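(* For any $\mu\in\mathbb{R}$ and $x>0$, the following pair of Fourier transforms holds: for every $\xi\in\mathbb{R}$, $$\int_{-\infty}^{\infty}W_{\mu,i\tau}(x)\,e^{-i\tau\xi}\,d\tau=2^{-\mu}\sqrt{\pi x}\,e^{\frac{x}{4}\left(1-\cosh(\xi)\right)}\,D_{2\mu}\left(\sqrt{2x}\,\cosh\left(\frac{\xi}{2}\right)\right),$$ and, for every $\tau\in\mathbb{R}$, $$W_{\mu,i\tau}(x)=\sqrt{\frac{x}{\pi}}\,\frac{e^{x/4}}{2^{\mu+1}}\int_{-\infty}^{\infty}e^{-\frac{x}{4}\cosh(\xi)}\,D_{2\mu}\left(\sqrt{2x}\,\cosh\left(\frac{\xi}{2}\right)\right)e^{i\tau\xi}\,d\xi.$$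
   Context: For $z>0$, Tricomi's function is $\Psi(a,c;z)=\frac{\Gamma(1-c)}{\Gamma(a-c+1)}\,{}_1F_1(a;c;z)+z^{1-c}\frac{\Gamma(c-1)}{\Gamma(a)}\,{}_1F_1(a-c+1;2-c;z)$ (for integer $c$ defined by continuity in $c$), where ${}_1F_1(a;c;z)=\sum_{k\ge 0}\frac{(a)_k}{(c)_k}\frac{z^k}{k!}$. The Whittaker function is $W_{\mu,\nu}(z)=e^{-z/2}z^{\nu+\frac12}\,\Psi\left(\tfrac12+\nu-\mu,\,2\nu+1;\,z\right)$; it is entire in $\mu$ and in $\nu$. The parabolic cylinder function is, for $z>0$, $D_{\mu}(z)=2^{\frac{\mu}{2}+\frac14}z^{-\frac12}W_{\frac{\mu}{2}+\frac14,\frac14}\left(\frac{z^2}{2}\right)$. *)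

(* Defs.v *)
From mathcomp Require Import all_boot all_order all_algebra.
From mathcomp Require Import complex.
From mathcomp Require Import all_classical all_reals all_analysis.

Set Implicit Arguments.
Unset Strict Implicit.
Unset Printing Implicit Defensive.

Import Order.TTheory GRing.Theory Num.Theory.
Import numFieldNormedType.Exports.

Local Open Scope classical_set_scope.
Local Open Scope ring_scope.
Local Open Scope complex_scope.

Section Defs.
Context {R : realType}.
Implicit Types (a c z w mu nu : R[i]) (x : R).

Definition cosh x : R := (expR x + expR (- x)) / 2.

Definition cexp w : R[i] :=
  (expR (complex.Re w) * cos (complex.Im w))
  +i* (expR (complex.Re w) * sin (complex.Im w)).

(* Principal power [x ^ w], meaningful for [0 < x] only. *)
Definition cpow x w : R[i] := cexp (w * (ln x)%:C).

Definition cintegrable (D : set R) (f : R -> R[i]) : Prop :=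
  lebesgue_measure.-integrable D (EFin \o (fun t => complex.Re (f t))) /\
  lebesgue_measure.-integrable D (EFin \o (fun t => complex.Im (f t))).

Definition cintegral (D : set R) (f : R -> R[i]) : R[i] :=
  (\int[lebesgue_measure]_(t in D) complex.Re (f t))
  +i* (\int[lebesgue_measure]_(t in D) complex.Im (f t)).

Definition pochhammer a (k : nat) : R[i] := \prod_(i < k) (a + i%:R).

Definition euler_integral z : R[i] :=
  cintegral `]0, +oo[ (fun t => cpow t (z - 1) * (expR (- t))%:C).

(* Euler's integral for [0 < Re z], continued to the left by
   [Gamma z = Gamma (z + n) / (z (z + 1) ... (z + n - 1))].  At the poles
   [z = 0, -1, ...] the denominator vanishes, so that [Gamma z = 0] and hence
   [(Gamma z)^-1 = 0], the value there of the entire function [1 / Gamma]. *)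
Definition Gamma z : R[i] :=
  let n := if 0 < complex.Re z then 0%N
           else (Num.truncn (- complex.Re z)).+1 in
  euler_integral (z + n%:R) / pochhammer z n.

(* [R[i]^o] gives [R[i]] the topology of the complex modulus. *)
Definition hyp1F1 a c z : R[i] :=
  limn (fun n => \sum_(0 <= k < n)
    (pochhammer a k / pochhammer c k * (z ^+ k / k`!%:R)) : R[i]^o).

Definition tricomi_nonint a c x : R[i] :=
  Gamma (1 - c) / Gamma (a - c + 1) * hyp1F1 a c x%:C
  + cpow x (1 - c) * (Gamma (c - 1) / Gamma a)
    * hyp1F1 (a - c + 1) (2 - c) x%:C.

Definition tricomi a c x : R[i] :=
  if `[< exists m : int, c = m%:~R >]
  then lim ((tricomi_nonint a c' x : R[i]^o) @[c' --> (c : R[i]^o)^'])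
  else tricomi_nonint a c x.

Definition whittakerW mu nu x : R[i] :=
  (expR (- x / 2))%:C * cpow x (nu + 2^-1)
  * tricomi (2^-1 + nu - mu) (2 * nu + 1) x.

Definition parabolicD mu x : R[i] :=
  cpow 2 (mu / 2 + 4^-1) * cpow x (- 2^-1)
  * whittakerW (mu / 2 + 4^-1) 4^-1 (x ^+ 2 / 2).

End Defs.

(* Main.v *)
Require Import Defs.
From mathcomp Require Import all_boot all_order all_algebra.
From mathcomp Require Import complex.
From mathcomp Require Import all_classical all_reals all_analysis.
From mathcomp Require Import measurable_realfun.
From mathcomp Require Import ring lra.

(* Everything reduces to
     W_{m, i tau}(x) = sqrt x e^{x/2} / (2 sqrt pi)
                         * int p_m(x cosh^2(xi/2)) e^{i tau xi} dxi,
     p_m(y) = e^{-y} sqrt y Psi(1/2 - m, 3/2; y),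
   since D_{2m}(sqrt(2x) cosh(xi/2)) = 2^m e^{y/2} p_m(y) at
   y = x cosh^2(xi/2): this is the second transform, and the first one is its
   Fourier inverse.
   For m < 0 one has Gamma(a) Psi(a, c; x) = J(a, c-a-1, x), where
     J(a, b, x) = int e^{au} (1 + e^u)^b e^{-x e^u} du
   (Euler's integral with t = e^u); this is proved by comparing Wronskians of
   solutions of Kummer's equation as x -> 0.  The identity then follows from
   Fubini's theorem and Gaussian integrals.  To go from m to m + 1, apply
   - y d/dy - (m + 1/2) to p_m: contiguity relations turn this into the shift
   of m on both sides.
   The three-term recurrence in m has coefficient (m + 1/2)^2 + tau^2, which
   yields an O(1/tau^2) decay, hence the integrability in tau that the
   inversion with a Gaussian regularization requires.  It also propagates in m
   the limit c -> 1 that defines W at tau = 0. *)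

Set Implicit Arguments.
Unset Strict Implicit.
Unset Printing Implicit Defensive.

Import Order.TTheory GRing.Theory Num.Theory.
Import numFieldNormedType.Exports.

Local Open Scope classical_set_scope.
Local Open Scope ring_scope.
Local Open Scope complex_scope.

Local Notation Re := (@complex.Re _).
Local Notation Im := (@complex.Im _).
Local Notation normc := (@ComplexField.Normc.normc _).

(** * Complex exponentials *)

Section complex_exponential.
Context {R : realType}.
Implicit Types (z w a b : R[i]) (x y s t : R).

(** Why the proof starts at [m < 0]: Kummer's transformation gives
    [p_m(y) = e^{-y} Psi(-m, 1/2; y)], whose Euler integral converges only for [-m > 0], whereas
    that of [W] asks for [1/2 - m > 0]. For [m < 0] both are Laplace integrals with positive
    kernels, so that Fubini applies. The connection formula is used only for [0 < Re c < 2]. There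
    [c] and [2 - c] both have positive real part, so no Pochhammer denominator vanishes in either
    Kummer series. The strip contains 1/2, 3/2, the line [1 + 2 i tau] and the disc of radius 1/2
    around 1. The point [tau = 0] is delicate because the definition of [tricomi] there moves [c]
    alone, with [a] fixed, while varying [tau] moves [a] and [c] together. Continuity of the
    integral in [tau] therefore does not identify [W_{m,0}], and a separate limit in [c] is needed.
    No asymptotics of [W] in [tau] are available; its only direct bound is the L1 norm of
    [p_m(x cosh^2(xi/2))], which is uniform in [tau]. *)

Lemma complexP z w : Re z = Re w -> Im z = Im w -> z = w.
Proof. by case: z w => [? ?] [? ?] /= -> ->. Qed.

Lemma cReD z w : Re (z + w) = Re z + Re w. Proof. by case: z w => [? ?] []. Qed.
Lemma cImD z w : Im (z + w) = Im z + Im w. Proof. by case: z w => [? ?] []. Qed.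
Lemma cReN z : Re (- z) = - Re z. Proof. by case: z. Qed.
Lemma cImN z : Im (- z) = - Im z. Proof. by case: z. Qed.
Lemma cReB z w : Re (z - w) = Re z - Re w. Proof. by rewrite cReD cReN. Qed.
Lemma cImB z w : Im (z - w) = Im z - Im w. Proof. by rewrite cImD cImN. Qed.
Lemma cReM z w : Re (z * w) = Re z * Re w - Im z * Im w.
Proof. by case: z w => [? ?] []. Qed.
Lemma cImM z w : Im (z * w) = Re z * Im w + Im z * Re w.
Proof. by case: z w => [? ?] []. Qed.
Lemma cReMr z x : Re (z * x%:C) = Re z * x.
Proof. by rewrite cReM /= mulr0 subr0. Qed.
Lemma cImMr z x : Im (z * x%:C) = Im z * x.
Proof. by rewrite cImM /= mulr0 add0r. Qed.
Lemma cReMl z x : Re (x%:C * z) = x * Re z. Proof. by rewrite mulrC cReMr mulrC. Qed.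
Lemma cImMl z x : Im (x%:C * z) = x * Im z. Proof. by rewrite mulrC cImMr mulrC. Qed.
Lemma cRe_nat n : Re (n%:R : R[i]) = n%:R.
Proof. by elim: n => // n IH; rewrite -addn1 !natrD cReD IH. Qed.
Lemma cIm_nat n : Im (n%:R : R[i]) = 0.
Proof. by elim: n => // n IH; rewrite -addn1 !natrD cImD IH addr0. Qed.
Lemma natC n : n%:R = (n%:R : R)%:C.
Proof. by rewrite rmorph_nat. Qed.

Definition cRIE := (cReB, cImB, cReD, cImD, cReN, cImN, cReMr, cImMr, cReMl, cImMl, cReM, cImM, cRe_nat, cIm_nat).

Lemma rcD x y : (x + y)%:C = x%:C + y%:C. Proof. exact: rmorphD. Qed.
Lemma rcN x : (- x)%:C = - x%:C. Proof. exact: rmorphN. Qed.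
Lemma rcB x y : (x - y)%:C = x%:C - y%:C. Proof. exact: rmorphB. Qed.
Lemma rcM x y : (x * y)%:C = x%:C * y%:C. Proof. exact: rmorphM. Qed.
Lemma rcV x : (x^-1)%:C = (x%:C)^-1. Proof. exact: fmorphV. Qed.
Lemma rcX x n : (x ^+ n)%:C = x%:C ^+ n. Proof. exact: rmorphXn. Qed.
Lemma rc_eq0 x : (x%:C == 0) = (x == 0). Proof. exact: fmorph_eq0. Qed.

Definition rcE := (rcB, rcD, rcN, rcM, rcV, rcX).

Lemma normc_ge0 z : 0 <= normc z.
Proof. by case: z => a b /=; exact: sqrtr_ge0. Qed.

Lemma normcM z w : normc (z * w) = normc z * normc w.
Proof. exact: ComplexField.Normc.normcM. Qed.

Lemma normcV z : normc z^-1 = (normc z)^-1.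
Proof. exact: ComplexField.Normc.normcV. Qed.

Lemma normc_real x : normc x%:C = `|x|.
Proof. by rewrite /= expr0n addr0 sqrtr_sqr. Qed.

Lemma normcN z : normc (- z) = normc z.
Proof. by case: z => a b /=; rewrite !sqrrN. Qed.

Lemma normc_sqr z : normc z ^+ 2 = Re z ^+ 2 + Im z ^+ 2.
Proof. by case: z => a b /=; rewrite sqr_sqrtr// addr_ge0 ?sqr_ge0. Qed.

Lemma normRe_le z : `|Re z| <= normc z.
Proof.
by rewrite -ler_sqr ?nnegrE ?normc_ge0// normc_sqr real_normK ?num_real// lerDl sqr_ge0.
Qed.

Lemma normIm_le z : `|Im z| <= normc z.
Proof.
by rewrite -ler_sqr ?nnegrE ?normc_ge0// normc_sqr real_normK ?num_real// lerDr sqr_ge0.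
Qed.

Lemma normc_le z : normc z <= `|Re z| + `|Im z|.
Proof.
rewrite -ler_sqr ?nnegrE ?normc_ge0 ?addr_ge0// normc_sqr sqrrD.
by rewrite !real_normK ?num_real// -addrA lerD2l lerDr mulrn_wge0// mulr_ge0.
Qed.

Lemma cexpD z w : cexp (z + w) = cexp z * cexp w.
Proof.
by apply: complexP; rewrite /cexp ?cRIE /= expRD ?cosD ?sinD; ring.
Qed.

Lemma cexp0 : cexp (0 : R[i]) = 1.
Proof. by rewrite /cexp /= expR0 cos0 sin0 mulr1 mulr0. Qed.

Lemma cexp_real x : cexp x%:C = (expR x)%:C.
Proof. by rewrite /cexp /= cos0 sin0 mulr1 mulr0. Qed.

Lemma normc_cexp z : normc (cexp z) = expR (Re z).
Proof.
rewrite /cexp /= !exprMn -mulrDr cos2Dsin2 mulr1 sqrtr_sqr.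
by rewrite ger0_norm// expR_ge0.
Qed.

Lemma cexpN z : cexp (- z) = (cexp z)^-1.
Proof.
have h : cexp z * cexp (- z) = 1 by rewrite -cexpD subrr cexp0.
apply: (mulfI (x := cexp z)); last first.
  rewrite h divff//; apply/eqP => e; move: h; rewrite e mul0r => /eqP.
  by rewrite eq_sym oner_eq0.
by apply/eqP => e; move: h; rewrite e mul0r => /eqP; rewrite eq_sym oner_eq0.
Qed.

Lemma cexp_neq0 z : cexp z != 0.
Proof.
apply/eqP => e; have := normc_cexp z; rewrite e /= expr0n addr0 sqrtr0.
by move/esym/eqP; rewrite expR_eq0.
Qed.

Lemma cpowD x z w : cpow x (z + w) = cpow x z * cpow x w.
Proof. by rewrite /cpow mulrDl cexpD. Qed.

Lemma cpowN x z : cpow x (- z) = (cpow x z)^-1.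
Proof. by rewrite /cpow mulNr cexpN. Qed.

Lemma cpowB x z w : cpow x (z - w) = cpow x z / cpow x w.
Proof. by rewrite cpowD cpowN. Qed.

Lemma cpow0 x : cpow x 0 = 1.
Proof. by rewrite /cpow mul0r cexp0. Qed.

Lemma cpow1 x : 0 < x -> cpow x 1 = x%:C.
Proof. by move=> x0; rewrite /cpow mul1r cexp_real lnK. Qed.

Lemma cpow_real x s : 0 < x -> cpow x s%:C = (x `^ s)%:C.
Proof.
by move=> x0; rewrite /cpow -rmorphM /= cexp_real /powR gt_eqF.
Qed.

Lemma normc_cpow x z : 0 < x -> normc (cpow x z) = x `^ (Re z).
Proof. by move=> x0; rewrite /cpow normc_cexp cRIE /powR gt_eqF. Qed.

Lemma cpow_neq0 x z : cpow x z != 0. Proof. exact: cexp_neq0. Qed.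

Lemma cpowM x y z : 0 < x -> 0 < y -> cpow (x * y) z = cpow x z * cpow y z.
Proof. by move=> x0 y0; rewrite /cpow lnM// rmorphD mulrDr cexpD. Qed.

Lemma cpowV x z : 0 < x -> cpow x^-1 z = cpow x (- z).
Proof. by move=> x0; rewrite /cpow lnV// rmorphN mulrN mulNr. Qed.

Lemma cpow_expR x z : cpow (expR x) z = cexp (z * x%:C).
Proof. by rewrite /cpow expRK. Qed.

Lemma cpowS x z : 0 < x -> cpow x (z + 1) = cpow x z * x%:C.
Proof. by move=> x0; rewrite cpowD cpow1. Qed.

End complex_exponential.

(** * Integrals over the real line *)

Section real_integrals.
Context {R : realType}.
Local Notation mu := (@lebesgue_measure R).
Implicit Types f g : R -> R.

Definition rintegrable f := mu.-integrable setT (EFin \o f).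

Lemma rintegrable_le f g : measurable_fun setT f -> rintegrable g ->
  (forall t, `|f t| <= g t) -> rintegrable f.
Proof.
move=> mf ig fg; apply: le_integrable ig => //; first exact/measurable_EFinP.
by move=> x _ /=; rewrite lee_fin (le_trans (fg x))// ler_norm.
Qed.

Lemma rintegrable_meas f : rintegrable f -> measurable_fun setT f.
Proof. by move=> /integrableP[/measurable_EFinP]. Qed.

Lemma rintegrableD f g : rintegrable f -> rintegrable g ->
  rintegrable (fun t => f t + g t).
Proof. by move=> fi gi; have := integrableD measurableT fi gi. Qed.

Lemma rintegrableZ f k : rintegrable f -> rintegrable (fun t => k * f t).
Proof. by move=> fi; have := integrableZl measurableT k fi. Qed.

Lemma rintegrable_ext f g : f =1 g -> rintegrable f -> rintegrable g.
Proof. by move=> /funext ->. Qed.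

Lemma rintegrable_norm f : rintegrable f -> rintegrable (fun t => `|f t|).
Proof.
move=> fi; apply: (@rintegrable_le _ (fun t => `|f t|)).
- by apply: measurableT_comp; last exact: rintegrable_meas.
- exact: integrable_norm fi.
- by move=> t; rewrite normr_id.
Qed.

(** A majorant of the inner integrals in one order suffices: Tonelli turns [K] into joint
    integrability, and the other order follows. *)
Lemma rFubini (f g : R -> R -> R) (K : R -> R) :
  measurable_fun setT (fun p : R * R => f p.1 p.2) ->
  (forall x, rintegrable (g x)) -> (forall x y, `|f x y| <= g x y) ->
  (forall x, \int[mu]_y g x y <= K x) -> rintegrable K ->
  rintegrable (fun x => \int[mu]_y f x y) /\
  \int[mu]_x \int[mu]_y f x y = \int[mu]_y \int[mu]_x f x y.
Proof.
move=> mf ig fg gK iK.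
pose F (p : R * R) := (f p.1 p.2)%:E.
have mF : measurable_fun setT F by exact/measurable_EFinP.
have sx x : rintegrable (f x).
  apply: rintegrable_le (ig x) (fg x).
  by have := measurableT_comp mf (pair1_measurable x); apply.
have iF : (mu \x mu)%E.-integrable setT F.
  have [_ h] := integrable12ltyP mu mu mF; apply: h.
  apply: (@le_lt_trans _ _ (\int[mu]_x (`|K x|)%:E)%E).
    apply: ge0_le_integral => //.
    - by move=> x _; exact: integral_ge0.
    - have := @measurable_fun_fubini_tonelli_F _ _ _ _ _ mu (abse \o F); apply.
        exact: measurableT_comp.
      by move=> p; exact: abse_ge0.
    - by apply/measurable_EFinP; apply: measurableT_comp => //; exact: rintegrable_meas.
    - move=> x _.
      apply: (@le_trans _ _ (\int[mu]_y (g x y)%:E)%E).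
        apply: ge0_le_integral => //.
        + apply: measurableT_comp => //; apply/measurable_EFinP.
          exact: (rintegrable_meas (sx x)).
        + by apply/measurable_EFinP; exact: (rintegrable_meas (ig x)).
        + by move=> y _; rewrite /= lee_fin fg.
      rewrite -[leLHS]fineK; last by apply: integrable_fin_num => //; exact: (ig x).
      by rewrite lee_fin (le_trans (gK x))// ler_norm.
  by have /integrableP[_] := rintegrable_norm iK; under eq_integral do rewrite /= normr_id.
have e1 x : (\int[mu]_y F (x, y))%E = (\int[mu]_y f x y)%:E.
  by rewrite fineK//; apply: integrable_fin_num => //; exact: sx.
have i1 : rintegrable (fun x => \int[mu]_y f x y).
  have := integrable_fubini_F iF; rewrite /fubini_F.
  by under eq_fun do rewrite e1.
have mG := measurable_fubini_G iF.
(* For exceptional [y] the inner integral may fail to be finite, and [fine] would replace it by a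
   default value; the two functions of [y] therefore agree only almost everywhere. *)
have ae2 : ae_eq mu setT (fubini_G mu F) (fun y => (\int[mu]_x f x y)%:E).
  have := ae_integrable2 iF; apply: filterS => y iy _.
  by rewrite /fubini_G /= /Rintegral fineK//; exact: integrable_fin_num.
split => //.
rewrite /Rintegral; congr fine.
transitivity (\int[mu]_x \int[mu]_y F (x, y))%E.
  by apply: eq_integral => x _; rewrite e1.
rewrite (Fubini iF); apply: ae_eq_integral => //.
by apply/measurable_EFinP; apply: measurableT_comp => //; exact: measurable_int mG.
Qed.

End real_integrals.

Section complex_integrals.
Context {R : realType}.
Local Notation mu := (@lebesgue_measure R).

Definition cmeas d (T : measurableType d) (f : T -> R[i]) :=
  measurable_fun setT (fun t => Re (f t)) /\ measurable_fun setT (fun t => Im (f t)).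

Section cmeas.
Context d (T : measurableType d).
Implicit Types f g : T -> R[i].

Lemma cmeas_cst k : cmeas (fun _ : T => k). Proof. by split. Qed.

Lemma cmeasM f g : cmeas f -> cmeas g -> cmeas (fun t => f t * g t).
Proof.
move=> [f1 f2] [g1 g2]; split; under eq_fun do rewrite ?cReM ?cImM.
  by apply: measurable_funB; exact: measurable_funM.
by apply: measurable_funD; exact: measurable_funM.
Qed.

Lemma cmeas_real (f : T -> R) : measurable_fun setT f -> cmeas (fun t => (f t)%:C).
Proof. by split. Qed.

Lemma cmeas_cexp f : cmeas f -> cmeas (fun t => cexp (f t)).
Proof.
move=> [f1 f2]; split => /=; apply: measurable_funM.
- by apply: measurableT_comp f1; exact: measurable_expR.
- apply: measurableT_comp f2; apply: continuous_measurable_fun; exact: continuous_cos.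
- by apply: measurableT_comp f1; exact: measurable_expR.
- apply: measurableT_comp f2; apply: continuous_measurable_fun; exact: continuous_sin.
Qed.

Lemma cmeas_cpow (f : T -> R) b : measurable_fun setT f -> cmeas (fun t => cpow (f t) b).
Proof.
move=> mf; apply: cmeas_cexp; apply: cmeasM; first exact: cmeas_cst.
by apply: cmeas_real; apply: measurableT_comp => //; exact: measurable_ln.
Qed.

Lemma cmeas_comp (f : R -> R[i]) (h : T -> R) : cmeas f -> measurable_fun setT h ->
  cmeas (fun t => f (h t)).
Proof.
by move=> [f1 f2] mh; split; [exact: (measurableT_comp f1)|exact: (measurableT_comp f2)].
Qed.

Lemma measurable_normc f : cmeas f -> measurable_fun setT (fun t => normc (f t)).
Proof.
move=> [f1 f2].
have -> : (fun t => normc (f t)) = (fun t => Num.sqrt (Re (f t) ^+ 2 + Im (f t) ^+ 2)).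
  by apply/funext => t; case: (f t).
apply: (measurableT_comp (f := @Num.sqrt R)).
  by apply: continuous_measurable_fun; exact: sqrt_continuous.
by apply: measurable_funD; exact: measurable_funX.
Qed.

End cmeas.

Implicit Types (f g : R -> R[i]) (k z : R[i]).
Local Notation cintble := (@cintegrable R setT).
Local Notation cint := (@cintegral R setT).

Lemma cintble_meas f : cintble f -> cmeas f.
Proof. by move=> [f1 f2]; split; exact: rintegrable_meas. Qed.

Lemma cintble_le f (g : R -> R) : cmeas f -> rintegrable g ->
  (forall t, normc (f t) <= g t) -> cintble f.
Proof.
move=> [f1 f2] ig fg; split; apply: rintegrable_le ig _ => // t.
  exact: le_trans (normRe_le _) (fg t).
exact: le_trans (normIm_le _) (fg t).
Qed.

Lemma cintble_normc f : cintble f -> rintegrable (fun t => normc (f t)).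
Proof.
move=> fi; have [f1 f2] := fi.
apply: (@rintegrable_le _ _ (fun t => `|Re (f t)| + `|Im (f t)|)).
- by apply: measurable_normc; exact: cintble_meas.
- by apply: rintegrableD; exact: rintegrable_norm.
- by move=> t; rewrite ger0_norm ?normc_ge0// normc_le.
Qed.

Lemma cintble_ext f g : f =1 g -> cintble f -> cintble g.
Proof. by move=> /funext ->. Qed.

Lemma eq_cint f g : f =1 g -> cint f = cint g.
Proof. by move=> /funext ->. Qed.

Lemma cintbleD f g : cintble f -> cintble g -> cintble (fun t => f t + g t).
Proof.
move=> [f1 f2] [g1 g2]; split.
  by apply: (rintegrable_ext _ (rintegrableD f1 g1)) => t /=; rewrite cRIE.
by apply: (rintegrable_ext _ (rintegrableD f2 g2)) => t /=; rewrite cRIE.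
Qed.

Lemma cintbleZ f k : cintble f -> cintble (fun t => k * f t).
Proof.
move=> fi; apply: (@cintble_le _ (fun t => normc k * normc (f t))).
- by apply: cmeasM; [exact: cmeas_cst|exact: cintble_meas].
- by apply: rintegrableZ; exact: cintble_normc.
- by move=> t; rewrite normcM.
Qed.

Lemma cintbleZr f k : cintble f -> cintble (fun t => f t * k).
Proof. by move=> fi; apply: (cintble_ext _ (cintbleZ k fi)) => t; rewrite mulrC. Qed.

Lemma cintbleB f g : cintble f -> cintble g -> cintble (fun t => f t - g t).
Proof.
move=> fi gi; apply: (cintble_ext _ (cintbleD fi (cintbleZ (-1) gi))) => t.
by rewrite mulN1r.
Qed.

Lemma cintbleR (f : R -> R) : rintegrable f -> cintble (fun t => (f t)%:C).
Proof.
move=> fi; split => //=; apply: (rintegrable_ext _ (rintegrableZ 0 fi)) => t.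
by rewrite mul0r.
Qed.

Lemma cintD f g : cintble f -> cintble g ->
  cint (fun t => f t + g t) = cint f + cint g.
Proof.
move=> [f1 f2] [g1 g2]; apply: complexP; rewrite cRIE /=.
  by under eq_Rintegral do rewrite cRIE; rewrite RintegralD.
by under eq_Rintegral do rewrite cRIE; rewrite RintegralD.
Qed.

Lemma cintZ f k : cintble f -> cint (fun t => k * f t) = k * cint f.
Proof.
move=> [f1 f2]; apply: complexP; rewrite cRIE /=.
  under eq_Rintegral do rewrite cReM.
  by rewrite RintegralB ?RintegralZl//; exact: rintegrableZ.
under eq_Rintegral do rewrite cImM.
by rewrite RintegralD ?RintegralZl//; exact: rintegrableZ.
Qed.

Lemma cintZr f k : cintble f -> cint (fun t => f t * k) = cint f * k.
Proof. by move=> fi; rewrite mulrC -cintZ//; apply: eq_cint => t; rewrite mulrC. Qed.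

Lemma cintB f g : cintble f -> cintble g ->
  cint (fun t => f t - g t) = cint f - cint g.
Proof.
move=> fi gi; rewrite -mulN1r -cintZ// -cintD//; last exact: cintbleZ.
by apply: eq_cint => t; rewrite mulN1r.
Qed.

Lemma cintR (f : R -> R) : cint (fun t => (f t)%:C) = (\int[mu]_t f t)%:C.
Proof. by rewrite /cintegral /=; congr (_ +i* _); rewrite Rintegral_cst// mul0r. Qed.

Lemma le_rint (f g : R -> R) : rintegrable f -> rintegrable g ->
  (forall t, f t <= g t) -> \int[mu]_t f t <= \int[mu]_t g t.
Proof. by move=> fi gi fg; apply: le_Rintegral. Qed.

(** The factor 2 comes from bounding real and imaginary parts separately; the value of the constant
    never matters later. *)
Lemma normc_cint_le f (g : R -> R) : cmeas f -> rintegrable g ->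
  (forall t, normc (f t) <= g t) -> normc (cint f) <= 2 * \int[mu]_t g t.
Proof.
move=> mf gi fg; have [f1 f2] := cintble_le mf gi fg.
apply: (le_trans (normc_le _)); rewrite mulr_natl mulr2n /=.
apply: lerD; apply: (le_trans (le_normr_Rintegral _ _)) => //;
  apply: le_rint => // [|t]; try exact: rintegrable_norm.
- exact: le_trans (normRe_le _) (fg t).
- exact: le_trans (normIm_le _) (fg t).
Qed.

Lemma cFubini_int (f : R -> R -> R[i]) (g : R -> R -> R) (K : R -> R) :
  cmeas (fun p : R * R => f p.1 p.2) ->
  (forall x, rintegrable (g x)) -> (forall x y, normc (f x y) <= g x y) ->
  (forall x, \int[mu]_y g x y <= K x) -> rintegrable K ->
  cintble (fun x => cint (f x)) /\
  cint (fun x => cint (f x)) = cint (fun y => cint (fun x => f x y)).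
Proof.
move=> [m1 m2] ig fg gK iK.
have [|||||i1 e1] := @rFubini R (fun x y => Re (f x y)) g K => //.
  by move=> x y; exact: le_trans (normRe_le _) (fg x y).
have [|||||i2 e2] := @rFubini R (fun x y => Im (f x y)) g K => //.
  by move=> x y; exact: le_trans (normIm_le _) (fg x y).
by split => //; apply: complexP.
Qed.

Lemma cFubini (f : R -> R -> R[i]) (g : R -> R -> R) (K : R -> R) :
  cmeas (fun p : R * R => f p.1 p.2) ->
  (forall x, rintegrable (g x)) -> (forall x y, normc (f x y) <= g x y) ->
  (forall x, \int[mu]_y g x y <= K x) -> rintegrable K ->
  cint (fun x => cint (f x)) = cint (fun y => cint (fun x => f x y)).
Proof. by move=> m ig fg gK iK; have [] := cFubini_int m ig fg gK iK. Qed.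

End complex_integrals.
Notation cintble := (cintegrable setT).
Notation cint := (cintegral setT).

(** * Derivatives, substitution and limits *)

Section real_derivatives.
Context {R : realType}.
Implicit Types (f g : R -> R) (x y d e : R).

Definition rder f x d := is_derive (x : R) (1 : R) f d.

Lemma rder_ext f g x d : f =1 g -> rder f x d -> rder g x d.
Proof. by move=> /funext ->. Qed.

Lemma rder_eq f x d e : rder f x d -> d = e -> rder f x e.
Proof. by move=> h <-. Qed.

Lemma rder_cst k x : rder (fun=> k) x 0. Proof. exact: is_derive_cst. Qed.

Lemma rder_id x : rder (fun t => t) x 1. Proof. exact: is_derive_id. Qed.

Lemma rderD f g x d e : rder f x d -> rder g x e -> rder (fun t => f t + g t) x (d + e).
Proof. by move=> hf hg; have := is_deriveD hf hg. Qed.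

Lemma rderN f x d : rder f x d -> rder (fun t => - f t) x (- d).
Proof. by move=> hf; have := is_deriveN hf. Qed.

Lemma rderB f g x d e : rder f x d -> rder g x e -> rder (fun t => f t - g t) x (d - e).
Proof. by move=> hf hg; have := is_deriveB hf hg. Qed.

Lemma rderM f g x d e : rder f x d -> rder g x e ->
  rder (fun t => f t * g t) x (d * g x + f x * e).
Proof.
move=> hf hg; have := is_deriveM hf hg; rewrite /GRing.scale /= => h.
by apply: rder_eq h _; rewrite addrC mulrC.
Qed.

Lemma rder_comp f g x d e : rder f (g x) d -> rder g x e -> rder (fun t => f (g t)) x (d * e).
Proof. by move=> hf hg; have := is_derive1_comp hf hg. Qed.

Lemma rder_cont f x d : rder f x d -> {for x, continuous f}.
Proof. by case=> df _; apply: differentiable_continuous; apply/derivable1_diffP. Qed.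

Lemma rder_derive1 f x d : rder f x d -> f^`()%classic x = d.
Proof. by move=> [df e]; rewrite derive1E. Qed.

Lemma rder_cst_itv f x y : (forall t, 0 < t -> rder f t 0) -> 0 < x -> 0 < y -> f x = f y.
Proof.
move=> h; wlog xy : x y / x < y => [H x0 y0|].
  by have [/H|/H h1|->//] := ltgtP x y; [apply|rewrite h1].
move=> x0 y0.
have hh t : x <= t -> rder f t 0 by move=> xt; apply: h; exact: lt_le_trans xt.
have [t||c _ /eqP] := @MVT R f (fun=> 0) x y xy.
- by rewrite in_itv /= => /andP[/ltW/hh].
- apply: derivable_within_continuous => t; rewrite in_itv /= => /andP[/hh[]//].
- by rewrite mul0r subr_eq0 => /eqP ->.
Qed.

Lemma homo_rder f (df : R -> R) : (forall x, rder f x (df x)) ->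
  (forall x, 0 < df x) -> {homo f : x y / x < y}.
Proof.
move=> h df0 x y xy; rewrite -subr_gt0.
have [t _||c _ ->] := @MVT R f df x y xy; first exact: h.
- by apply: derivable_within_continuous => t _; case: (h t).
- by rewrite mulr_gt0// subr_gt0.
Qed.

Lemma MVT_bound f (df : R -> R) (M : R) : (forall x, rder f x (df x)) ->
  (forall x, `|df x| <= M) -> forall x y, `|f x - f y| <= M * `|x - y|.
Proof.
move=> h dM x y; wlog xy : x y / y < x => [H|].
  have [yx|xy|->] := ltgtP y x.
    exact: H.
    by rewrite distrC (distrC x); exact: H.
    by rewrite !subrr normr0 mulr0.
have [t _||c _ ->] := @MVT R f df y x xy; first exact: h.
- by apply: derivable_within_continuous => t _; case: (h t).
- by rewrite normrM ler_wpM2r.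
Qed.

End real_derivatives.

(** * Change of variables along an increasing bijection of the line onto [A] *)

Section substitution.
Context {R : realType}.
Local Notation mu := (@lebesgue_measure R).

Section phi.
Variables (phi dphi : R -> R) (A : set R).
Hypothesis hphi : forall x, rder phi x (dphi x).
Hypothesis cdphi : continuous dphi.
Hypothesis dphi_gt0 : forall x, 0 < dphi x.
Hypothesis rphi : range phi = A.
Hypothesis mA : measurable A.

Let cphi : continuous phi. Proof. by move=> x; apply: rder_cont. Qed.
Let dphiE : phi^`()%classic = dphi.
Proof. by apply/funext => x; exact: rder_derive1. Qed.

Let I n := `[- n%:R, n%:R]%classic : set R.
Let J n := `[phi (- n%:R), phi n%:R]%classic.

Let I_cover : \bigcup_n I n = setT.
Proof.
apply/seteqP; split => // x _; exists (Num.truncn `|x|).+1 => //.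
rewrite /I /= in_itv /= -ler_norml; apply/ltW.
by have /andP[] := truncn_itv (normr_ge0 x).
Qed.

Let le_phi : {mono phi : x y / x <= y}.
Proof. exact: le_mono (homo_rder hphi dphi_gt0). Qed.

Let J_cover : \bigcup_n J n = A.
Proof.
rewrite -rphi; apply/seteqP; split => y.
  move=> [n _] /= hy.
  have [x _ <-] : exists2 x, x \in `[(- n%:R : R), n%:R] & phi x = y.
    apply: IVT.
    - by rewrite ge0_cp// ?oppr_le0.
    - by apply: continuous_subspaceT.
    - move: hy; rewrite /J /= in_itv /= => /andP[h1 h2].
      by rewrite ge_min h1 /= le_max h2 orbT.
  by exists x.
move=> [x _ <-]; have : setT x by [].
by rewrite -I_cover => -[n _]; rewrite /I /= in_itv /= => /andP[h1 h2]; exists n => //=;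
  rewrite /J /= in_itv /= !le_phi h1 h2.
Qed.

(** On each [[-n, n]] this is the substitution rule for compact intervals; [phi] maps these onto the
    [J n], which exhaust [A], and monotone convergence passes to the limit on both sides. *)
Let ge0_integral_subst (G : R -> R) : measurable_fun A G ->
  (forall y, A y -> {for y, continuous G}) -> (forall y, 0 <= G y) ->
  (\int[mu]_(y in A) (G y)%:E = \int[mu]_u (G (phi u) * dphi u)%:E)%E.
Proof.
move=> mG cG G0.
have mGphi : measurable_fun setT (fun u => G (phi u) * dphi u).
  apply: continuous_measurable_fun => u; apply: cvgM; last exact: cdphi.
  apply: (continuous_comp (f := phi) (g := G)); first exact: cphi.
  by apply: cG; rewrite -rphi; exists u.
have c1 : (\int[mu]_(y in J n) (G y)%:E @[n --> \oo] --> \int[mu]_(y in A) (G y)%:E)%E.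
  rewrite -J_cover; apply: ge0_nondecreasing_set_cvg_integral => //.
  - move=> n m nm; apply/subsetPset => y; rewrite /J /= !in_itv /= => /andP[h1 h2].
    by rewrite (le_trans _ h1) ?(le_trans h2)// le_phi ?lerN2 ler_nat.
  - by move=> n; exact: measurable_itv.
  - move=> n; apply/measurable_EFinP; apply: measurable_funS mG => //.
    by rewrite -J_cover; exact: bigcup_sup.
  - by move=> n x _; rewrite lee_fin.
have c2 : (\int[mu]_(y in I n) (G (phi y) * dphi y)%:E @[n --> \oo] -->
           \int[mu]_y (G (phi y) * dphi y)%:E)%E.
  rewrite -[in X in _ --> X]I_cover; apply: ge0_nondecreasing_set_cvg_integral => //.
  - move=> n m nm; apply/subsetPset => y; rewrite /I /= !in_itv /= => /andP[h1 h2].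
    by rewrite (le_trans _ h1) ?(le_trans h2)// ?lerN2 ler_nat.
  - by move=> n; exact: measurable_itv.
  - move=> n; apply/measurable_EFinP; exact: measurable_funTS.
  - by move=> n x _; rewrite lee_fin mulr_ge0// ltW.
apply: (cvg_unique _ c1 _) => //; apply: cvg_trans c2; apply: near_eq_cvg.
apply: nearW => n; rewrite /I /J.
rewrite (@integration_by_substitution_increasing _ phi G (- n%:R) n%:R)//.
- by rewrite dphiE.
- by rewrite ge0_cp// oppr_le0.
- by move=> x y _ _; exact: (homo_rder hphi dphi_gt0).
- by rewrite dphiE => x _; exact: cdphi.
- by rewrite dphiE; apply/cvg_ex; exists (dphi (- n%:R)); apply: cvg_at_right_filter; exact: cdphi.
- by rewrite dphiE; apply/cvg_ex; exists (dphi (n%:R)); apply: cvg_at_left_filter; exact: cdphi.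
- split; first by move=> x _; case: (hphi x).
    by apply: cvg_at_right_filter; exact: cphi.
  by apply: cvg_at_left_filter; exact: cphi.
- apply: continuous_in_subspaceT => y; rewrite inE => yJ; apply: cG.
  by rewrite -J_cover; exists n.
Qed.

(** The equality is between extended reals and needs no integrability: positive and negative parts
    are substituted separately, and [dphi > 0] passes through the maximum with 0. *)
Lemma integral_subst (G : R -> R) : measurable_fun A G ->
  (forall y, A y -> {for y, continuous G}) ->
  (\int[mu]_(y in A) (G y)%:E = \int[mu]_u (G (phi u) * dphi u)%:E)%E.
Proof.
move=> mG cG; rewrite integralE [RHS]integralE.
have e u v : Num.max (v * dphi u) 0 = Num.max v 0 * dphi u.
  by rewrite maxr_pMl ?mul0r// ltW.
congr (_ - _)%E.
  under eq_integral do rewrite funeposE -EFin_max.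
  under [RHS]eq_integral do rewrite funeposE -EFin_max e.
  apply: (ge0_integral_subst (G := fun y => Num.max (G y) 0)).
  - by apply: measurable_maxr.
  - by move=> y Ay; apply: continuous_max; [exact: cG|exact: cvg_cst].
  - by move=> y; rewrite le_max lexx orbT.
under eq_integral do rewrite funenegE -EFinN -EFin_max.
under [RHS]eq_integral do rewrite funenegE -EFinN -mulNr -EFin_max e.
apply: (ge0_integral_subst (G := fun y => Num.max (- G y) 0)).
- by apply: measurable_maxr => //; exact: measurableT_comp.
- move=> y Ay; apply: continuous_max; last exact: cvg_cst.
  by apply: cvgN; exact: cG.
- by move=> y; rewrite le_max lexx orbT.
Qed.

Lemma integrable_subst (G : R -> R) : measurable_fun A G ->
  (forall y, A y -> {for y, continuous G}) ->
  mu.-integrable A (EFin \o G) <-> rintegrable (fun u => G (phi u) * dphi u).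
Proof.
move=> mG cG.
have e : (\int[mu]_(y in A) `|(EFin \o G) y| = \int[mu]_u `|(G (phi u) * dphi u)%:E|)%E.
  under eq_integral do rewrite /=.
  under [RHS]eq_integral do rewrite /= normrM (gtr0_norm (dphi_gt0 _)).
  apply: (integral_subst (G := fun y => `|G y|)); first exact: measurableT_comp.
  by move=> y Ay; apply: cvg_norm; exact: cG.
split => /integrableP[_ h]; apply/integrableP; split.
- apply/measurable_EFinP; apply: continuous_measurable_fun => u; apply: cvgM; last exact: cdphi.
  apply: (continuous_comp (f := phi) (g := G)); first exact: cphi.
  by apply: cG; rewrite -rphi; exists u.
- by rewrite -e.
- exact/measurable_EFinP.
- by rewrite e.
Qed.

Lemma cint_subst (f : R -> R[i]) :
  measurable_fun A (fun t => Re (f t)) -> measurable_fun A (fun t => Im (f t)) ->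
  (forall y, A y -> {for y, continuous (fun t => Re (f t))}) ->
  (forall y, A y -> {for y, continuous (fun t => Im (f t))}) ->
  cintegral A f = cint (fun u => f (phi u) * (dphi u)%:C) /\
  (cintegrable A f <-> cintble (fun u => f (phi u) * (dphi u)%:C)).
Proof.
move=> m1 m2 c1 c2; split.
  apply: complexP; rewrite /= /Rintegral; congr fine.
    by under [RHS]eq_integral do rewrite cReMr; exact: (integral_subst m1 c1).
  by under [RHS]eq_integral do rewrite cImMr; exact: (integral_subst m2 c2).
rewrite /cintegrable; have i1 := integrable_subst m1 c1; have i2 := integrable_subst m2 c2.
have -> : EFin \o (fun t => Re (f (phi t) * (dphi t)%:C)) =
   (fun u => (Re (f (phi u)) * dphi u)%:E) by apply/funext => u; rewrite /= cReMr.
have -> : EFin \o (fun t => Im (f (phi t) * (dphi t)%:C)) =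
   (fun u => (Im (f (phi u)) * dphi u)%:E) by apply/funext => u; rewrite /= cImMr.
by split=> -[/i1 h1 /i2 h2].
Qed.

End phi.

End substitution.

Section complex_derivatives.
Context {R : realType}.
Implicit Types (f g : R -> R[i]) (x : R) (d e k : R[i]).

Definition cder f x d :=
  rder (fun t => Re (f t)) x (Re d) /\ rder (fun t => Im (f t)) x (Im d).

Lemma cder_ext f g x d : f =1 g -> cder f x d -> cder g x d.
Proof. by move=> /funext ->. Qed.

Lemma cder_eq f x d e : cder f x d -> d = e -> cder f x e.
Proof. by move=> h <-. Qed.

Lemma cder_cst k x : cder (fun=> k) x 0. Proof. by split; exact: rder_cst. Qed.

Lemma cderD f g x d e : cder f x d -> cder g x e -> cder (fun t => f t + g t) x (d + e).
Proof.
move=> [f1 f2] [g1 g2]; split.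
  by apply: (rder_eq (rder_ext _ (rderD f1 g1))) => [t|]; rewrite cReD.
by apply: (rder_eq (rder_ext _ (rderD f2 g2))) => [t|]; rewrite cImD.
Qed.

Lemma cderM f g x d e : cder f x d -> cder g x e ->
  cder (fun t => f t * g t) x (d * g x + f x * e).
Proof.
move=> [f1 f2] [g1 g2]; split.
  apply: (rder_eq (rder_ext _ (rderB (rderM f1 g1) (rderM f2 g2)))) => [t|];
    rewrite ?cReM ?cReD ?cReM//; ring.
apply: (rder_eq (rder_ext _ (rderD (rderM f1 g2) (rderM f2 g1)))) => [t|];
  rewrite ?cImM ?cImD ?cImM//; ring.
Qed.

Lemma cderZ f x d k : cder f x d -> cder (fun t => k * f t) x (k * d).
Proof.
by move=> h; apply: cder_eq (cderM (cder_cst k x) h) _; rewrite mul0r add0r.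
Qed.

Lemma cderN f x d : cder f x d -> cder (fun t => - f t) x (- d).
Proof.
move=> h; apply: (cder_eq (cder_ext _ (cderZ (-1) h))) => [t|]; exact: mulN1r.
Qed.

Lemma cderB f g x d e : cder f x d -> cder g x e -> cder (fun t => f t - g t) x (d - e).
Proof. by move=> h1 h2; apply: cderD h1 _; exact: cderN. Qed.

Lemma cder_real (f : R -> R) x (d : R) : rder f x d -> cder (fun t => (f t)%:C) x d%:C.
Proof. by move=> h; split => //; exact: rder_cst. Qed.

Lemma cder_id x : cder (fun t => t%:C) x 1.
Proof. exact: cder_real (rder_id x). Qed.

Lemma cder_comp f (g : R -> R) x d (e : R) : cder f (g x) d -> rder g x e ->
  cder (fun t => f (g t)) x (d * e%:C).
Proof.
move=> [f1 f2] hg; split; rewrite ?cReMr ?cImMr.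
  exact: (@rder_comp _ (fun t => Re (f t)) g).
exact: (@rder_comp _ (fun t => Im (f t)) g).
Qed.

Lemma cder_cexp f x d : cder f x d -> cder (fun t => cexp (f t)) x (cexp (f x) * d).
Proof.
move=> [f1 f2]; split.
- apply: (rder_eq (rderM (rder_comp (is_derive_expR _) f1) (rder_comp (is_derive_cos _) f2))).
  by rewrite cReM /=; ring.
- apply: (rder_eq (rderM (rder_comp (is_derive_expR _) f1) (rder_comp (is_derive_sin _) f2))).
  by rewrite cImM /=; ring.
Qed.

Lemma cder_cpow (g : R -> R) x (e : R) k : 0 < g x -> rder g x e ->
  cder (fun t => cpow (g t) k) x (k * cpow (g x) k * (e / g x)%:C).
Proof.
move=> g0 hg; apply: (cder_eq (cder_cexp (cderZ k (cder_real (rder_comp (is_derive1_ln g0) hg))))).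
by rewrite /cpow [(g x)^-1 * e]mulrC; ring.
Qed.

Lemma cder_cst_itv f x y : (forall t, 0 < t -> cder f t 0) -> 0 < x -> 0 < y -> f x = f y.
Proof.
move=> h x0 y0; apply: complexP.
  by apply: (@rder_cst_itv _ (fun t => Re (f t))) => // t /h[].
by apply: (@rder_cst_itv _ (fun t => Im (f t))) => // t /h[].
Qed.

Lemma cder_uniq f x d e : cder f x d -> cder f x e -> d = e.
Proof.
move=> [f1 f2] [g1 g2]; apply: complexP.
  by rewrite -(rder_derive1 f1) (rder_derive1 g1).
by rewrite -(rder_derive1 f2) (rder_derive1 g2).
Qed.

Definition ccont f := continuous (fun t => Re (f t)) /\ continuous (fun t => Im (f t)).

Lemma ccont_cder f : (forall x, exists d, cder f x d) -> ccont f.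
Proof. by move=> h; split => x; have [d [h1 h2]] := h x; [exact: rder_cont h1|exact: rder_cont h2]. Qed.

Lemma cmeas_ccont f : ccont f -> cmeas f.
Proof. by move=> [h1 h2]; split; exact: continuous_measurable_fun. Qed.

Lemma ccontM f g : ccont f -> ccont g -> ccont (fun t => f t * g t).
Proof.
move=> [f1 f2] [g1 g2]; split.
  have -> : (fun t => Re (f t * g t)) = (fun t => Re (f t) * Re (g t) - Im (f t) * Im (g t)).
    by apply/funext => t; rewrite cReM.
  by move=> x; apply: cvgB; apply: cvgM; [exact: f1|exact: g1|exact: f2|exact: g2].
have -> : (fun t => Im (f t * g t)) = (fun t => Re (f t) * Im (g t) + Im (f t) * Re (g t)).
  by apply/funext => t; rewrite cImM.
by move=> x; apply: cvgD; apply: cvgM; [exact: f1|exact: g2|exact: f2|exact: g1].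
Qed.

Lemma ccontD f g : ccont f -> ccont g -> ccont (fun t => f t + g t).
Proof.
move=> [f1 f2] [g1 g2]; split.
  have -> : (fun t => Re (f t + g t)) = (fun t => Re (f t) + Re (g t)).
    by apply/funext => t; rewrite cReD.
  by move=> x; apply: cvgD; [exact: f1|exact: g1].
have -> : (fun t => Im (f t + g t)) = (fun t => Im (f t) + Im (g t)).
  by apply/funext => t; rewrite cImD.
by move=> x; apply: cvgD; [exact: f2|exact: g2].
Qed.

Lemma ccont_cst k : ccont (fun=> k).
Proof. by split => x; exact: cvg_cst. Qed.

Lemma ccontZ f k : ccont f -> ccont (fun t => k * f t).
Proof. by move=> h; apply: ccontM h; exact: ccont_cst. Qed.

Lemma ccontB f g : ccont f -> ccont g -> ccont (fun t => f t - g t).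
Proof.
move=> h1 h2; have := ccontD h1 (ccontZ (-1) h2).
by under eq_fun do rewrite mulN1r.
Qed.

Lemma ccont_real (f : R -> R) : continuous f -> ccont (fun t => (f t)%:C).
Proof. by split => // x; exact: cvg_cst. Qed.

Lemma ccont_comp f (phi : R -> R) : ccont f -> continuous phi -> ccont (fun t => f (phi t)).
Proof.
move=> [f1 f2] cphi; split => x.
  by apply: (continuous_comp (g := fun t => Re (f t))); [exact: cphi|exact: f1].
by apply: (continuous_comp (g := fun t => Im (f t))); [exact: cphi|exact: f2].
Qed.

End complex_derivatives.

(** * Sequential limits, dominated convergence and integrals of derivatives *)

Section limits.
Context {R : realType}.
Local Notation mu := (@lebesgue_measure R).
Implicit Types (u v : nat -> R[i]) (l m k : R[i]).

Definition ccvg u l :=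
  (Re (u n) @[n --> \oo] --> Re l) /\ (Im (u n) @[n --> \oo] --> Im l).

Lemma ccvg_cst k : ccvg (fun=> k) k. Proof. by split; exact: cvg_cst. Qed.

Lemma ccvgD u v l m : ccvg u l -> ccvg v m -> ccvg (fun n => u n + v n) (l + m).
Proof.
move=> [u1 u2] [v1 v2]; split; under eq_fun do rewrite cRIE; rewrite cRIE; exact: cvgD.
Qed.

Lemma ccvgM u v l m : ccvg u l -> ccvg v m -> ccvg (fun n => u n * v n) (l * m).
Proof.
move=> [u1 u2] [v1 v2]; split.
  by under eq_fun do rewrite cReM; rewrite cReM; apply: cvgB; exact: cvgM.
by under eq_fun do rewrite cImM; rewrite cImM; apply: cvgD; exact: cvgM.
Qed.

Lemma ccvgN u l : ccvg u l -> ccvg (fun n => - u n) (- l).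
Proof.
by move=> [u1 u2]; split; under eq_fun do rewrite cRIE; rewrite cRIE; exact: cvgN.
Qed.

Lemma ccvgB u v l m : ccvg u l -> ccvg v m -> ccvg (fun n => u n - v n) (l - m).
Proof. by move=> h1 h2; apply: ccvgD h1 _; exact: ccvgN. Qed.

Lemma ccvg_uniq u l m : ccvg u l -> ccvg u m -> l = m.
Proof.
move=> [u1 u2] [v1 v2]; apply: complexP.
  exact: (cvg_unique _ u1 v1).
exact: (cvg_unique _ u2 v2).
Qed.

Lemma ccvg_ext u v l : u =1 v -> ccvg u l -> ccvg v l.
Proof. by move=> /funext ->. Qed.

Lemma ccvg_real (a : nat -> R) (b : R) : a n @[n --> \oo] --> b -> ccvg (fun n => (a n)%:C) b%:C.
Proof. by move=> h; split => //; exact: cvg_cst. Qed.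

Lemma ccvg0_le u (a : nat -> R) : (forall n, normc (u n) <= a n) ->
  a n @[n --> \oo] --> 0 -> ccvg u 0.
Proof.
move=> ua a0; split; apply: norm_cvg0.
  apply: (@squeeze_cvgr _ _ _ _ (cst 0) a) => //; last exact: cvg_cst.
  by apply: nearW => n; rewrite normr_ge0 /= (le_trans (normRe_le _)).
apply: (@squeeze_cvgr _ _ _ _ (cst 0) a) => //; last exact: cvg_cst.
by apply: nearW => n; rewrite normr_ge0 /= (le_trans (normIm_le _)).
Qed.

Lemma ccvg_cont (f : R -> R[i]) (a : nat -> R) x d : cder f x d ->
  a n @[n --> \oo] --> x -> ccvg (fun n => f (a n)) (f x).
Proof.
move=> [h1 h2] ax; split.
  exact: (cvg_comp _ _ ax (rder_cont h1)).
exact: (cvg_comp _ _ ax (rder_cont h2)).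
Qed.

Lemma rDCT (f : nat -> R -> R) (F g : R -> R) :
  (forall n, measurable_fun setT (f n)) -> rintegrable g ->
  (forall n t, `|f n t| <= g t) -> (forall t, f n t @[n --> \oo] --> F t) ->
  rintegrable F /\ (\int[mu]_t f n t @[n --> \oo] --> \int[mu]_t F t).
Proof.
move=> mf ig fg fF.
have mF : measurable_fun setT F by apply: (measurable_fun_cvg mf) => t _; exact: fF.
have [|||||i1 _ i2] := @dominated_convergence _ _ R mu setT measurableT
   (fun n t => (f n t)%:E) (fun t => (F t)%:E) (fun t => (g t)%:E).
- by move=> n; apply/measurable_EFinP; exact: mf.
- exact/measurable_EFinP.
- by apply: aeW => t _; apply: cvg_EFin; [exact: nearW|exact: fF].
- exact: ig.
- by apply: aeW => t n _; rewrite lee_fin fg.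
split => //; apply: fine_cvg; rewrite fineK//.
exact: integrable_fin_num.
Qed.

Lemma cDCT (f : nat -> R -> R[i]) (F : R -> R[i]) (g : R -> R) :
  (forall n, cmeas (f n)) -> rintegrable g ->
  (forall n t, normc (f n t) <= g t) -> (forall t, ccvg (fun n => f n t) (F t)) ->
  cintble F /\ ccvg (fun n => cint (f n)) (cint F).
Proof.
move=> mf ig fg fF.
have [||||i1 c1] := @rDCT (fun n t => Re (f n t)) (fun t => Re (F t)) g => //.
- by move=> n; have [] := mf n.
- by move=> n t; exact: le_trans (normRe_le _) (fg _ _).
- by move=> t; have [] := fF t.
have [||||i2 c2] := @rDCT (fun n t => Im (f n t)) (fun t => Im (F t)) g => //.
- by move=> n; have [] := mf n.
- by move=> n t; exact: le_trans (normIm_le _) (fg _ _).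
- by move=> t; have [] := fF t.
Qed.

Lemma rint_sym_cvg (f : R -> R) : rintegrable f ->
  \int[mu]_(t in `[(- n%:R : R), n%:R]) f t @[n --> \oo] --> \int[mu]_t f t.
Proof.
move=> fi.
have [||||_ c] := @rDCT (fun n => f \_ `[(- n%:R : R), n%:R]) f (fun t => `|f t|).
- move=> n; apply/(measurable_restrictT _ (measurable_itv _)).
  exact: measurable_funTS (rintegrable_meas fi).
- exact: rintegrable_norm.
- by move=> n t; rewrite /patch; case: ifP => // _; rewrite normr0.
- move=> t; apply: cvg_near_cst; exists (Num.truncn `|t|).+1 => // n /= hn.
  rewrite /patch mem_set// /= in_itv /= -ler_norml; apply/ltW.
  have /andP[_ h] := truncn_itv (normr_ge0 t).
  by apply: lt_le_trans h _; rewrite ler_nat.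
by under eq_fun do rewrite Rintegral_mkcond.
Qed.

Lemma rFTC (F f : R -> R) (n : nat) : (forall x, rder F x (f x)) -> continuous f ->
  \int[mu]_(t in `[(- n%:R : R), n%:R]) f t = F n%:R - F (- n%:R).
Proof.
move=> hF cf; case: n => [|n].
  by rewrite oppr0 set_itv1 Rintegral_set1 subrr.
have cF : continuous F by move=> x; exact: rder_cont (hF x).
rewrite /Rintegral (@continuous_FTC2 _ f F)//.
- by rewrite gtrN// ltr0Sn.
- exact: continuous_subspaceT.
- split; first by move=> x _; case: (hF x).
    by apply: cvg_at_right_filter; exact: cF.
  by apply: cvg_at_left_filter; exact: cF.
- by move=> x _; exact: rder_derive1.
Qed.

(** Since [f] is integrable, its integral is the limit of those over [[-n, n]], so the boundary
    terms are only needed along integers. *)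
Lemma rint_rder0 (F f : R -> R) : (forall x, rder F x (f x)) -> continuous f ->
  rintegrable f -> F n%:R @[n --> \oo] --> 0 -> F (- n%:R) @[n --> \oo] --> 0 ->
  \int[mu]_t f t = 0.
Proof.
move=> hF cf fi F1 F2; have := rint_sym_cvg fi.
have -> : (fun n => \int[mu]_(t in `[(- n%:R : R), n%:R]) f t) =
          (fun n => F n%:R - F (- n%:R)) by apply/funext => n; rewrite (rFTC _ hF cf).
move=> h.
have h2 : F n%:R - F (- n%:R) @[n --> \oo] --> 0 - 0 by exact: cvgB.
by rewrite subr0 in h2; apply: (cvg_unique _ h h2).
Qed.

Lemma cint_cder0 (F f : R -> R[i]) : (forall x, cder F x (f x)) -> ccont f ->
  cintble f -> ccvg (fun n => F n%:R) 0 -> ccvg (fun n => F (- n%:R)) 0 -> cint f = 0.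
Proof.
move=> hF [c1 c2] [i1 i2] [a1 a2] [b1 b2]; apply: complexP => /=.
  by apply: (@rint_rder0 (fun t => Re (F t))) => // x; case: (hF x).
by apply: (@rint_rder0 (fun t => Im (F t))) => // x; case: (hF x).
Qed.

Lemma rint_odd (f : R -> R) : continuous f -> rintegrable f ->
  (forall x, f (- x) = - f x) -> \int[mu]_t f t = 0.
Proof.
move=> cf fi of_.
have h n : \int[mu]_(t in `[(- n%:R : R), n%:R]) f t = 0.
  have := @integration_by_substitution_oppr R f (- n%:R) n%:R.
  rewrite ge0_cp// ?oppr_le0// opprK => /(_ isT (continuous_subspaceT cf)) e.
  have : \int[mu]_(t in `[(- n%:R : R), n%:R]) f t = - \int[mu]_(t in `[(- n%:R : R), n%:R]) f t.
    transitivity (\int[mu]_(t in `[(- n%:R : R), n%:R]) (-1 * f t)).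
      by rewrite /Rintegral e; congr fine; apply: eq_integral => x _ /=; rewrite of_ mulN1r.
    rewrite RintegralZl ?mulN1r//.
    exact: (@integrableS _ _ _ _ setT).
  by move/eqP; rewrite -addr_eq0 -mulr2n mulrn_eq0 /= => /eqP.
have := rint_sym_cvg fi.
have -> : (fun n => \int[mu]_(t in `[(- n%:R : R), n%:R]) f t) = (fun=> 0).
  exact/funext.
by move=> c; apply: (cvg_unique _ c); [exact: norm_hausdorff|exact: cvg_cst].
Qed.

Lemma cint_shift (f : R -> R[i]) (s : R) : ccont f ->
  cint (fun t => f (t + s)) = cint f /\ (cintble (fun t => f (t + s)) <-> cintble f).
Proof.
move=> [c1 c2]; have [m1 m2] := cmeas_ccont (conj c1 c2).
have := @cint_subst R (fun t => t + s) (fun=> 1) setT _ _ _ _ _ f m1 m2 _ _.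
have -> : (fun t => f (t + s) * 1%:C) = (fun t => f (t + s)).
  by apply/funext => t; rewrite mulr1.
move=> [||||//|y _|y _|-> ->//].
- by move=> x; apply: (rder_eq (rderD (rder_id x) (rder_cst s x))); rewrite addr0.
- by move=> x; exact: cvg_cst.
- by move=> _; exact: ltr01.
- by apply/seteqP; split => // x _; exists (x - s) => //; rewrite subrK.
- exact: c1.
- exact: c2.
Qed.

Lemma cder_cint (f d : R -> R -> R[i]) (a r s : R) (G : R -> R) :
  r < a < s ->
  (forall x, r < x < s -> cintble (f x)) ->
  (forall x t, r < x < s -> cder (f^~ t) x (d x t)) ->
  rintegrable G -> (forall x t, r < x < s -> normc (d x t) <= G t) ->
  cder (fun x => cint (f x)) a (cint (d a)).
Proof.
move=> auv fi hd Gi dG.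
have G0 t : 0 <= G t by apply: le_trans (dG _ t auv); exact: normc_ge0.
have Ia : `]r, s[%classic a by rewrite /= in_itv.
split => /=.
- have H1 x : `]r, s[%classic x -> mu.-integrable setT (EFin \o (fun t => Re (f x t))).
    by rewrite /= in_itv => /fi[].
  have H2 x t : `]r, s[%classic x -> setT t -> derivable (fun x => Re (f x t)) x 1.
    by rewrite /= in_itv => /(hd x t)[[]].
  have E x t : `]r, s[%classic x -> partial1of2 (fun x t => Re (f x t)) x t = Re (d x t).
    by rewrite /= in_itv => /(hd x t)[h _]; exact: rder_derive1.
  have H3 x t : `]r, s[%classic x -> setT t ->
      `|partial1of2 (fun x t => Re (f x t)) x t| <= G t.
    by move=> xI _; rewrite E// (le_trans (normRe_le _))// dG//; move: xI; rewrite /= in_itv.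
  split; first exact: (derivable_under_integral measurableT Ia H1 H2 G0 Gi H3).
  rewrite -derive1E (differentiation_under_integral measurableT Ia H1 H2 G0 Gi H3).
  by apply: eq_Rintegral => t _; rewrite E.
- have H1 x : `]r, s[%classic x -> mu.-integrable setT (EFin \o (fun t => Im (f x t))).
    by rewrite /= in_itv => /fi[].
  have H2 x t : `]r, s[%classic x -> setT t -> derivable (fun x => Im (f x t)) x 1.
    by rewrite /= in_itv => /(hd x t)[_ []].
  have E x t : `]r, s[%classic x -> partial1of2 (fun x t => Im (f x t)) x t = Im (d x t).
    by rewrite /= in_itv => /(hd x t)[_ h]; exact: rder_derive1.
  have H3 x t : `]r, s[%classic x -> setT t ->
      `|partial1of2 (fun x t => Im (f x t)) x t| <= G t.
    by move=> xI _; rewrite E// (le_trans (normIm_le _))// dG//; move: xI; rewrite /= in_itv.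
  split; first exact: (derivable_under_integral measurableT Ia H1 H2 G0 Gi H3).
  rewrite -derive1E (differentiation_under_integral measurableT Ia H1 H2 G0 Gi H3).
  by apply: eq_Rintegral => t _; rewrite E.
Qed.

End limits.

(** * Laplace-type integrals and the Gamma function *)

Section dominating_functions.
Context {R : realType}.
Implicit Types (s x m u : R).

Lemma rintegrable_oneDsqrV : rintegrable (fun u : R => (1 + u ^+ 2)^-1).
Proof.
have c : continuous (fun u : R => (1 + u ^+ 2)^-1).
  exact: continuous_oneDsqrV.
have p (u : R) : 0 <= (1 + u ^+ 2)^-1 by rewrite invr_ge0 addr_ge0// sqr_ge0.
apply/integrableP; split; first by apply/measurable_EFinP; apply: continuous_measurable_fun.
under eq_integral do rewrite /= ger0_norm//.
rewrite ge0_symfun_integralT//; last by move=> u /=; rewrite sqrrN.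
rewrite -set_itvcy integral0y_oneDsqr -EFinM; exact: ltry.
Qed.

Lemma rintegrable_expR_abs m : 0 < m -> rintegrable (fun u => expR (- (m * `|u|))).
Proof.
(* [C] is such that [C (1 + m^2 u^2 / 2) >= 1 + u^2], where the bracket is a lower bound of
   [e^{m |u|}]. *)
move=> m0; pose C := 1 + 2 / m ^+ 2.
apply: (rintegrable_le (g := fun u => C * (1 + u ^+ 2)^-1)).
- apply: continuous_measurable_fun => u; apply: continuous_comp; last exact: continuous_expR.
  by apply: cvgN; apply: cvgM; [exact: cvg_cst|apply: cvg_norm; exact: cvg_id].
- exact/rintegrableZ/rintegrable_oneDsqrV.
move=> u; rewrite ger0_norm ?expR_ge0// expRN ler_pdivlMr; last first.
  by rewrite ltr_pwDl// sqr_ge0.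
rewrite mulrC ler_pdivrMr ?expR_gt0//.
have mu0 : 0 <= m * `|u| by rewrite mulr_ge0// ltW.
have h := expR_ge1Dxn 1 mu0.
apply: (@le_trans _ _ (C * (1 + (m * `|u|) ^+ 2 / 2))); last first.
  by rewrite ler_wpM2l// addr_ge0// divr_ge0// sqr_ge0.
rewrite exprMn real_normK ?num_real//.
have -> : C * (1 + m ^+ 2 * u ^+ 2 / 2) = C + (m ^+ 2 / 2) * u ^+ 2 + u ^+ 2.
  by rewrite /C; field; rewrite gt_eqF.
have h2 : 0 <= 2 / m ^+ 2 by rewrite divr_ge0// sqr_ge0.
have h3 : 0 <= m ^+ 2 / 2 * u ^+ 2 by rewrite mulr_ge0 ?sqr_ge0// divr_ge0// sqr_ge0.
rewrite /C; lra.
Qed.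

Lemma expR_abs_cvg0 m : 0 < m -> expR (- (m * n%:R)) @[n --> \oo] --> (0 : R).
Proof.
move=> m0; under eq_fun do rewrite -mulNr mulrC expRM_natl.
by apply: cvg_expr; rewrite ger0_norm ?expR_ge0// expR_lt1 oppr_lt0.
Qed.

(** For [u <= 0] the factor [e^{su}] decays by itself. For [u > 0] the bound [e^u >= 1 + u^2/2]
    makes the exponent quadratic; the constant completes the square, with [s + 1] instead of [s] so
    that [e^{-u}] is left over. *)
Lemma gamma_kernel_le s x : 0 < s -> 0 < x -> forall u,
  expR (s * u) * expR (- x * expR u) <=
    expR ((s + 1) ^+ 2 / (2 * x)) * expR (- (Num.min s 1 * `|u|)).
Proof.
move=> s0 x0 u; rewrite -!expRD ler_expR.
have C0 : 0 <= (s + 1) ^+ 2 / (2 * x).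
  by rewrite divr_ge0 ?sqr_ge0// mulr_ge0// ltW.
have [u0|u0] := leP u 0.
  rewrite ler0_norm// mulrN opprK.
  have h1 : 0 <= x * expR u by rewrite mulr_ge0 ?expR_ge0// ltW.
  have h2 : s * u <= Num.min s 1 * u by rewrite ler_wnM2r// ge_min lexx.
  lra.
rewrite gtr0_norm//.
have h := expR_ge1Dxn 1 (ltW u0).
have h2 : Num.min s 1 * u <= u by rewrite ler_piMl ?(ltW u0)// ge_min lexx orbT.
have h3 : x * (1 + u ^+ 2 / 2) <= x * expR u by rewrite ler_wpM2l// ltW.
suff : (s + 1) * u <= x * (1 + u ^+ 2 / 2) + (s + 1) ^+ 2 / (2 * x) by lra.
rewrite -subr_ge0.
have -> : x * (1 + u ^+ 2 / 2) + (s + 1) ^+ 2 / (2 * x) - (s + 1) * u =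
   x + (x * u - (s + 1)) ^+ 2 / (2 * x) by field; rewrite gt_eqF.
by rewrite addr_ge0 ?(ltW x0)// divr_ge0 ?sqr_ge0// mulr_ge0// ltW.
Qed.

Lemma one_expR_gt0 u : 0 < 1 + expR u. Proof. by rewrite addr_gt0// expR_gt0. Qed.
Lemma one_expR_ge1 u : 1 <= 1 + expR u. Proof. by rewrite lerDl expR_ge0. Qed.
Hint Resolve one_expR_gt0 one_expR_ge1 : core.

(** For [b > 0] this is [ln s <= s] at [s = x t / b]. *)
Lemma powR_expR_le b x : 0 < x ->
  exists2 C, 0 <= C & forall t, 1 <= t -> t `^ b <= C * expR (x * t).
Proof.
move=> x0; have [b0|b0] := leP b 0.
  exists 1 => // t t1; rewrite mul1r.
  apply: (@le_trans _ _ 1).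
    by rewrite -(powRr0 t) ler_powR.
  by rewrite -expR0 ler_expR mulr_ge0 ?(ltW x0)// (le_trans _ t1).
exists (expR (- (b * ln (x / b)))); first exact: expR_ge0.
move=> t t1; have t0 : 0 < t by exact: lt_le_trans t1.
have xb : 0 < x / b by rewrite mulr_gt0 // invr_gt0.
rewrite /powR gt_eqF// -expRD ler_expR.
have := ln_sublinear (mulr_gt0 xb t0); rewrite [ln (x / b * t)]lnM ?posrE// => h.
have : b * (ln (x / b) + ln t) <= b * (x / b * t) by rewrite ler_wpM2l ?ltW.
have -> : b * (x / b * t) = x * t by field; rewrite gt_eqF.
lra.
Qed.

End dominating_functions.
#[export] Hint Resolve one_expR_gt0 one_expR_ge1 : core.

Section laplace_kernel.
Context {R : realType}.
Implicit Types (a b p q z : R[i]) (x u : R).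

(** With [t = e^u] the powers become exponentials and dilations of [t] become translations of [u].
    The case [b = 0], [x = 1] is the integral of Gamma. *)
Definition kJ a b x u : R[i] :=
  cexp (a * u%:C) * cpow (1 + expR u) b * (expR (- x * expR u))%:C.

Definition J a b x : R[i] := cint (kJ a b x).

Lemma rder_oneD_expR u : rder (fun t : R => 1 + expR t) u (expR u).
Proof. by apply: rder_eq (rderD (rder_cst _ _) (is_derive_expR _)) _; rewrite add0r. Qed.

Lemma kJ_derx a b x u : cder (fun x => kJ a b x u) x (- kJ (a + 1) b x u).
Proof.
have h : rder (fun x => - x * expR u) x (- expR u).
  apply: rder_eq (rderM (rderN (rder_id x)) (rder_cst _ x)) _.
  by rewrite mulN1r mulr0 addr0.
apply: cder_eq (cderZ _ (cder_real (rder_comp (is_derive_expR _) h))) _.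
rewrite /kJ mulrDl mul1r cexpD cexp_real !rcE; ring.
Qed.

Lemma kJ_deru a b x u : cder (kJ a (b + 1) x) u
  (a * kJ a (b + 1) x u + (b + 1) * kJ (a + 1) b x u - x%:C * kJ (a + 1) (b + 1) x u).
Proof.
have h1 : cder (fun u : R => cexp (a * u%:C)) u (cexp (a * u%:C) * a).
  by apply: cder_eq (cder_cexp (cderZ a (cder_id u))) _; rewrite mulr1.
have h2 := @cder_cpow R (fun t => 1 + expR t) u (expR u) (b + 1) (one_expR_gt0 u)
  (rder_oneD_expR u).
have h3 : rder (fun u => - x * expR u) u (- x * expR u).
  by apply: rder_eq (rderM (rder_cst _ u) (is_derive_expR u)) _; rewrite mul0r add0r.
have h4 := cder_real (rder_comp (is_derive_expR _) h3).
apply: cder_eq (cderM (cderM h1 h2) h4) _.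
have : (1 + expR u)%:C != 0 :> R[i] by rewrite rc_eq0 gt_eqF.
rewrite /kJ (mulrDl a 1) mul1r !cexpD cexp_real !rcM !rcN rcV !cpowS//.
by rewrite rcD => h; field; exact: h.
Qed.

Lemma cpow_real_der b u : exists d, cder (fun t : R => cpow (1 + expR t) b) u d.
Proof.
exists (b * cpow (1 + expR u) b * (expR u / (1 + expR u))%:C).
exact: cder_cpow (rder_oneD_expR u).
Qed.

Lemma ccont_kJ a b x : ccont (kJ a b x).
Proof.
apply: ccont_cder => u; rewrite -(subrK 1 b).
eexists; exact: kJ_deru.
Qed.

Lemma cmeas_kJ a b x : cmeas (kJ a b x).
Proof. exact/cmeas_ccont/ccont_kJ. Qed.

Lemma normc_kJ a b x u :
  normc (kJ a b x u) = expR (Re a * u) * (1 + expR u) `^ Re b * expR (- x * expR u).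
Proof.
by rewrite /kJ !normcM normc_cexp normc_cpow// normc_real ger0_norm ?expR_ge0// cReMr.
Qed.

(** Half of the exponent [x0 e^u] absorbs the power of [1 + e^u], the other half gives the decay.
    Uniformity in [x >= x0] is what differentiation under the integral sign requires. *)
Lemma kJ_le a b x0 : 0 < Re a -> 0 < x0 ->
  exists2 C, 0 <= C & forall x, x0 <= x -> forall u,
    normc (kJ a b x u) <= C * expR (- (Num.min (Re a) 1 * `|u|)).
Proof.
move=> a0 x00; have x2 : 0 < x0 / 2 by rewrite divr_gt0.
have [C C0 hC] := powR_expR_le (Re b) x2.
pose D := expR ((Re a + 1) ^+ 2 / (2 * (x0 / 2))).
exists (C * expR (x0 / 2) * D).
  by rewrite mulr_ge0 ?mulr_ge0 ?expR_ge0.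
move=> x xx u; rewrite normc_kJ.
apply: (@le_trans _ _ (expR (Re a * u) * (C * expR (x0 / 2 * (1 + expR u))) * expR (- x0 * expR u))).
  apply: ler_pM; rewrite ?mulr_ge0 ?expR_ge0 ?powR_ge0//.
    by rewrite ler_wpM2l ?expR_ge0// hC.
  by rewrite ler_expR ler_wpM2r ?expR_ge0// lerN2.
have -> : expR (Re a * u) * (C * expR (x0 / 2 * (1 + expR u))) * expR (- x0 * expR u) =
  C * expR (x0 / 2) * (expR (Re a * u) * expR (- (x0 / 2) * expR u)).
  rewrite -!mulrA [LHS]mulrCA -!expRD; congr (C * expR _); by field.
rewrite -[leRHS]mulrA ler_wpM2l ?mulr_ge0 ?expR_ge0//.
exact: gamma_kernel_le.
Qed.

Lemma cintble_kJ a b x : 0 < Re a -> 0 < x -> cintble (kJ a b x).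
Proof.
move=> a0 x0; have [C C0 h] := @kJ_le a b x a0 x0.
apply: (cintble_le _ _ (h x (lexx _))); first exact: cmeas_kJ.
by apply/rintegrableZ/rintegrable_expR_abs; rewrite lt_min a0 ltr01.
Qed.

Lemma cder_J a b x : 0 < Re a -> 0 < x -> cder (J a b) x (- J (a + 1) b x).
Proof.
move=> a0 x0; have x2 : 0 < x / 2 by rewrite divr_gt0.
have a1 : 0 < Re (a + 1) by rewrite cReD /= addr_gt0.
have [C C0 h] := @kJ_le (a + 1) b (x / 2) a1 x2.
have hh : forall y, x / 2 < y < 2 * x -> x / 2 <= y by move=> y /andP[/ltW].
apply: (cder_eq (@cder_cint _ (kJ a b) (fun x u => - kJ (a + 1) b x u) x (x / 2) (2 * x)
  (fun u => C * expR (- (Num.min (Re (a + 1)) 1 * `|u|))) _ _ _ _ _)).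
- by apply/andP; split; lra.
- by move=> y /hh xy; apply: cintble_kJ => //; exact: lt_le_trans xy.
- by move=> y t _; exact: kJ_derx.
- by apply/rintegrableZ/rintegrable_expR_abs; rewrite lt_min a1 ltr01.
- by move=> y t /hh xy; rewrite normcN h.
- rewrite /J -mulN1r -cintZ; last exact: cintble_kJ.
  by apply: eq_cint => t; rewrite mulN1r.
Qed.

Lemma J_succ a b x : 0 < Re a -> 0 < x -> J a (b + 1) x = J a b x + J (a + 1) b x.
Proof.
move=> a0 x0; have a1 : 0 < Re (a + 1) by rewrite cReD /= addr_gt0.
rewrite /J -cintD; [|exact: cintble_kJ..].
apply: eq_cint => u; rewrite /kJ cpowS// mulrDl mul1r cexpD cexp_real rcD; ring.
Qed.

(** The left side integrates the [u]-derivative of [kJ a (b + 1) x], which vanishes at both ends.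
    Together with [J_succ] it yields Kummer's equation; at [b = -1], [x = 1] it is the functional
    equation of Gamma. *)
Lemma J_byparts a b x : 0 < Re a -> 0 < x ->
  a * J a (b + 1) x + (b + 1) * J (a + 1) b x - x%:C * J (a + 1) (b + 1) x = 0.
Proof.
move=> a0 x0; have a1 : 0 < Re (a + 1) by rewrite cReD /= addr_gt0.
have i1 : cintble (kJ a (b + 1) x) by exact: cintble_kJ.
have i2 : cintble (kJ (a + 1) b x) by exact: cintble_kJ.
have i3 : cintble (kJ (a + 1) (b + 1) x) by exact: cintble_kJ.
rewrite /J -!cintZ// -cintD; [|exact: cintbleZ..].
rewrite -cintB; [|by apply: cintbleD; exact: cintbleZ|exact: cintbleZ].
have [C C0 h] := @kJ_le a (b + 1) x a0 x0.
have m0 : 0 < Num.min (Re a) 1 by rewrite lt_min a0 ltr01.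
apply: (@cint_cder0 _ (kJ a (b + 1) x)).
- by move=> u; exact: kJ_deru.
- apply: ccontB; last by apply: ccontZ; exact: ccont_kJ.
  by apply: ccontD; apply: ccontZ; exact: ccont_kJ.
- apply: cintbleB; [|exact: cintbleZ].
  by apply: cintbleD; exact: cintbleZ.
- apply: (ccvg0_le (fun n => h x (lexx _) n%:R)).
  rewrite -(mulr0 C); apply: cvgM; first exact: cvg_cst.
  by under eq_fun do rewrite ger0_norm//; exact: expR_abs_cvg0.
- apply: (ccvg0_le (fun n => h x (lexx _) (- n%:R))).
  rewrite -(mulr0 C); apply: cvgM; first exact: cvg_cst.
  by under eq_fun do rewrite normrN ger0_norm//; exact: expR_abs_cvg0.
Qed.

End laplace_kernel.

Section real_shift.
Context {R : realType}.
Local Notation mu := (@lebesgue_measure R).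

Lemma continuous_normc (f : R -> R[i]) : ccont f -> continuous (fun t => normc (f t)).
Proof.
move=> [f1 f2].
have -> : (fun t => normc (f t)) = (fun t => Num.sqrt (Re (f t) ^+ 2 + Im (f t) ^+ 2)).
  by apply/funext => t; case: (f t).
move=> x; apply: (@continuous_comp _ _ _ (fun t => Re (f t) ^+ 2 + Im (f t) ^+ 2) (@Num.sqrt R)).
  by apply: cvgD; rewrite expr2; apply: cvgM; solve [exact: f1|exact: f2].
exact: sqrt_continuous.
Qed.

Lemma rint_shift (f : R -> R) (s : R) : continuous f ->
  \int[mu]_t f (t + s) = \int[mu]_t f t /\
  (rintegrable f -> rintegrable (fun t => f (t + s))).
Proof.
move=> cf; have [e h] := cint_shift s (ccont_real cf); split.
  by move/(congr1 Re): e; rewrite !cintR.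
by move=> /cintbleR /h [].
Qed.

Lemma abs_sin_le (x : R) : `|sin x| <= `|x|.
Proof.
have := @MVT_bound R sin cos 1 (fun x => is_derive_sin x) (@cos_max R) x 0.
by rewrite sin0 !subr0 mul1r.
Qed.

Lemma cos_ge_quad (x : R) : 1 - x ^+ 2 / 2 <= cos x.
Proof.
have -> : cos x = 1 - 2 * sin (x / 2) ^+ 2.
  rewrite {1}[x in LHS]splitr cosD -!expr2 cos2sin2; ring.
have : sin (x / 2) ^+ 2 <= (x / 2) ^+ 2.
  by rewrite -[leLHS]real_normK ?num_real// -[leRHS]real_normK ?num_real// lerXn2r// abs_sin_le.
rewrite expr_div_n; lra.
Qed.

(** The bracket is the square of [e^{x/2} - e^{-x/2}], which is at least [x/2] for [x >= 0]. It
    serves both for the non-vanishing of Gamma and for the Gaussian decay of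
    [e^{-x cosh^2(xi/2)}]. *)
Lemma sqr_le_expR (x : R) : x ^+ 2 <= 4 * (expR x + expR (- x) - 2).
Proof.
wlog x0 : x / 0 <= x => [H|].
  have [/H//|/ltW] := leP 0 x; rewrite -oppr_ge0 => /H.
  by rewrite sqrrN opprK [expR (- x) + _]addrC.
have h1 : 1 + x / 2 <= expR (x / 2) by exact: expR_ge1Dx.
have h2 : expR (- (x / 2)) <= 1 by rewrite -expR0 ler_expR oppr_le0 divr_ge0.
have -> : expR x + expR (- x) - 2 = (expR (x / 2) - expR (- (x / 2))) ^+ 2.
  have pq : expR (x / 2) * expR (- (x / 2)) = 1 by rewrite -expRD subrr expR0.
  rewrite {1 2}[x]splitr opprD !expRD.
  transitivity (expR (x / 2) * expR (x / 2) + expR (- (x / 2)) * expR (- (x / 2))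
      - 2 * (expR (x / 2) * expR (- (x / 2)))); last by ring.
  by rewrite pq mulr1.
have : (x / 2) ^+ 2 <= (expR (x / 2) - expR (- (x / 2))) ^+ 2.
  by rewrite lerXn2r ?nnegrE//; lra.
rewrite expr_div_n; lra.
Qed.

End real_shift.

(** * Euler's integrals of the first and second kind *)

Section euler_gamma.
Context {R : realType}.
Local Notation mu := (@lebesgue_measure R).
Implicit Types (a b p q z : R[i]) (x u s : R).

Lemma euler_integralE z : 0 < Re z -> euler_integral z = J z 0 1.
Proof.
move=> z0; rewrite /euler_integral /J.
pose f t := cpow t (z - 1) * (expR (- t))%:C.
have [m1 m2] : cmeas f.
  apply: cmeasM; first exact: cmeas_cpow.
  by apply: cmeas_real; apply: measurableT_comp => //; exact: measurable_expR.
have hd y : 0 < y -> exists d, cder f y d.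
  move=> y0; eexists; apply: cderM (cder_cpow _ y0 (rder_id y)) _.
  exact: cder_real (rder_comp (is_derive_expR _) (rderN (rder_id y))).
have [|||||||y Ay|y Ay|-> _] := @cint_subst R expR expR `]0, +oo[%classic _ _ _ _ _ f.
- by move=> x; exact: is_derive_expR.
- exact: continuous_expR.
- exact: expR_gt0.
- apply/seteqP; split => [_ [x _ <-]|x] /=; first by rewrite in_itv /= expR_gt0.
  by rewrite in_itv /= andbT => x0; exists (ln x) => //; rewrite lnK.
- exact: measurable_itv.
- exact: measurable_funTS.
- exact: measurable_funTS.
- have [|d [h _]] := hd y; first by move: Ay; rewrite /= in_itv /= andbT.
  exact: rder_cont h.
- have [|d [_ h]] := hd y; first by move: Ay; rewrite /= in_itv /= andbT.
  exact: rder_cont h.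
apply: eq_cint => u; rewrite /f /kJ cpow_expR mulrBl mul1r cexpD cexpN cexp_real cpow0 mulr1.
have e0 : (expR u)%:C != 0 :> R[i] by rewrite rc_eq0 gt_eqF// expR_gt0.
by rewrite mulN1r; field; exact: e0.
Qed.

Lemma eulerS z : 0 < Re z -> J (z + 1) 0 1 = z * J z 0 1.
Proof.
move=> z0; have := @J_byparts R z (-1) 1 z0 ltr01.
by rewrite addNr mul0r addr0 mul1r => /eqP; rewrite subr_eq0 => /eqP.
Qed.

Lemma J_scale z x : 0 < Re z -> 0 < x -> J z 0 x = cpow x (- z) * J z 0 1.
Proof.
move=> z0 x0; rewrite /J -cintZ; last exact: cintble_kJ.
rewrite -(cint_shift (- ln x) (ccont_kJ z 0 x)).1.
apply: eq_cint => u; rewrite /kJ !cpow0 !mulr1 expRD expRN lnK// rcD mulrDr cexpD /cpow.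
rewrite rcN mulrN -mulNr [RHS]mulrA; congr (_ * _%:C); first exact: mulrC.
by congr expR; field; rewrite gt_eqF.
Qed.

(** The integrand of [int_0^oo t^{p-1} (1 + t)^{-p-q} dt] after [t = e^u]. *)
Definition kB p q u : R[i] := cexp (p * u%:C) * cpow (1 + expR u) (- (p + q)).

Definition Beta p q : R[i] := cint (kB p q).

Lemma ccont_kB p q : ccont (kB p q).
Proof.
apply: ccontM; apply: ccont_cder => u.
  eexists; exact: cder_cexp (cderZ p (cder_id u)).
exact: cpow_real_der.
Qed.

Lemma kB_le p q u : 0 < Re p -> 0 < Re q ->
  normc (kB p q u) <= expR (- (Num.min (Re p) (Re q) * `|u|)).
Proof.
move=> p0 q0; rewrite /kB normcM normc_cexp normc_cpow// cReMr cReN cReD.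
have [u0|u0] := leP u 0.
  rewrite ler0_norm// mulrN opprK -[leRHS]mulr1; apply: ler_pM; rewrite ?expR_ge0 ?powR_ge0//.
    by rewrite ler_expR ler_wnM2r// ge_min lexx.
  have h : - (Re p + Re q) <= 0 by rewrite oppr_le0 ltW// addr_gt0.
  by have := ler_powR (one_expR_ge1 u) h; rewrite powRr0.
rewrite gtr0_norm//.
have h : (1 + expR u) `^ (- (Re p + Re q)) <= expR (- ((Re p + Re q) * u)).
  have hl : u <= ln (1 + expR u).
    by rewrite -{1}(expRK u) ler_ln ?posrE ?expR_gt0// lerDr.
  rewrite /powR gt_eqF// ler_expR !mulNr lerN2.
  by apply: ler_wpM2l hl; rewrite addr_ge0 ?ltW.
apply: (@le_trans _ _ (expR (Re p * u) * expR (- ((Re p + Re q) * u)))).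
  by rewrite ler_wpM2l ?expR_ge0.
rewrite -expRD ler_expR -subr_ge0.
have -> : - (Num.min (Re p) (Re q) * u) - (Re p * u - (Re p + Re q) * u) =
  (Re q - Num.min (Re p) (Re q)) * u by ring.
by rewrite mulr_ge0 ?(ltW u0)// subr_ge0 ge_min lexx orbT.
Qed.

Lemma cintble_kB p q : 0 < Re p -> 0 < Re q -> cintble (kB p q).
Proof.
move=> p0 q0; apply: (cintble_le _ _ (fun u => kB_le u p0 q0)).
  exact/cmeas_ccont/ccont_kB.
by apply: rintegrable_expR_abs; rewrite lt_min p0.
Qed.

(** Translating [u] by [v] makes [u] the logarithm of the ratio of the two original variables; the
    integral over [v] is then a rescaled Gamma integral ([J_scale]), and the scale [1 + e^u]
    supplies the Beta kernel. *)
Lemma euler_mul p q : 0 < Re p -> 0 < Re q ->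
  J p 0 1 * J q 0 1 = Beta p q * J (p + q) 0 1.
Proof.
move=> p0 q0; have pq0 : 0 < Re (p + q) by rewrite cReD addr_gt0.
pose f v u := kJ p 0 1 (u + v) * kJ q 0 1 v.
have fE v u : f v u = cexp (p * u%:C) * kJ (p + q) 0 (1 + expR u) v.
  rewrite /f /kJ !cpow0 !mulr1 !mulN1r expRD rcD mulrDr mulrDl !cexpD.
  rewrite (_ : - (1 + expR u) * expR v = - expR v - expR u * expR v); last by ring.
  rewrite expRD rcM; ring.
have -> : J p 0 1 * J q 0 1 = cint (fun v => cint (f v)).
  rewrite -cintZ; last exact: cintble_kJ.
  apply: eq_cint => v; rewrite /f cintZr ?(cint_shift v (ccont_kJ p 0 1)).1//.
  by apply/(cint_shift v (ccont_kJ p 0 1)).2; exact: cintble_kJ.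
rewrite (@cFubini _ f (fun v u => normc (kJ p 0 1 (u + v)) * normc (kJ q 0 1 v))
   (fun v => (\int[mu]_u normc (kJ p 0 1 u)) * normc (kJ q 0 1 v))).
- rewrite /Beta -cintZr; last exact: cintble_kB.
  apply: eq_cint => u; under eq_cint do rewrite fE.
  rewrite cintZ; last exact: cintble_kJ.
  by rewrite -/(J _ _ _) J_scale// /kB mulrA.
- apply: cmeasM; apply: cmeas_comp; [exact: cmeas_kJ| |exact: cmeas_kJ|exact: measurable_fst].
  by apply: measurable_funD; [exact: measurable_snd|exact: measurable_fst].
- move=> v; apply: rintegrable_ext (rintegrableZ (normc (kJ q 0 1 v)) _) => [u|].
    exact: mulrC.
  apply: (rint_shift v (continuous_normc (ccont_kJ p 0 1))).2.
  exact/cintble_normc/cintble_kJ.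
- by move=> v u; rewrite /f normcM.
- move=> v.
  have [e hi] := rint_shift v (continuous_normc (ccont_kJ p 0 1)).
  have := hi (cintble_normc (cintble_kJ _ p0 ltr01)) => {}hi.
  by rewrite (RintegralZr _ measurableT hi) e.
- exact/rintegrableZ/cintble_normc/cintble_kJ.
Qed.

End euler_gamma.

(** * Zeros and functional equation of Gamma *)

Section gamma_function.
Context {R : realType}.
Local Notation mu := (@lebesgue_measure R).
Implicit Types (a b p q z : R[i]) (x u s t : R).

Definition kG s u : R := expR (s * u) * expR (- expR u).
Definition rgamma s : R := \int[mu]_u kG s u.

Lemma kJ_real s u : kJ s%:C 0 1 u = (kG s u)%:C.
Proof. by rewrite /kJ /kG cpow0 mulr1 mulN1r -rcM cexp_real -rcM. Qed.

Lemma rgammaE s : J s%:C 0 1 = (rgamma s)%:C.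
Proof. by rewrite /J (eq_cint (kJ_real s)) cintR. Qed.

Lemma rintegrable_kG s : 0 < s -> rintegrable (kG s).
Proof.
move=> s0; have [h _] := @cintble_kJ R s%:C 0 1 s0 ltr01.
by apply: rintegrable_ext h => u; rewrite kJ_real.
Qed.

Lemma rgammaS s : 0 < s -> rgamma (s + 1) = s * rgamma s.
Proof.
move=> s0; have := @eulerS R s%:C s0; rewrite -[1]/(1%:C) -rcD !rgammaE -rcM.
exact: complexI.
Qed.

Lemma rgamma_gt0 s : 0 < s -> 0 < rgamma s.
Proof.
move=> s0; pose c : R := expR (- expR 1).
have c0 : 0 < c by exact: expR_gt0.
pose A : set R := `[0, 1]%classic.
have mI : measurable A by exact: measurable_itv.
have le u : (cst c \_ A) u <= kG s u.
  rewrite /patch; case: ifPn => [|_]; last by rewrite /kG mulr_ge0 ?expR_ge0.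
  rewrite inE /A /= in_itv /= => /andP[u0 u1]; rewrite /kG /c -[expR (- expR 1)]mul1r.
  apply: ler_pM; rewrite ?expR_ge0//; first by rewrite -expR0 ler_expR mulr_ge0// ltW.
  by rewrite ler_expR lerN2 ler_expR.
have ic : rintegrable (cst c \_ A).
  apply: (rintegrable_le _ (rintegrable_kG s0)) => [|u].
    by apply/(measurable_restrictT _ mI); exact: measurable_cst.
  by rewrite ger0_norm// /patch; case: ifP => // _; exact: ltW.
apply: lt_le_trans (le_rint ic (rintegrable_kG s0) le).
have vA : lebesgue_measure A = 1%:E.
  by rewrite /A lebesgue_measure_itv /= lte_fin ltr01 -EFinB subr0.
rewrite -Rintegral_mkcond Rintegral_cst// (_ : fine _ = 1) ?mulr1//.
exact: (congr1 fine vA).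
Qed.

(* After rotation by [s^{- i t}] the integrand has phase [t (u - ln s)], and
   [1 - cos] is quadratically small where the real kernel is concentrated. *)
Lemma euler_neq0_large s t : 1 + 4 * t ^+ 2 < s -> J (s +i* t) 0 1 != 0.
Proof.
move=> hs; have t2 : 0 <= t ^+ 2 by exact: sqr_ge0.
have s1 : 0 < s - 1 by lra.
have s0 : 0 < s by lra.
have s00 : 0 < s + 1 by lra.
pose L := ln s.
apply/eqP => J0.
pose w := cexp ((- (t * L)) *i).
have e u : Re (w * kJ (s +i* t) 0 1 u) = kG s u * cos (t * (u - L)).
  rewrite /w /kJ cpow0 mulr1 mulrA -cexpD cReMr /cexp /=.
  rewrite /kG mulN1r mulrAC; congr (_ * _ * cos _); first by congr expR; ring.
  by ring.
have i0 : cintble (kJ (s +i* t) 0 1) by exact: cintble_kJ.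
have i1 := cintbleZ w i0.
have I0 : \int[mu]_u (kG s u * cos (t * (u - L))) = 0.
  transitivity (Re (cint (fun u => w * kJ (s +i* t) 0 1 u))).
    by apply: eq_Rintegral => u _; rewrite e.
  by rewrite cintZ// -/(J _ _ _) J0 mulr0.
(* [lo] is [kG s u] times [1 - 2 t^2 (e^{u-L} + e^{L-u} - 2)], a lower bound of the cosine chosen
   because its integral involves only real Gamma values at [s - 1], [s] and [s + 1]. *)
pose lo u := (1 + 4 * t ^+ 2) * kG s u - (2 * t ^+ 2) * (s^-1 * kG (s + 1) u + s * kG (s - 1) u).
have ilo : rintegrable lo.
  apply: rintegrable_ext (rintegrableD (rintegrableZ (1 + 4 * t ^+ 2) (rintegrable_kG s0))
    (rintegrableZ (- (2 * t ^+ 2)) (rintegrableD (rintegrableZ s^-1 (rintegrable_kG s00))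
      (rintegrableZ s (rintegrable_kG s1))))) => u.
  by rewrite /lo mulNr.
have ic : rintegrable (fun u => kG s u * cos (t * (u - L))).
  by case: i1 => h _; apply: rintegrable_ext h => u; rewrite e.
have hlo u : lo u <= kG s u * cos (t * (u - L)).
  have k1 : kG (s + 1) u = kG s u * expR u.
    by rewrite /kG mulrDl mul1r expRD mulrAC.
  have k2 : kG (s - 1) u = kG s u * expR (- u).
    by rewrite /kG mulrBl mul1r expRD mulrAC.
  have -> : lo u = kG s u * (1 - 2 * t ^+ 2 * (expR (u - L) + expR (- (u - L)) - 2)).
    rewrite /lo k1 k2 opprB !expRD /L (expRN (ln s)) lnK//; ring.
  rewrite ler_wpM2l//; first by rewrite /kG mulr_ge0 ?expR_ge0.
  apply: le_trans (cos_ge_quad _).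
  have := sqr_le_expR (u - L); rewrite exprMn => h.
  have := ler_wpM2l t2 h; lra.
have := le_rint ilo ic hlo; rewrite I0.
(* Relative to [kG s], the means of [e^{u-L}] and [e^{L-u}] are 1 and [s / (s - 1)], so that
   [e^{u-L} + e^{L-u} - 2] has mean [1 / (s - 1)]. *)
have -> : \int[mu]_u lo u = rgamma s * (1 - 2 * t ^+ 2 / (s - 1)).
  have i3 := rintegrableZ s^-1 (rintegrable_kG s00).
  have i4 := rintegrableZ s (rintegrable_kG s1).
  have i5 := rintegrableZ (1 + 4 * t ^+ 2) (rintegrable_kG s0).
  have i6 := rintegrableZ (2 * t ^+ 2) (rintegrableD i3 i4).
  rewrite /lo (RintegralB measurableT i5 i6).
  rewrite (RintegralZl _ measurableT (rintegrable_kG s0)).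
  rewrite (RintegralZl _ measurableT (rintegrableD i3 i4)) (RintegralD measurableT i3 i4).
  rewrite (RintegralZl _ measurableT (rintegrable_kG s00)).
  rewrite (RintegralZl _ measurableT (rintegrable_kG s1)).
  rewrite -!/(rgamma _) rgammaS//.
  have : rgamma (s - 1 + 1) = (s - 1) * rgamma (s - 1) by exact: rgammaS.
  rewrite subrK => ->; field.
  by rewrite !gt_eqF.
apply/negP; rewrite -ltNge mulr_gt0 ?rgamma_gt0// subr_gt0 ltr_pdivrMr// mul1r.
lra.
Qed.

Lemma euler_shift z n : 0 < Re z -> J (z + n%:R) 0 1 = pochhammer z n * J z 0 1.
Proof.
move=> z0; elim: n => [|n IH]; first by rewrite /pochhammer big_ord0 addr0 mul1r.
rewrite -addn1 natrD addrA eulerS; last by rewrite !cRIE ltr_wpDr.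
rewrite IH /pochhammer addn1 big_ord_recr /=; ring.
Qed.

(** The functional equation expresses the value at [z + n] as a multiple of the value at [z], and
    for large [n] the point [z + n] lies in the region of [euler_neq0_large], as the imaginary part
    does not change. *)
Lemma euler_neq0 z : 0 < Re z -> J z 0 1 != 0.
Proof.
move=> z0; pose n := (Num.truncn (1 + 4 * Im z ^+ 2)).+1.
have := euler_shift n z0; rewrite (_ : z + n%:R = (Re z + n%:R) +i* Im z); last first.
  by apply: complexP; rewrite !cRIE /= ?addr0.
move=> h; have : J ((Re z + n%:R) +i* Im z) 0 1 != 0.
  apply: euler_neq0_large.
  have h0 : 0 <= 1 + 4 * Im z ^+ 2 by rewrite addr_ge0// mulr_ge0// sqr_ge0.
  have /andP[_ h1] := truncn_itv h0.
  by apply: lt_trans h1 _; rewrite -/n ltrDr.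
by rewrite h; apply: contraNneq => ->; rewrite mulr0.
Qed.

Lemma GammaE z : 0 < Re z -> Gamma z = J z 0 1.
Proof.
by move=> z0; rewrite /Gamma z0 addr0 euler_integralE// /pochhammer big_ord0 divr1.
Qed.

Lemma Gamma_neq0 z : 0 < Re z -> Gamma z != 0.
Proof. by move=> z0; rewrite GammaE// euler_neq0. Qed.

Lemma pochhammerS z n : pochhammer z n.+1 = z * pochhammer (z + 1) n.
Proof.
rewrite /pochhammer big_ord_recl /= addr0; congr (_ * _).
by apply: eq_bigr => i _; rewrite /bump /= natrD addrA.
Qed.

(** It holds at every [z]: at the poles both sides are 0 by the convention on [Gamma]. Using the
    reciprocal therefore keeps the contiguity relations below free of exceptions. *)
Lemma invGammaS z : (Gamma z)^-1 = z * (Gamma (z + 1))^-1.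
Proof.
have [z0|z0] := ltP 0 (Re z).
  have z10 : 0 < Re (z + 1) by rewrite cReD ltr_wpDr/=.
  rewrite !GammaE// eulerS// invfM mulrA divff ?mul1r//.
  by apply/eqP => e; move: z0; rewrite e ltxx.
have hz : ~~ (0 < Re z) by rewrite -leNgt.
rewrite {1}/Gamma (negbTE hz) /=.
have [z1|z1] := ltP 0 (Re (z + 1)).
  rewrite GammaE// (_ : Num.truncn _ = 0%N); last first.
    by apply: truncn_def; rewrite oppr_ge0 z0 /=; move: z1; rewrite cReD /=; lra.
  by rewrite euler_integralE// pochhammerS /pochhammer big_ord0 mulr1 invf_div.
have hz1 : ~~ (0 < Re (z + 1)) by rewrite -leNgt.
rewrite /Gamma (negbTE hz1).
(* The number of continuation steps drops by exactly one from [z] to [z + 1]. *)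
have -> : (Num.truncn (- Re z)).+1 = (Num.truncn (- Re (z + 1))).+2.
  congr S; apply: truncn_def.
  have h0 : 0 <= - Re (z + 1) by rewrite oppr_ge0.
  have /andP[] := truncn_itv h0; rewrite cReD /= -!natr1; lra.
rewrite pochhammerS !invf_div mulrA; congr (_ * _ / euler_integral _).
by rewrite -[in LHS]natr1; ring.
Qed.

Lemma GammaS z : z != 0 -> Gamma (z + 1) = z * Gamma z.
Proof.
move=> z0; have h := invGammaS z.
by rewrite -[Gamma z]invrK h invfM invrK mulrA divff// mul1r.
Qed.

End gamma_function.

(** * Kummer's function *)

Section entire_series.
Context {R : realType}.
Implicit Types (s t : nat -> R[i]) (a c k z : R[i]) (x : R).

(** This factorial bound is stable under [cdiffs] and [cshift], so that identities between series
    and their derivatives reduce to identities between coefficients. *)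
Definition entire s := exists C K : R,
  [/\ 0 <= C, 0 <= K & forall n, normc (s n) <= C * (K ^+ n / n`!%:R)].

(** Splitting into two real power series gives access to termwise differentiation of real power
    series. *)
Definition cps s x : R[i] :=
  limn (pseries (fun n => Re (s n)) x) +i* limn (pseries (fun n => Im (s n)) x).

Definition cdiffs s n : R[i] := n.+1%:R * s n.+1.
Definition cshift s n : R[i] := if n is m.+1 then s m else 0.

Lemma normcD z w : normc (z + w) <= normc z + normc w.
Proof. exact: le_normcD. Qed.

Lemma normc_nat n : normc (n%:R : R[i]) = n%:R.
Proof. by rewrite natC normc_real ger0_norm. Qed.

Lemma entireD s t : entire s -> entire t -> entire (fun n => s n + t n).
Proof.
move=> [C [K [C0 K0 h]]] [D [L [D0 L0 g]]]; exists (C + D), (K + L).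
split; rewrite ?addr_ge0// => n; apply: (le_trans (normcD _ _)).
rewrite mulrDl; apply: lerD; [apply: le_trans (h n) _|apply: le_trans (g n) _];
  rewrite ler_wpM2l// ler_wpM2r ?invr_ge0// lerXn2r ?nnegrE ?addr_ge0//.
- by rewrite lerDl.
- by rewrite lerDr.
Qed.

Lemma entireZ s k : entire s -> entire (fun n => k * s n).
Proof.
move=> [C [K [C0 K0 h]]]; exists (normc k * C), K; split => //.
  by rewrite mulr_ge0 ?normc_ge0.
by move=> n; rewrite normcM -mulrA ler_wpM2l ?normc_ge0.
Qed.

Lemma entire_diffs s : entire s -> entire (cdiffs s).
Proof.
move=> [C [K [C0 K0 h]]]; exists (C * K), K; split => //; first exact: mulr_ge0.
move=> n; rewrite /cdiffs normcM normc_nat.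
apply: (@le_trans _ _ (n.+1%:R * (C * (K ^+ n.+1 / n.+1`!%:R)))); first by rewrite ler_wpM2l.
rewrite factS natrM exprS le_eqVlt; apply/orP; left; apply/eqP; field.
by rewrite nat1r !pnatr_eq0 -lt0n fact_gt0.
Qed.

Lemma entire_shift s : entire s -> entire (cshift s).
Proof.
(* The shift replaces [n!] by [(n + 1)!] at the price of a factor [n + 1 <= 2^{n+1}], absorbed by
   doubling the base; [K + 1 >= 1] allows the extra power. *)
move=> [C [K [C0 K0 h]]]; exists C, (2 * (K + 1)); split => //.
  by rewrite mulr_ge0// addr_ge0.
case=> [|n] /=; first by rewrite expr0n addr0 sqrtr0 mulr_ge0// mulr_ge0 ?invr_ge0// expr0.
apply: le_trans (h n) _; rewrite ler_wpM2l//.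
rewrite factS natrM invfM mulrA ler_wpM2r ?invr_ge0//.
rewrite ler_pdivlMr ?ltr0Sn// exprMn mulrC.
apply: ler_pM; rewrite ?exprn_ge0//.
  by rewrite -natrX ler_nat ltnW// ltn_expl.
apply: (@le_trans _ _ ((K + 1) ^+ n)).
  by rewrite lerXn2r ?nnegrE ?addr_ge0// lerDl.
by rewrite exprS ler_peMl ?exprn_ge0 ?addr_ge0// lerDr.
Qed.

Lemma cvg_entire_real (f : nat -> R) (C K : R) x : 0 <= C -> 0 <= K ->
  (forall n, `|f n| <= C * (K ^+ n / n`!%:R)) -> cvgn (pseries f x).
Proof.
move=> C0 K0 h; apply: normed_cvg; rewrite /normed_series_of.
apply: (@series_le_cvg _ _ (C *: exp_coeff (K * `|x|))).
- by move=> n; exact: normr_ge0.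
- by move=> n; rewrite /= mulr_ge0// exp_coeff_ge0// mulr_ge0.
- move=> n; rewrite /= normrM normrX /exp_coeff /=.
  apply: le_trans (ler_wpM2r _ (h n)) _; first by rewrite exprn_ge0.
  rewrite [leRHS](_ : _ = C * ((K * `|x|) ^+ n / n`!%:R))// exprMn le_eqVlt.
  by apply/orP; left; apply/eqP; ring.
- by rewrite seriesZ; apply: is_cvgZr; exact: is_cvg_series_exp_coeff.
Qed.

Lemma cvg_entire s x : entire s ->
  cvgn (pseries (fun n => Re (s n)) x) /\ cvgn (pseries (fun n => Im (s n)) x).
Proof.
move=> [C [K [C0 K0 h]]]; split; apply: (cvg_entire_real C0 K0) => n.
  exact: le_trans (normRe_le _) (h n).
exact: le_trans (normIm_le _) (h n).
Qed.

Definition cpsum s x n : R[i] := \sum_(0 <= i < n) s i * (x ^+ i)%:C.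

Lemma cRe_sum (F : nat -> R[i]) n : Re (\sum_(0 <= i < n) F i) = \sum_(0 <= i < n) Re (F i).
Proof.
elim: n => [|n IH]; first by rewrite !big_geq.
by rewrite !big_nat_recr//= cReD IH.
Qed.

Lemma cIm_sum (F : nat -> R[i]) n : Im (\sum_(0 <= i < n) F i) = \sum_(0 <= i < n) Im (F i).
Proof.
elim: n => [|n IH]; first by rewrite !big_geq.
by rewrite !big_nat_recr//= cImD IH.
Qed.

Lemma cps_cvg s x : entire s -> ccvg (cpsum s x) (cps s x).
Proof.
move=> /(cvg_entire x)[h1 h2]; split => /=.
  rewrite (_ : (fun n => _) = pseries (fun n => Re (s n)) x)//.
  by apply/funext => n; rewrite cRe_sum /pseries /series /=; apply: eq_bigr => i _; rewrite cReMr.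
rewrite (_ : (fun n => _) = pseries (fun n => Im (s n)) x)//.
by apply/funext => n; rewrite cIm_sum /pseries /series /=; apply: eq_bigr => i _; rewrite cImMr.
Qed.

Lemma cpsD s t x : entire s -> entire t -> cps (fun n => s n + t n) x = cps s x + cps t x.
Proof.
move=> es et; apply: (ccvg_uniq (cps_cvg x (entireD es et))).
apply: ccvg_ext (ccvgD (cps_cvg x es) (cps_cvg x et)) => n.
by rewrite /cpsum -big_split /=; apply: eq_bigr => i _; rewrite mulrDl.
Qed.

Lemma cpsZ s k x : entire s -> cps (fun n => k * s n) x = k * cps s x.
Proof.
move=> es; apply: (ccvg_uniq (cps_cvg x (entireZ k es))).
apply: ccvg_ext (ccvgM (ccvg_cst k) (cps_cvg x es)) => n.
by rewrite /cpsum big_distrr /=; apply: eq_bigr => i _; rewrite mulrA.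
Qed.

Lemma cpsX s x : entire s -> cps (cshift s) x = x%:C * cps s x.
Proof.
move=> es; have es' := entire_shift es.
have h : ccvg (fun n => cpsum (cshift s) x n.+1) (cps (cshift s) x).
  have [h1 h2] := cps_cvg x es'.
  by split; [rewrite (cvg_shiftS (fun n => Re (cpsum (cshift s) x n)))|
             rewrite (cvg_shiftS (fun n => Im (cpsum (cshift s) x n)))].
apply: (ccvg_uniq h); apply: ccvg_ext (ccvgM (ccvg_cst x%:C) (cps_cvg x es)) => n.
rewrite /cpsum big_nat_recl// /= mul0r add0r big_distrr /=.
by apply: eq_bigr => i _; rewrite exprS rcM; ring.
Qed.

Lemma cder_cps s x : entire s -> cder (cps s) x (cps (cdiffs s) x).
Proof.
move=> es; have e1 := entire_diffs es; have e2 := entire_diffs e1.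
have xK : `|x| < `|(`|x| + 1)| by rewrite [ltRHS]ger0_norm ?addr_ge0// ltrDl.
have dR u : (fun n => Re (cdiffs u n)) = pseries_diffs (fun n => Re (u n)).
  by apply/funext => n; rewrite /cdiffs /pseries_diffs natC cReMl.
have dI u : (fun n => Im (cdiffs u n)) = pseries_diffs (fun n => Im (u n)).
  by apply/funext => n; rewrite /cdiffs /pseries_diffs natC cImMl.
have [a1 b1] := cvg_entire (`|x| + 1) es.
have [a2 b2] := cvg_entire (`|x| + 1) e1.
have [a3 b3] := cvg_entire (`|x| + 1) e2.
split; rewrite /= ?dR ?dI.
  by apply: pseries_snd_diffs xK => //; rewrite -?dR.
by apply: pseries_snd_diffs xK => //; rewrite -?dI.
Qed.

Lemma cps0 s : entire s -> cps s 0 = s 0%N.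
Proof.
move=> es; apply: (ccvg_uniq (cps_cvg 0 es)).
have h n : cpsum s 0 n.+1 = s 0%N.
  rewrite /cpsum big_nat_recl// expr0 mulr1 big1 ?addr0// => i _.
  by rewrite expr0n /= mulr0.
have : ccvg (fun n => cpsum s 0 n.+1) (s 0%N).
  by apply: ccvg_ext (ccvg_cst (s 0%N)).
by move=> [h1 h2]; split; [rewrite -(cvg_shiftS (fun n => Re (cpsum s 0 n)))|
                           rewrite -(cvg_shiftS (fun n => Im (cpsum s 0 n)))].
Qed.

End entire_series.

Section kummer_series.
Context {R : realType}.
Implicit Types (a c z : R[i]) (x : R).

Definition kcoef a c n : R[i] := pochhammer a n / pochhammer c n / n`!%:R.
Definition kM a c x : R[i] := cps (kcoef a c) x.
Definition dkM a c x : R[i] := cps (cdiffs (kcoef a c)) x.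

Lemma pochhammerSr a n : pochhammer a n.+1 = pochhammer a n * (a + n%:R).
Proof. by rewrite /pochhammer big_ord_recr. Qed.

Lemma addn_neq0 c n : 0 < Re c -> c + n%:R != 0.
Proof.
move=> c0; apply/eqP => /(congr1 Re); rewrite !cRIE /= => h.
have : 0 < Re c + n%:R by rewrite ltr_wpDr.
by rewrite h ltxx.
Qed.

Lemma pochhammer_neq0 c n : 0 < Re c -> pochhammer c n != 0.
Proof.
move=> c0; elim: n => [|n IH]; first by rewrite /pochhammer big_ord0 oner_eq0.
by rewrite pochhammerSr mulf_neq0// addn_neq0.
Qed.

Lemma natSC_neq0 n : n%:R + 1 != 0 :> R[i].
Proof. by rewrite natr1 pnatr_eq0. Qed.

Lemma factC_neq0 n : n`!%:R != 0 :> R[i].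
Proof. by rewrite pnatr_eq0 -lt0n fact_gt0. Qed.

Lemma kcoef0 a c : kcoef a c 0 = 1.
Proof. by rewrite /kcoef /pochhammer !big_ord0 !divr1. Qed.

Lemma kcoefS a c n : 0 < Re c ->
  (c + n%:R) * (n%:R + 1) * kcoef a c n.+1 = (a + n%:R) * kcoef a c n.
Proof.
move=> c0; rewrite /kcoef !pochhammerSr factS natrM -natr1.
have := addn_neq0 n c0; have := pochhammer_neq0 n c0; have := natSC_neq0 n.
have := factC_neq0 n => h1 h2 h3 h4; field.
by rewrite h1 h2 h3 h4.
Qed.

Lemma entire_kcoef a c : 0 < Re c -> entire (kcoef a c).
Proof.
(* [K] bounds each ratio [(a + n) / (c + n) = (a - c) / (c + n) + 1], since the modulus of [c + n]
   is at least [Re c]. *)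
move=> c0; pose K := normc (a - c) / Re c + 1.
have K0 : 0 <= K by rewrite addr_ge0// divr_ge0 ?normc_ge0// ltW.
exists 1, K; split => // n; rewrite mul1r /kcoef normcM normcV normc_nat.
rewrite ler_wpM2r ?invr_ge0//; elim: n => [|n IH].
  by rewrite /pochhammer !big_ord0 divr1 expr0 normc_real normr1.
rewrite !pochhammerSr invfM mulrACA normcM exprSr.
apply: ler_pM; rewrite ?normc_ge0// normcM normcV.
have cn : Re c <= normc (c + n%:R).
  apply: le_trans (normRe_le _); rewrite !cRIE ger0_norm ?lerDl//.
  by rewrite addr_ge0// ltW.
have cn0 : 0 < normc (c + n%:R) by exact: lt_le_trans cn.
rewrite ler_pdivrMr// /K mulrDl mul1r.
rewrite (_ : a + n%:R = (a - c) + (c + n%:R)); last by ring.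
apply: (le_trans (normcD _ _)); rewrite lerD2r.
rewrite mulrAC ler_pdivlMr// ler_wpM2l ?normc_ge0//.
Qed.

Lemma cder_kM a c x : 0 < Re c -> cder (kM a c) x (dkM a c x).
Proof. by move=> c0; apply: cder_cps; exact: entire_kcoef. Qed.

Lemma cder_dkM a c x : 0 < Re c ->
  cder (dkM a c) x (cps (cdiffs (cdiffs (kcoef a c))) x).
Proof. by move=> c0; apply: cder_cps; exact/entire_diffs/entire_kcoef. Qed.

Lemma kM0 a c : 0 < Re c -> kM a c 0 = 1.
Proof. by move=> c0; rewrite /kM cps0 ?kcoef0//; exact: entire_kcoef. Qed.

(** Coefficientwise this is the recursion [kcoefS]; the constant term is separate because
    multiplication by [x] shifts the others. *)
Lemma kummer_ode a c x : 0 < Re c ->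
  x%:C * cps (cdiffs (cdiffs (kcoef a c))) x + (c - x%:C) * dkM a c x = a * kM a c x.
Proof.
move=> c0; have e0 := entire_kcoef a c0.
have e1 := entire_diffs e0; have e2 := entire_diffs e1.
apply/eqP; rewrite mulrBl addrA subr_eq; apply/eqP.
rewrite /dkM /kM -!cpsX// -!cpsZ// -!cpsD//; try exact: entire_shift; try exact: entireZ.
congr (cps _ x); apply/funext => -[|n]; rewrite /= /cdiffs.
  have := kcoefS a 0 c0; rewrite addr0 add0r addr0 => h.
  by rewrite add0r addr0 -h; ring.
have := kcoefS a n.+1 c0; rewrite -(natr1 n.+1) => h.
rewrite [RHS](_ : _ = (a + n.+1%:R) * kcoef a c n.+1); last by ring.
by rewrite -h; ring.
Qed.

(** Here and in [kM_raise] a neighbour in [a] is expressed through the function and its derivative;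
    this is what later lets differentiation in [x] shift the first parameter. *)
Lemma kM_lower a c x : 0 < Re c ->
  (a - c) * kM (a - 1) c x = (a - c + x%:C) * kM a c x - x%:C * dkM a c x.
Proof.
move=> c0; have e0 := entire_kcoef a c0; have e1 := entire_diffs e0.
have e2 := entire_kcoef (a - 1) c0.
apply/eqP; rewrite -subr_eq opprK (mulrDl (a - c)); apply/eqP.
rewrite /dkM /kM -!cpsX// -!cpsZ// -!cpsD//; try exact: entire_shift; try exact: entireZ.
congr (cps _ x); apply/funext => -[|n]; rewrite /= ?kcoef0 ?addr0//.
rewrite /cdiffs /kcoef pochhammerS subrK !pochhammerSr factS natrM -natr1.
have := addn_neq0 n c0; have := pochhammer_neq0 n c0; have := natSC_neq0 n.
have := factC_neq0 n => h1 h2 h3 h4; field.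
by rewrite h1 h2 h3 h4.
Qed.

Lemma kM_raise a c x : 0 < Re c ->
  a * kM (a + 1) c x = a * kM a c x + x%:C * dkM a c x.
Proof.
move=> c0; have e0 := entire_kcoef a c0; have e1 := entire_diffs e0.
have e2 := entire_kcoef (a + 1) c0.
rewrite /dkM /kM -!cpsX// -!cpsZ// -!cpsD//; try exact: entire_shift; try exact: entireZ.
congr (cps _ x); apply/funext => -[|n]; rewrite /= ?kcoef0 ?addr0//.
rewrite /cdiffs -mulrDl /kcoef !mulrA -pochhammerS pochhammerSr -natr1 mulrAC; ring.
Qed.

Lemma cvg_ccvg (u : nat -> R[i]) (l : R[i]) : ccvg u l ->
  (u n : R[i]^o) @[n --> \oo] --> (l : R[i]^o).
Proof.
move=> [h1 h2]; apply/cvgrPdist_le => /= e e0.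
have [e1 e2] : 0 < Re e /\ e = (Re e)%:C.
  by case: e e0 => a b; rewrite ltcE /= => /andP[/eqP -> ->].
have e3 : 0 < Re e / 2 by rewrite divr_gt0.
move/cvgrPdist_le : h1 => /(_ _ e3) h1; move/cvgrPdist_le : h2 => /(_ _ e3) h2.
near=> n; rewrite e2.
have -> : `|l - u n| = (normc (l - u n))%:C by [].
rewrite lecR (le_trans (normc_le _))// (splitr (Re e)) lerD//.
  by rewrite cReB; near: n.
by rewrite cImB; near: n.
Unshelve. all: by end_near. Qed.

Lemma hyp1F1E a c x : 0 < Re c -> hyp1F1 a c x%:C = kM a c x.
Proof.
move=> c0; have h := cps_cvg x (entire_kcoef a c0).
rewrite /hyp1F1; apply: (@cvg_lim R[i]^o); first exact: norm_hausdorff.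
have -> : (fun n => \sum_(0 <= k < n)
    (pochhammer a k / pochhammer c k * (x%:C ^+ k / k`!%:R))) =
  cpsum (kcoef a c) x.
  by apply/funext => n; apply: eq_bigr => k _; rewrite /kcoef rcX; ring.
exact: cvg_ccvg.
Qed.

End kummer_series.

(** * Integral representation of Tricomi's function *)

Section wronskian.
Context {R : realType}.
Implicit Types (a b c z : R[i]) (x : R).

Definition kummer_sol a c (f f1 f2 : R -> R[i]) := forall x, 0 < x ->
  [/\ cder f x (f1 x), cder f1 x (f2 x) &
      x%:C * f2 x + (c - x%:C) * f1 x = a * f x].

(** The weight [x^c e^{-x}] is the integrating factor of Kummer's equation, so by Abel's identity
    this quantity is constant for two solutions. *)
Definition wronskian c (f f1 g g1 : R -> R[i]) x : R[i] :=
  cpow x c * (expR (- x))%:C * (f1 x * g x - f x * g1 x).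

Lemma rc_neq0 x : 0 < x -> x%:C != 0 :> R[i].
Proof. by move=> x0; rewrite rc_eq0 gt_eqF. Qed.

Lemma wronskian_cst a c f f1 f2 g g1 g2 x y :
  kummer_sol a c f f1 f2 -> kummer_sol a c g g1 g2 -> 0 < x -> 0 < y ->
  wronskian c f f1 g g1 x = wronskian c f f1 g g1 y.
Proof.
move=> hf hg; apply: cder_cst_itv => t t0.
have [f01 f12 fe] := hf _ t0; have [g01 g12 ge] := hg _ t0.
have h1 := @cder_cpow R (fun t => t) t 1 c t0 (rder_id t).
have h2 := cder_real (rder_comp (is_derive_expR _) (rderN (rder_id t))).
apply: cder_eq (cderM (cderM h1 h2) (cderB (cderM f12 g01) (cderM f01 g12))) _.
have tC := rc_neq0 t0; apply: (mulfI tC); rewrite mulr0 rcM rcV rcM rcN.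
transitivity (cpow t c * (expR (- t))%:C *
  ((t%:C * f2 t + (c - t%:C) * f1 t) * g t - (t%:C * g2 t + (c - t%:C) * g1 t) * f t)).
  by field.
by rewrite fe ge; ring.
Qed.

Lemma kummer_sol_kM a c : 0 < Re c ->
  kummer_sol a c (kM a c) (dkM a c) (cps (cdiffs (cdiffs (kcoef a c)))).
Proof.
move=> c0 x x0; split; [exact: cder_kM|exact: cder_dkM|exact: kummer_ode].
Qed.

Definition kN a c x : R[i] := cpow x (1 - c) * kM (a - c + 1) (2 - c) x.
Definition dkN a c x : R[i] := cpow x (1 - c) *
  ((1 - c) / x%:C * kM (a - c + 1) (2 - c) x + dkM (a - c + 1) (2 - c) x).

Lemma cder_kN a c x : 0 < x -> Re c < 2 -> cder (kN a c) x (dkN a c x).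
Proof.
move=> x0 c2; have c'0 : 0 < Re (2 - c) by rewrite cReB /= subr_gt0.
have h1 := @cder_cpow R (fun t => t) x 1 (1 - c) x0 (rder_id x).
apply: cder_eq (cderM h1 (cder_kM (a - c + 1) x c'0)) _.
rewrite /dkN mul1r rcV; ring.
Qed.

Lemma kummer_sol_kN a c : Re c < 2 -> exists f2, kummer_sol a c (kN a c) (dkN a c) f2.
Proof.
move=> c2; have c'0 : 0 < Re (2 - c) by rewrite cReB /= subr_gt0.
pose ddk := cps (cdiffs (cdiffs (kcoef (a - c + 1) (2 - c)))).
pose k := kM (a - c + 1) (2 - c); pose dk := dkM (a - c + 1) (2 - c).
exists (fun x => cpow x (1 - c) * ((1 - c) / x%:C * ((1 - c) / x%:C * k x + dk x)
   - (1 - c) / x%:C ^+ 2 * k x + (1 - c) / x%:C * dk x + ddk x)).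
move=> x x0; have xC := rc_neq0 x0.
have h1 := @cder_cpow R (fun t => t) x 1 (1 - c) x0 (rder_id x).
split.
- exact: cder_kN.
- have h2 : cder (fun t : R => (1 - c) / t%:C) x (- ((1 - c) / x%:C ^+ 2)).
    have hV : rder (fun t : R => t^-1) x (- x ^- 2).
      have x0' : x != 0 by rewrite gt_eqF.
      apply: rder_eq (@is_deriveV R (fun t => t) x 1 1 x0' (rder_id x)) _.
      by rewrite /GRing.scale /= mulr1.
    apply: cder_ext (cder_eq (cderZ (1 - c) (cder_real hV)) _) => [t|].
      by rewrite rcV.
    by rewrite rcN rcV rcX; ring.
  apply: cder_eq (cderM h1 (cderD (cderM h2 (cder_kM (a - c + 1) x c'0))
     (cder_dkM (a - c + 1) x c'0))) _.
  rewrite -/(k x) -/(dk x) -/(ddk x) mul1r rcV; ring.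
- have e := kummer_ode (a - c + 1) x c'0; rewrite -/(k x) -/(dk x) -/(ddk x) in e.
  apply/eqP; rewrite -subr_eq0; apply/eqP.
  rewrite /dkN /kN -/(k x) -/(dk x).
  transitivity (cpow x (1 - c) * (x%:C * ddk x + (2 - c - x%:C) * dk x - (a - c + 1) * k x)).
    by field.
  by rewrite e subrr mulr0.
Qed.

(** Each [x]-derivative of [J] raises [a] by one and changes sign; the equation is [J_byparts] after
    [J_succ] has removed the exponents [b + 1]. *)
Lemma kummer_sol_J a b : 0 < Re a -> kummer_sol a (a + b + 1) (J a b)
  (fun x => - J (a + 1) b x) (J (a + 1 + 1) b).
Proof.
move=> a0 x x0; have a1 : 0 < Re (a + 1) by rewrite cReD /= addr_gt0.
split; first exact: cder_J.
  by apply: cder_eq (cderN (cder_J b a1 x0)) _; rewrite opprK.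
have := J_byparts b a0 x0; rewrite !J_succ// => e.
apply/eqP; rewrite -subr_eq0; apply/eqP; rewrite -[RHS]oppr0 -e; ring.
Qed.

End wronskian.

(** * Behaviour at the origin and the connection coefficients *)

Section connection.
Context {R : realType}.
Implicit Types (a b c z : R[i]) (x : R).

Let h_ (n : nat) : R := n.+1%:R^-1.
Let h_gt0 n : 0 < h_ n. Proof. by rewrite invr_gt0. Qed.
Let h_cvg : h_ n @[n --> \oo] --> (0 : R). Proof. exact: cvg_harmonic. Qed.

Let cpow_h0 z : 0 < Re z -> ccvg (fun n => cpow (h_ n) z) 0.
Proof.
move=> z0; apply: (@ccvg0_le _ _ (fun n => h_ n `^ Re z)).
  by move=> n; rewrite normc_cpow.
have /cvg_at_rightP := powR_cvg0 z0; apply; split => //.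
Qed.

(** Translating by [ln x] turns [(1 + e^u)^b] into [(x + e^v)^b] and removes [x] from the
    exponential. As [Re b < 0], its modulus is at most that of [e^{bv}], so the integrand is
    dominated by a Gamma kernel. *)
Lemma J_deriv_cvg a b : 0 < Re a -> Re b < 0 -> 0 < Re (a + b + 1) ->
  ccvg (fun n => cpow (h_ n) (a + b + 1) * - J (a + 1) b (h_ n)) (- J (a + b + 1) 0 1).
Proof.
move=> a0 b0 c0; have a1 : 0 < Re (a + 1) by rewrite cReD /= addr_gt0.
pose f n v := cexp ((a + 1) * v%:C) * cpow (h_ n + expR v) b * (expR (- expR v))%:C.
have fE n : cpow (h_ n) (a + b + 1) * J (a + 1) b (h_ n) = cint (f n).
  rewrite /J -cintZ; last exact: cintble_kJ.
  have [<- _] := cint_shift (- ln (h_ n)) (ccontZ (cpow (h_ n) (a + b + 1)) (ccont_kJ (a + 1) b (h_ n))).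
  apply: eq_cint => v; rewrite /kJ /f expRD expRN lnK ?posrE//.
  rewrite (_ : a + b + 1 = (a + 1) + b); last by ring.
  have -> : cexp ((a + 1) * (v - ln (h_ n))%:C) = cexp ((a + 1) * v%:C) / cpow (h_ n) (a + 1).
    by rewrite rcB mulrBr cexpD cexpN /cpow.
  have -> : h_ n + expR v = h_ n * (1 + expR v / h_ n).
    by field; rewrite gt_eqF.
  have p0 : 0 < 1 + expR v / h_ n by rewrite addr_gt0// divr_gt0// expR_gt0.
  rewrite cpowM// cpowD (_ : - h_ n * (expR v / h_ n) = - expR v); last first.
    by field; rewrite gt_eqF.
  by have := cpow_neq0 (h_ n) (a + 1) => ?; field.
apply: (@ccvg_ext _ (fun n => - cint (f n))); first by move=> n; rewrite mulrN fE.
apply: ccvgN.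
have [||||_ h] := @cDCT R f (kJ (a + b + 1) 0 1) (kG (Re (a + b + 1))).
- move=> n; apply/cmeas_ccont/ccont_cder => v.
  eexists; apply: cderM (cderM _ (cder_cpow b _ (rderD (rder_cst (h_ n) v) (is_derive_expR v)))) _.
  + exact: cder_cexp (cderZ _ (cder_id v)).
  + by rewrite addr_gt0// expR_gt0.
  + exact: cder_real (rder_comp (is_derive_expR _) (rderN (is_derive_expR _))).
- exact: rintegrable_kG.
- move=> n v; rewrite /f !normcM normc_cexp normc_cpow ?addr_gt0 ?expR_gt0// normc_real.
  rewrite ger0_norm ?expR_ge0// cReMr /kG ler_wpM2r ?expR_ge0//.
  rewrite (_ : a + b + 1 = (a + 1) + b); last by ring.
  rewrite (cReD (a + 1)) (mulrDl (Re (a + 1))) expRD ler_wpM2l ?expR_ge0//.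
  rewrite /powR gt_eqF ?addr_gt0 ?expR_gt0// ler_expR ler_wnM2l ?(ltW b0)//.
  by rewrite -{1}(expRK v) ler_ln ?posrE ?addr_gt0 ?expR_gt0// lerDr ltW.
- move=> v.
  have hk : kJ (a + b + 1) 0 1 v =
      cexp ((a + 1) * v%:C) * cpow (expR v) b * (expR (- expR v))%:C.
    rewrite /kJ cpow0 mulr1 mulN1r cpow_expR -cexpD.
    by rewrite -(mulrDl (a + 1) b) -[in RHS]addrA [1 + b]addrC addrA.
  rewrite hk; apply: ccvgM; last exact: ccvg_cst.
  apply: ccvgM; first exact: ccvg_cst.
  have hd := @cder_cpow R (fun t => t) (expR v) 1 b (expR_gt0 v) (rder_id _).
  apply: (@ccvg_cont _ (fun t => cpow t b) (fun n => h_ n + expR v) _ _ hd).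
  rewrite -[X in _ --> X]add0r; apply: cvgD; [exact: h_cvg|exact: cvg_cst].
exact: h.
Qed.

Lemma J_zero_cvg a b : 0 < Re a -> 0 < Re (1 - a - b) ->
  ccvg (fun n => J a (b - 1) (h_ n)) (Beta a (1 - a - b)).
Proof.
move=> a0 c0.
have kBE u : kB a (1 - a - b) u = cexp (a * u%:C) * cpow (1 + expR u) (b - 1).
  by rewrite /kB; congr (_ * cpow _ _); ring.
have [||||_ h] := @cDCT R (fun n => kJ a (b - 1) (h_ n)) (kB a (1 - a - b))
   (fun u => normc (kB a (1 - a - b) u)).
- by move=> n; exact: cmeas_kJ.
- exact/cintble_normc/cintble_kB.
- move=> n u; rewrite kBE /kJ normcM ler_piMr ?normc_ge0//.
  rewrite normc_real ger0_norm ?expR_ge0// expR_le1 mulNr oppr_le0.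
  by rewrite mulr_ge0 ?expR_ge0// ltW.
- move=> u; rewrite kBE /kJ -[X in ccvg _ X]mulr1; apply: ccvgM; first exact: ccvg_cst.
  rewrite -[1]/(1%:C); apply: ccvg_real; rewrite -expR0.
  apply: continuous_cvg; first exact: continuous_expR.
  rewrite -[X in _ --> X](mul0r (expR u)); apply: cvgM; last exact: cvg_cst.
  by rewrite -oppr0; apply: cvgN; exact: h_cvg.
exact: h.
Qed.

(** The Laplace integral, [M] and the second solution [N] all solve Kummer's equation, and three
    constant Wronskians, computed as [x -> 0], determine the coefficients of the first in terms of
    the other two. *)
Lemma tricomi_J a c x : 0 < x -> 0 < Re a -> 0 < Re c -> Re c < 2 -> c != 1 ->
  Re (c - a - 1) < 0 -> tricomi_nonint a c x = J a (c - a - 1) x / Gamma a.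
Proof.
move=> x0 a0 c0 c2 c1 b0; pose b := c - a - 1.
have cE : c = a + b + 1 by rewrite /b; ring.
have c'0 : 0 < Re (2 - c) by rewrite cReB /= subr_gt0.
have c1' : c - 1 != 0 by rewrite subr_eq0.
have c1'' : 1 - c != 0 by rewrite subr_eq0 eq_sym.
pose F := J a b; pose F1 x := - J (a + 1) b x.
have sF : kummer_sol a c F F1 (J (a + 1 + 1) b) by rewrite cE; exact: kummer_sol_J.
have sM := kummer_sol_kM a c0.
have [N2 sN] := kummer_sol_kN a c2.
pose M := kM a c; pose M1 := dkM a c; pose N := kN a c; pose N1 := dkN a c.
pose K := kM (a - c + 1) (2 - c); pose K1 := dkM (a - c + 1) (2 - c).
have lim_p : ccvg (fun n => cpow (h_ n) c * F1 (h_ n)) (- Gamma c).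
  by rewrite GammaE// cE; apply: J_deriv_cvg => //; rewrite -cE.
(* This combination is what multiplies [K] in the Wronskian of [F] and [N]. By [J_byparts] it equals
   [b J(a, b - 1, x)], which stays bounded even when [F] itself blows up at 0. *)
have lim_q : ccvg (fun n => (c - 1) * F (h_ n) + (h_ n)%:C * F1 (h_ n)) (b * Beta a (2 - c)).
  rewrite (_ : 2 - c = 1 - a - b); last by rewrite /b; ring.
  apply: (@ccvg_ext _ (fun n => b * J a (b - 1) (h_ n))).
    move=> n; have := J_byparts (b - 1) a0 (h_gt0 n); rewrite subrK /F /F1 => e.
    have e2 := J_succ (b - 1) a0 (h_gt0 n); rewrite subrK in e2.
    rewrite (_ : c - 1 = a + b); last by rewrite /b; ring.
    rewrite -[RHS]subr0 -e e2; ring.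
  apply: ccvgM; first exact: ccvg_cst.
  by apply: J_zero_cvg => //; rewrite (_ : 1 - a - b = 2 - c)// /b; ring.
have lim_h : ccvg (fun n => (h_ n)%:C) 0 by exact: (ccvg_real h_cvg).
have lim_hc := cpow_h0 c0.
(* The remainders with [F] alone are obtained by solving [lim_p] and [lim_q] for [F], which uses
   [c != 1]. *)
have lim_hcF : ccvg (fun n => cpow (h_ n) c * F (h_ n)) 0.
  have := ccvgM (ccvg_cst (c - 1)^-1) (ccvgB (ccvgM lim_hc lim_q) (ccvgM lim_h lim_p)).
  rewrite !mul0r subr0 mulr0; apply: ccvg_ext => n.
  by field.
have lim_hF : ccvg (fun n => (h_ n)%:C * F (h_ n)) 0.
  have := ccvgM (ccvg_cst (c - 1)^-1) (ccvgB (ccvgM lim_h lim_q) (ccvgM (cpow_h0 c'0) lim_p)).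
  rewrite !mul0r subr0 mulr0; apply: ccvg_ext => n.
  have -> : cpow (h_ n) (2 - c) = (h_ n)%:C ^+ 2 / cpow (h_ n) c.
    by rewrite cpowB -(cpow1 (h_gt0 n)) expr2 -cpowD.
  by have hc := cpow_neq0 (h_ n) c; field; rewrite hc c1'.
have lim_M : ccvg (fun n => M (h_ n)) 1.
  by rewrite -(kM0 a c0); apply: ccvg_cont (cder_kM a 0 c0) h_cvg.
have lim_M1 : ccvg (fun n => M1 (h_ n)) (M1 0) by apply: ccvg_cont (cder_dkM a 0 c0) h_cvg.
have lim_K : ccvg (fun n => K (h_ n)) 1.
  by rewrite -(kM0 (a - c + 1) c'0); apply: ccvg_cont (cder_kM _ 0 c'0) h_cvg.
have lim_K1 : ccvg (fun n => K1 (h_ n)) (K1 0) by apply: ccvg_cont (cder_dkM _ 0 c'0) h_cvg.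
have lim_e : ccvg (fun n => (expR (- h_ n))%:C) 1.
  rewrite -[1]/(1%:C); apply: ccvg_real; rewrite -expR0.
  apply: continuous_cvg; first exact: continuous_expR.
  by rewrite -oppr0; apply: cvgN; exact: h_cvg.
have NE n : cpow (h_ n) c * N (h_ n) = (h_ n)%:C * K (h_ n).
  by rewrite /N /kN mulrA -cpowD addrC subrK cpow1.
have N1E n : cpow (h_ n) c * N1 (h_ n) = (1 - c) * K (h_ n) + (h_ n)%:C * K1 (h_ n).
  rewrite /N1 /dkN mulrA -cpowD addrC subrK cpow1// -/(K _) -/(K1 _).
  by have := rc_neq0 (h_gt0 n) => ?; field.
have lim_cst (w : R -> R[i]) l : (forall s t, 0 < s -> 0 < t -> w s = w t) ->
    ccvg (fun n => w (h_ n)) l -> w x = l.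
  move=> hw; apply: ccvg_uniq; apply: ccvg_ext (ccvg_cst (w x)) => n.
  exact: hw.
have wFM : wronskian c F F1 M M1 x = - Gamma c.
  apply: lim_cst => [s t s0 t0|]; first exact: (wronskian_cst sF sM).
  have := ccvgM lim_e (ccvgB (ccvgM lim_p lim_M) (ccvgM lim_hcF lim_M1)).
  rewrite mul0r subr0 mulr1 mul1r; apply: ccvg_ext => n.
  by rewrite /wronskian; ring.
have wFN : wronskian c F F1 N N1 x = b * Beta a (2 - c).
  apply: lim_cst => [s t s0 t0|]; first exact: (wronskian_cst sF sN).
  have := ccvgM lim_e (ccvgB (ccvgM lim_q lim_K) (ccvgM lim_hF lim_K1)).
  rewrite mul0r subr0 mulr1 mul1r; apply: ccvg_ext => n.
  rewrite /wronskian.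
  transitivity ((expR (- h_ n))%:C * (F1 (h_ n) * (cpow (h_ n) c * N (h_ n))
     - F (h_ n) * (cpow (h_ n) c * N1 (h_ n)))); last by ring.
  rewrite NE N1E; ring.
have wMN : wronskian c M M1 N N1 x = c - 1.
  apply: lim_cst => [s t s0 t0|]; first exact: (wronskian_cst sM sN).
  have := ccvgM lim_e (ccvgB (ccvgM lim_M1 (ccvgM lim_h lim_K))
     (ccvgM lim_M (ccvgD (ccvgM (ccvg_cst (1 - c)) lim_K) (ccvgM lim_h lim_K1)))).
  rewrite !mul0r mulr0 !mul1r mulr1 addr0 sub0r opprB; apply: ccvg_ext => n.
  rewrite /wronskian.
  transitivity ((expR (- h_ n))%:C * (M1 (h_ n) * (cpow (h_ n) c * N (h_ n))
     - M (h_ n) * (cpow (h_ n) c * N1 (h_ n)))); last by ring.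
  rewrite NE N1E; ring.
(* For any three functions, [F W(M, N) = W(F, N) M - W(F, M) N]. *)
have key : F x * (c - 1) = b * Beta a (2 - c) * M x + Gamma c * N x.
  rewrite -wMN -wFN -[Gamma c]opprK -wFM /wronskian; ring.
have nb0 : 0 < Re (- b) by rewrite cReN oppr_gt0.
have nb1 : 0 < Re (- b + 1) by rewrite cReD /= addr_gt0.
have B : Beta a (2 - c) = Gamma a * Gamma (2 - c) / Gamma (- b + 1).
  rewrite !GammaE// euler_mul// (_ : a + (2 - c) = - b + 1); last by rewrite /b; ring.
  by rewrite mulfK// euler_neq0.
have bn0 : - b != 0 by apply/eqP => e; move: nb0; rewrite e ltxx.
have G1 : Gamma (2 - c) = (1 - c) * Gamma (1 - c).
  by rewrite -GammaS// (_ : 1 - c + 1 = 2 - c)//; ring.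
have G2 : Gamma c = (c - 1) * Gamma (c - 1) by rewrite -GammaS// subrK.
have G3 : Gamma (- b + 1) = - b * Gamma (- b) by exact: GammaS.
have Ga := Gamma_neq0 a0; have Gb := Gamma_neq0 nb0.
rewrite /tricomi_nonint !hyp1F1E// (_ : a - c + 1 = - b); last by rewrite /b; ring.
have Nx : N x = cpow x (1 - c) * kM (- b) (2 - c) x.
  by rewrite /N /kN (_ : a - c + 1 = - b)// /b; ring.
apply: (mulIf c1'); rewrite [RHS]mulrAC -/b -/(F x) key B G1 G2 G3 Nx -/(M x).
rewrite oppr_eq0 in bn0.
by field; rewrite Ga Gb bn0.
Qed.

End connection.

(** * Contiguity relations of Tricomi's function in its first parameter *)

Section tricomi_recurrences.
Context {R : realType}.
Implicit Types (a c : R[i]) (x : R).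

Lemma tricomi_kMN a c x : 0 < Re c -> Re c < 2 ->
  tricomi_nonint a c x = Gamma (1 - c) / Gamma (a - c + 1) * kM a c x
    + Gamma (c - 1) / Gamma a * kN a c x.
Proof.
move=> c0 c2; have c'0 : 0 < Re (2 - c) by rewrite cReB /= subr_gt0.
rewrite /tricomi_nonint !hyp1F1E// /kN; ring.
Qed.

Definition dtricomi a c x : R[i] := Gamma (1 - c) / Gamma (a - c + 1) * dkM a c x
    + Gamma (c - 1) / Gamma a * dkN a c x.

Lemma cder_tricomi a c x : 0 < Re c -> Re c < 2 -> 0 < x ->
  cder (tricomi_nonint a c) x (dtricomi a c x).
Proof.
move=> c0 c2 x0; apply: (@cder_ext _ (fun x => Gamma (1 - c) / Gamma (a - c + 1) * kM a c x
    + Gamma (c - 1) / Gamma a * kN a c x)); first by move=> t; rewrite tricomi_kMN.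
by apply: cderD; apply: cderZ; [exact: cder_kM|exact: cder_kN].
Qed.

(** The factors [a - c] and [a - 1] in the relations for the two Kummer solutions are exactly those
    produced by their normalisations through [1 / Gamma], so that both solutions obey the same
    relation. *)
Lemma tricomi_lower a c x : 0 < Re c -> Re c < 2 -> 0 < x ->
  tricomi_nonint (a - 1) c x =
    (a - c + x%:C) * tricomi_nonint a c x - x%:C * dtricomi a c x.
Proof.
move=> c0 c2 x0; have c'0 : 0 < Re (2 - c) by rewrite cReB /= subr_gt0.
have xC := rc_neq0 x0.
have e1 := kM_lower a x c0; have e2 := kM_lower (a - c + 1) x c'0.
rewrite !tricomi_kMN// /dtricomi /kN /dkN.
have g1 : (Gamma (a - 1 - c + 1))^-1 = (a - c) / Gamma (a - c + 1).
  have -> : a - 1 - c + 1 = a - c by ring.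
  by rewrite invGammaS.
have g2 : (Gamma (a - 1))^-1 = (a - 1) / Gamma a by rewrite invGammaS subrK.
rewrite g1 g2 (_ : a - 1 - c + 1 = a - c + 1 - 1); last by ring.
have e3 : (a - 1) * kM (a - c + 1 - 1) (2 - c) x =
   (a - 1 + x%:C) * kM (a - c + 1) (2 - c) x - x%:C * dkM (a - c + 1) (2 - c) x.
  by move: e2; rewrite (_ : a - c + 1 - (2 - c) = a - 1)//; ring.
transitivity (Gamma (1 - c) / Gamma (a - c + 1) * ((a - c) * kM (a - 1) c x) +
  Gamma (c - 1) / Gamma a * (cpow x (1 - c) * ((a - 1) * kM (a - c + 1 - 1) (2 - c) x))).
  by ring.
rewrite e1 e3.
(* The reciprocals become plain variables, since [field] would otherwise ask for [Gamma] to be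
   nonzero, which fails at the poles. *)
move: (Gamma a)^-1 (Gamma (a - c + 1))^-1 => i1 i2.
by field.
Qed.

Lemma tricomi_raise a c x : 0 < Re c -> Re c < 2 -> 0 < x ->
  x%:C * dtricomi a c x =
    a * (a - c + 1) * tricomi_nonint (a + 1) c x - a * tricomi_nonint a c x.
Proof.
move=> c0 c2 x0; have c'0 : 0 < Re (2 - c) by rewrite cReB /= subr_gt0.
have xC := rc_neq0 x0.
have e1 := kM_raise a x c0; have e2 := kM_raise (a - c + 1) x c'0.
rewrite !tricomi_kMN// /dtricomi /kN /dkN.
have g1 : (Gamma (a - c + 1))^-1 = (a - c + 1) / Gamma (a + 1 - c + 1).
  have -> : a + 1 - c + 1 = a - c + 1 + 1 by ring.
  by rewrite invGammaS.
have g2 : (Gamma a)^-1 = a / Gamma (a + 1) by rewrite invGammaS.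
rewrite g1 g2 (_ : kM (a + 1 - c + 1) = kM (a - c + 1 + 1)); last by congr kM; ring.
move: (Gamma (a + 1))^-1 (Gamma (a + 1 - c + 1))^-1 => i1 i2.
transitivity (Gamma (1 - c) * (a - c + 1) * i2 * (a * kM (a + 1) c x - a * kM a c x) +
  Gamma (c - 1) * a * i1 * cpow x (1 - c) * ((1 - c) * kM (a - c + 1) (2 - c) x +
   ((a - c + 1) * kM (a - c + 1 + 1) (2 - c) x - (a - c + 1) * kM (a - c + 1) (2 - c) x))).
  by rewrite e1 e2; field.
by ring.
Qed.

(** Eliminating the derivative between the lowering and the raising relation. *)
Lemma tricomi_3term a c x : 0 < Re c -> Re c < 2 -> 0 < x ->
  tricomi_nonint (a - 1) c x = (2 * a - c + x%:C) * tricomi_nonint a c x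
    - a * (a - c + 1) * tricomi_nonint (a + 1) c x.
Proof. by move=> c0 c2 x0; rewrite tricomi_lower// tricomi_raise//; ring. Qed.

End tricomi_recurrences.

(** * The Fourier representation for negative [m] *)

Section glasser.
Context {R : realType}.
Local Notation mu := (@lebesgue_measure R).

Section ab.
Variables A B : R.
Hypotheses (A0 : 0 < A) (B0 : 0 < B).
Let sA := Num.sqrt A.
Let sB := Num.sqrt B.
Let sA0 : 0 < sA. Proof. by rewrite sqrtr_gt0. Qed.
Let sB0 : 0 < sB. Proof. by rewrite sqrtr_gt0. Qed.

(* [- A e^{-u} - B e^u = - y^2 - 2 sqrt(A B)] and
   [sqrt A e^{-u/2} = y' - y / 2], where [y] contributes an odd integrand. *)
Let y u : R := sB * expR (u / 2) - sA * expR (- (u / 2)).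
Let dy u : R := (sB * expR (u / 2) + sA * expR (- (u / 2))) / 2.

Let rder_half u : rder (fun t : R => t / 2) u 2^-1.
Proof.
by apply: rder_eq (rderM (rder_id u) (rder_cst _ u)) _; rewrite mul1r mulr0 addr0.
Qed.

Let y_der u : rder y u (dy u).
Proof.
have h1 := rder_comp (is_derive_expR _) (rder_half u).
have h2 := rder_comp (is_derive_expR _) (rderN (rder_half u)).
apply: rder_eq (rderB (rderM (rder_cst sB u) h1) (rderM (rder_cst sA u) h2)) _.
by rewrite /dy; field.
Qed.

Let dy_cont : continuous dy.
Proof.
move=> u.
have h1 := rder_comp (is_derive_expR _) (rder_half u).
have h2 := rder_comp (is_derive_expR _) (rderN (rder_half u)).
exact: rder_cont (rderM (rderD (rderM (rder_cst sB u) h1) (rderM (rder_cst sA u) h2)) (rder_cst _ u)).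
Qed.

Let dy_gt0 u : 0 < dy u.
Proof. by rewrite divr_gt0// addr_gt0// mulr_gt0// expR_gt0. Qed.

Let y_range : range y = setT.
Proof.
apply/seteqP; split => // t _.
(* With [v = e^{u/2}], the equation [y u = t] reads [sB v^2 - t v - sA = 0]; [D^2] is its
   discriminant and the root with [+ D] is positive. *)
pose D := Num.sqrt (t ^+ 2 + 4 * sA * sB).
have p0 : 0 < 4 * sA * sB by rewrite !mulr_gt0.
have D2 : D ^+ 2 = t ^+ 2 + 4 * sA * sB.
  by rewrite sqr_sqrtr// addr_ge0 ?sqr_ge0// ltW.
have tD : `|t| < D.
  rewrite -ltr_sqr ?nnegrE ?sqrtr_ge0// D2 real_normK ?num_real//.
  by rewrite ltrDl.
have tD0 : 0 < t + D by move: tD; rewrite ltr_norml => /andP[]; lra.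
pose v := (t + D) / (2 * sB).
have v0 : 0 < v by rewrite divr_gt0// mulr_gt0.
exists (2 * ln v) => //; rewrite /y.
rewrite (_ : 2 * ln v / 2 = ln v); last by field.
rewrite expRN lnK ?posrE//.
have nz : t + D != 0 by rewrite gt_eqF.
have nz2 : sB != 0 by rewrite gt_eqF.
apply/eqP; rewrite -subr_eq0; apply/eqP.
transitivity ((D ^+ 2 - t ^+ 2 - 4 * sA * sB) / (2 * (t + D))).
  by rewrite /v; field; rewrite nz nz2.
by rewrite D2 (_ : _ - _ - _ = 0) ?mul0r//; ring.
Qed.

Let g u : R := expR (- (y u) ^+ 2).

Let gauss_y : rintegrable (fun u => g u * dy u) /\ \int[mu]_u (g u * dy u) = Num.sqrt pi.
Proof.
have mg : measurable_fun setT (@gauss_fun R) by exact: measurable_gauss_fun.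
have cg t : setT t -> {for t, continuous (@gauss_fun R)} by move=> _; exact: continuous_gauss_fun.
have e := integral_subst y_der dy_cont dy_gt0 y_range measurableT mg cg.
have [h _] := integrable_subst y_der dy_cont dy_gt0 y_range measurableT mg cg.
split; first exact: (h integrableT_gauss).
have := congr1 fine e; rewrite integralT_gauss /= => ->.
by [].
Qed.

Let g_ge0 u : 0 <= g u. Proof. exact: expR_ge0. Qed.

Let g_cont : continuous g.
Proof.
move=> u; apply: (@continuous_comp _ _ _ (fun u => - (y u) ^+ 2) expR).
  apply: cvgN; rewrite expr2; apply: cvgM; exact: rder_cont (y_der u).
exact: continuous_expR.
Qed.

Let gy_int : rintegrable (fun u => g u * y u).
Proof.
have y_cont : continuous y by move=> t; exact: rder_cont (y_der t).
(* [y] is the difference and [2 dy] the sum of the same two positive terms, hence the absolute value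
   of [y] is at most [2 dy]. *)
apply: (rintegrable_le _ (rintegrableZ 2 gauss_y.1)) => [|u].
  by apply: continuous_measurable_fun => u; apply: cvgM; [exact: g_cont|exact: y_cont].
rewrite normrM ger0_norm// mulrCA ler_wpM2l//.
have h1 : 0 <= sB * expR (u / 2) by rewrite mulr_ge0 ?expR_ge0// ltW.
have h2 : 0 <= sA * expR (- (u / 2)) by rewrite mulr_ge0 ?expR_ge0// ltW.
rewrite /y /dy ler_norml; apply/andP; split; lra.
Qed.

Let gy0 : \int[mu]_u (g u * y u) = 0.
Proof.
have y_cont : continuous y by move=> t; exact: rder_cont (y_der t).
have gy_cont : continuous (fun u => g u * y u).
  by move=> u; apply: cvgM; [exact: g_cont|exact: y_cont].
(* This translation balances the two exponentials, so that [y (u + s)] becomes an odd function of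
   [u]. *)
pose s := ln (sA / sB); pose h := expR (s / 2).
have h0 : 0 < h by exact: expR_gt0.
have e1 : sB * h = sA / h.
  have hh : h * h = sA / sB by rewrite -expRD -splitr lnK// posrE divr_gt0.
  apply: (mulIf (lt0r_neq0 h0)); rewrite divfK ?lt0r_neq0// -mulrA hh mulrC divfK//.
  exact: lt0r_neq0.
have yE u : y (u + s) = sB * h * (expR (u / 2) - expR (- (u / 2))).
  rewrite /y mulrDl opprD !expRD (expRN (s / 2)) -/h mulrBr {2}e1; ring.
have [e hi] := rint_shift s gy_cont.
rewrite -e; apply: rint_odd.
- by move=> u; apply: (@continuous_comp _ _ _ (fun t => t + s) (fun u => g u * y u));
    [apply: cvgD; [exact: cvg_id|exact: cvg_cst]|exact: gy_cont].
- exact: hi gy_int.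
- move=> u; rewrite /g !yE.
  have -> : expR (- u / 2) - expR (- (- u / 2)) = - (expR (u / 2) - expR (- (u / 2))).
    by rewrite mulNr opprK opprB.
  by rewrite !mulrN sqrrN.
Qed.

Let gl u : expR (- A * expR (- u) - B * expR u - u / 2) =
  expR (- (2 * (sA * sB))) / sA * (g u * dy u - 2^-1 * (g u * y u)).
Proof.
have -> : g u * dy u - 2^-1 * (g u * y u) = g u * (sA * expR (- (u / 2))).
  by rewrite /dy /y; field.
have p1 : expR (u / 2) ^+ 2 = expR u by rewrite expr2 -expRD -splitr.
have p2 : expR (- (u / 2)) ^+ 2 = expR (- u) by rewrite expr2 -expRD -opprD -splitr.
have p3 : expR (u / 2) * expR (- (u / 2)) = 1 by rewrite -expRD subrr expR0.
have a2 : sA ^+ 2 = A by rewrite sqr_sqrtr// ltW.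
have b2 : sB ^+ 2 = B by rewrite sqr_sqrtr// ltW.
have -> : - A * expR (- u) - B * expR u - u / 2 =
    - (2 * (sA * sB)) + - (y u) ^+ 2 + - (u / 2).
  rewrite -a2 -b2 -p1 -p2 /y.
  have -> : 2 * (sA * sB) = 2 * (sA * sB) * (expR (u / 2) * expR (- (u / 2))).
    by rewrite p3 mulr1.
  ring.
rewrite !expRD /g; field; exact: lt0r_neq0.
Qed.

(** An integral for the Bessel function of order 1/2, hence elementary. By [gl] the integrand splits
    into a Gaussian in [y], whose integral is [sqrt pi], and an odd part that vanishes. *)
Lemma glasser_int :
  rintegrable (fun u => expR (- A * expR (- u) - B * expR u - u / 2)) /\
  \int[mu]_u expR (- A * expR (- u) - B * expR u - u / 2) =
    Num.sqrt (pi / A) * expR (- (2 * Num.sqrt (A * B))).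
Proof.
have i1 := rintegrableZ 2^-1 gy_int.
have i2 : rintegrable (fun u => g u * dy u - 2^-1 * (g u * y u)).
  apply: rintegrable_ext (rintegrableD gauss_y.1 (rintegrableZ (-1) i1)) => u.
  by rewrite mulN1r.
have E : (fun u => expR (- A * expR (- u) - B * expR u - u / 2)) =
  (fun u => expR (- (2 * (sA * sB))) / sA * (g u * dy u - 2^-1 * (g u * y u))).
  by apply/funext => u; exact: gl.
rewrite E; split; first exact: rintegrableZ.
rewrite (RintegralZl _ measurableT i2) (RintegralB measurableT gauss_y.1 i1).
rewrite (RintegralZl _ measurableT gy_int) gy0 gauss_y.2 mulr0 subr0.
rewrite sqrtrM ?pi_ge0// sqrtrV ?ltW// sqrtrM ?ltW// -/sA -/sB; ring.
Qed.

End ab.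
End glasser.

(** * The Macdonald function of imaginary order *)

Section bessel.
Context {R : realType}.
Local Notation mu := (@lebesgue_measure R).
Implicit Types (x u v xi eta tau : R).

Definition ch2 xi : R := (2 + expR xi + expR (- xi)) / 4.

Lemma ch2_ge xi : 1 + xi ^+ 2 / 16 <= ch2 xi.
Proof. have := sqr_le_expR xi; rewrite /ch2; lra. Qed.

Lemma ch2_ge1 xi : 1 <= ch2 xi.
Proof. by apply: le_trans (ch2_ge xi); rewrite lerDl divr_ge0// sqr_ge0. Qed.

Lemma ch2_gt0 xi : 0 < ch2 xi.
Proof. exact: lt_le_trans (ch2_ge1 xi). Qed.

Lemma ch2_cosh xi : (cosh (xi / 2)) ^+ 2 = ch2 xi.
Proof.
rewrite /cosh /ch2.
have p1 : expR (xi / 2) ^+ 2 = expR xi by rewrite expr2 -expRD -splitr.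
have p2 : expR (- (xi / 2)) ^+ 2 = expR (- xi) by rewrite expr2 -expRD -opprD -splitr.
have p3 : expR (xi / 2) * expR (- (xi / 2)) = 1 by rewrite -expRD subrr expR0.
rewrite -p1 -p2.
transitivity ((2 * (expR (xi / 2) * expR (- (xi / 2))) + expR (xi / 2) ^+ 2 +
   expR (- (xi / 2)) ^+ 2) / 4); first by field.
by rewrite p3 mulr1.
Qed.

Lemma ch2_der xi : rder ch2 xi ((expR xi - expR (- xi)) / 4).
Proof.
have h1 := rderD (rderD (rder_cst 2 xi) (is_derive_expR xi))
  (rder_comp (is_derive_expR _) (rderN (rder_id xi))).
apply: rder_eq (rderM h1 (rder_cst 4^-1 xi)) _.
by rewrite mulrN1 mulr0 addr0 add0r.
Qed.

Lemma ch2_cont : continuous ch2.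
Proof. by move=> xi; exact: rder_cont (ch2_der xi). Qed.

Lemma continuous_expR_ch2 x : continuous (fun xi => expR (- (x * ch2 xi))).
Proof.
move=> xi; apply: (@continuous_comp _ _ _ (fun xi => - (x * ch2 xi)) expR).
  by apply: cvgN; apply: cvgM; [exact: cvg_cst|exact: ch2_cont].
exact: continuous_expR.
Qed.

Lemma rintegrable_ch2 x : 0 < x -> rintegrable (fun xi => expR (- (x * ch2 xi))).
Proof.
move=> x0; pose m := Num.min 1 (x / 16).
have m0 : 0 < m by rewrite lt_min ltr01 divr_gt0.
apply: (rintegrable_le _ (rintegrableZ m^-1 rintegrable_oneDsqrV)) => [|xi].
  by apply: continuous_measurable_fun; exact: continuous_expR_ch2.
rewrite ger0_norm ?expR_ge0// expRN -invfM lef_pV2 ?posrE ?expR_gt0//; last first.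
  by rewrite mulr_gt0// ltr_pwDl// sqr_ge0.
apply: le_trans (expR_ge1Dx _).
have h1 : x * (1 + xi ^+ 2 / 16) <= x * ch2 xi by rewrite ler_wpM2l ?ch2_ge// ltW.
have h2 : m <= 1 by rewrite ge_min lexx.
have h3 : m * xi ^+ 2 <= x / 16 * xi ^+ 2.
  by rewrite ler_wpM2r ?sqr_ge0// ge_min lexx orbT.
lra.
Qed.

Definition kI0 x tau xi : R[i] := (expR (- (x * ch2 xi)))%:C * cexp (tau *i * xi%:C).
(** This is [2 e^{-x/2} K_{i tau}(x/2)]. *)
Definition I0 x tau : R[i] := cint (kI0 x tau).

Lemma normc_kI0 x tau xi : normc (kI0 x tau xi) = expR (- (x * ch2 xi)).
Proof.
rewrite /kI0 normcM normc_real normc_cexp cReMr /= mul0r expR0 mulr1.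
by rewrite ger0_norm ?expR_ge0.
Qed.

Lemma ccont_cexp_lin (z : R[i]) : ccont (fun u : R => cexp (z * u%:C)).
Proof. by apply: ccont_cder => u; eexists; exact: cder_cexp (cderZ z (cder_id u)). Qed.

Lemma ccont_kI0 x tau : ccont (kI0 x tau).
Proof.
apply: ccontM; last exact: ccont_cexp_lin.
exact/ccont_real/continuous_expR_ch2.
Qed.

Lemma cintble_kI0 x tau : 0 < x -> cintble (kI0 x tau).
Proof.
move=> x0; apply: (cintble_le _ (rintegrable_ch2 x0)) => [|xi].
  exact/cmeas_ccont/ccont_kI0.
by rewrite normc_kI0.
Qed.

(** With [t = e^u], [e^{phi} = x t (1 + t)]; the choice makes [e^{phi} + x/4 = x (t + 1/2)^2] a
    perfect square, which removes the square roots left by the Gaussian integral. *)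
Let phi x u : R := ln x + u + ln (1 + expR u).
Let dphi u : R := 1 + expR u / (1 + expR u).

Let phi_der x u : rder (phi x) u (dphi u).
Proof.
have h := @rder_comp _ (@ln R) (fun t => 1 + expR t) u _ _ (is_derive1_ln (one_expR_gt0 u)) (rder_oneD_expR u).
apply: rder_eq (rderD (rderD (rder_cst (ln x) u) (rder_id u)) h) _.
by rewrite add0r mulrC.
Qed.

Let dphi_cont : continuous dphi.
Proof.
move=> u; apply: cvgD; first exact: cvg_cst.
apply: cvgM; first exact: continuous_expR.
apply: cvgV; first by rewrite gt_eqF.
by apply: cvgD; [exact: cvg_cst|exact: continuous_expR].
Qed.

Let dphi_gt0 u : 0 < dphi u.
Proof. by rewrite addr_gt0// divr_gt0// expR_gt0. Qed.

Let phi_range x : 0 < x -> range (phi x) = setT.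
Proof.
move=> x0; apply/seteqP; split => // eta _.
pose q := expR eta / x; have q0 : 0 < q by rewrite divr_gt0// expR_gt0.
(* the positive root of [t ^+ 2 + t = q] *)
pose D := Num.sqrt (1 + 4 * q).
have D2 : D ^+ 2 = 1 + 4 * q by rewrite sqr_sqrtr// addr_ge0// mulr_ge0// ltW.
have D1 : 1 < D.
  rewrite -(@ltr_sqr _ 1) ?nnegrE ?sqrtr_ge0// D2 expr1n ltrDl mulr_gt0//.
have [t tE] : exists t, t = (D - 1) / 2 by exists ((D - 1) / 2).
have t0 : 0 < t by rewrite tE divr_gt0// subr_gt0.
exists (ln t) => //; rewrite /phi lnK ?posrE// -lnM ?posrE// -lnM ?posrE ?mulr_gt0 ?addr_gt0//.
rewrite (_ : x * t * (1 + t) = expR eta) ?expRK//.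
rewrite (_ : x * t * (1 + t) = x * ((D ^+ 2 - 1) / 4)); last by rewrite tE; field.
by rewrite D2 /q; field; rewrite gt_eqF.
Qed.

(** The classical expression of [K_nu] by Psi. Writing Gamma as an integral, translated by [- xi],
    and exchanging the order makes the integral over [xi] one of those in [glasser_int]; the
    substitution [phi] then produces the Laplace integral. *)
Lemma bessel_laplace x tau : 0 < x ->
  Gamma (2^-1 + tau *i) * I0 x tau = (2 * Num.sqrt pi)%:C * cpow x (tau *i) * (expR (- x))%:C
    * J (2^-1 + tau *i) (2^-1 + tau *i - 1) x.
Proof.
move=> x0; pose a : R[i] := 2^-1 + tau *i; rewrite -/a.
have aE : a = (2^-1 : R)%:C + tau *i by rewrite /a rcV natC.
have a0 : 0 < Re a by rewrite aE cReD /= addr0 invr_gt0.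
rewrite GammaE//.
pose f xi eta := kJ a 0 1 (eta - xi) * kI0 x tau xi.
have -> : J a 0 1 * I0 x tau = cint (fun xi => cint (f xi)).
  rewrite -cintZ; last exact: cintble_kI0.
  apply: eq_cint => xi.
  have [e h] := cint_shift (- xi) (ccont_kJ a 0 1).
  have i1 := h.2 (cintble_kJ 0 a0 ltr01).
  by rewrite /f (cintZr _ i1) e.
rewrite (@cFubini _ f (fun xi eta => normc (kJ a 0 1 (eta - xi)) * expR (- (x * ch2 xi)))
   (fun xi => (\int[mu]_eta normc (kJ a 0 1 eta)) * expR (- (x * ch2 xi)))); last 5 first.
- apply: cmeasM; last by apply: cmeas_comp; [exact/cmeas_ccont/ccont_kI0|exact: measurable_fst].
  apply: cmeas_comp; first exact: cmeas_kJ.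
  by apply: measurable_funB; [exact: measurable_snd|exact: measurable_fst].
- move=> xi; apply: (rintegrable_ext _ (rintegrableZ (expR (- (x * ch2 xi))) _)) => [eta|].
    exact: mulrC.
  apply: (rint_shift (- xi) (continuous_normc (ccont_kJ a 0 1))).2.
  exact/cintble_normc/cintble_kJ.
- by move=> xi eta; rewrite /f normcM normc_kI0.
- move=> xi.
  have [e hi] := rint_shift (- xi) (continuous_normc (ccont_kJ a 0 1)).
  have := hi (cintble_normc (cintble_kJ _ a0 ltr01)) => {}hi.
  by rewrite (RintegralZr _ measurableT hi) e.
- exact/rintegrableZ/rintegrable_ch2.
have x4 : 0 < x / 4 by rewrite divr_gt0.
pose A eta := expR eta + x / 4.
have A0 eta : 0 < A eta by rewrite addr_gt0// expR_gt0.
pose H eta : R[i] := cexp (a * eta%:C) * (expR (- (x / 2)) *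
  (Num.sqrt (pi / A eta) * expR (- (2 * Num.sqrt (A eta * (x / 4))))))%:C.
have fE xi eta : f xi eta = cexp (a * eta%:C) * (expR (- (x / 2)) *
    expR (- A eta * expR (- xi) - x / 4 * expR xi - xi / 2))%:C.
  transitivity (cexp (a * (eta - xi)%:C + tau *i * xi%:C) *
      (expR (- expR (eta - xi)) * expR (- (x * ch2 xi)))%:C).
    by rewrite /f /kJ /kI0 cpow0 mulr1 mulN1r cexpD rcM; ring.
  (* The oscillation in [xi] cancels because the imaginary part of [a] is [tau]; the real part 1/2
     leaves exactly the factor [e^{-xi/2}] of [glasser_int]. *)
  have -> : a * (eta - xi)%:C + tau *i * xi%:C = a * eta%:C + (- (xi / 2))%:C.
    by rewrite aE rcB !rcN !rcM rcV; field.
  rewrite cexpD cexp_real -mulrA -rcM -!expRD; congr (_ * (expR _)%:C).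
  by rewrite /A /ch2 expRD; field.
have inner eta : cint (fun xi => f xi eta) = H eta.
  have [gi ge] := glasser_int (A0 eta) x4.
  rewrite /H -ge -(RintegralZl _ measurableT gi) -cintR -cintZ; last exact/cintbleR/rintegrableZ.
  by apply: eq_cint => xi; rewrite fE.
rewrite (eq_cint inner).
have cH : ccont H.
  apply: ccontM; first exact: ccont_cexp_lin.
  have cA : continuous A.
    by move=> eta; apply: cvgD; [exact: continuous_expR|exact: cvg_cst].
  apply: ccont_real => eta; apply: cvgM; first exact: cvg_cst.
  apply: cvgM.
    apply: (@continuous_comp _ _ _ (fun eta => pi / A eta) (@Num.sqrt R)); last exact: sqrt_continuous.
    by apply: cvgM; [exact: cvg_cst|apply: cvgV; [rewrite gt_eqF|exact: cA]].
  apply: (@continuous_comp _ _ _ (fun eta => - (2 * Num.sqrt (A eta * (x / 4)))) expR); last exact: continuous_expR.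
  apply: cvgN; apply: cvgM; first exact: cvg_cst.
  apply: (@continuous_comp _ _ _ (fun eta => A eta * (x / 4)) (@Num.sqrt R)); last exact: sqrt_continuous.
  by apply: cvgM; [exact: cA|exact: cvg_cst].
have [m1 m2] := cmeas_ccont cH.
have [-> _] := cint_subst (phi_der x) dphi_cont dphi_gt0 (phi_range x0) measurableT
   m1 m2 (fun y _ => cH.1 y) (fun y _ => cH.2 y).
rewrite /J -cintZ; last exact: cintble_kJ.
apply: eq_cint => u; set t := expR u.
have t0 : 0 < t by exact: expR_gt0.
have t10 : 0 < 1 + t by rewrite addr_gt0.
have th : 0 < t + 2^-1 by rewrite addr_gt0// invr_gt0.
have ephi : expR (phi x u) = x * t * (1 + t) by rewrite /phi !expRD !lnK.
have AE : A (phi x u) = x * (t + 2^-1) ^+ 2 by rewrite /A ephi; field.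
have s1 : Num.sqrt (A (phi x u) * (x / 4)) = x * (t + 2^-1) / 2.
  rewrite AE (_ : _ * _ = (x * (t + 2^-1) / 2) ^+ 2); last by field.
  by rewrite sqrtr_sqr ger0_norm// divr_ge0// mulr_ge0// ltW.
have sx0 : Num.sqrt x != 0 by rewrite gt_eqF// sqrtr_gt0.
have s2 : Num.sqrt (pi / A (phi x u)) = Num.sqrt pi / (Num.sqrt x * (t + 2^-1)).
  rewrite AE sqrtrM ?pi_ge0// sqrtrV; last by rewrite mulr_ge0 ?sqr_ge0// ltW.
  by rewrite sqrtrM ?ltW// sqrtr_sqr ger0_norm// ltW.
have ca : cexp (a * (phi x u)%:C) = cpow x a * cexp (a * u%:C) * cpow (1 + t) a.
  by rewrite /phi !rcD !mulrDr !cexpD.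
have cx : cpow x a = (Num.sqrt x)%:C * cpow x (tau *i).
  by rewrite aE cpowD cpow_real// powR12_sqrt// ltW.
have e2 : expR (- (x / 2)) * expR (- (2 * (x * (t + 2^-1) / 2))) = expR (- x) * expR (- x * t).
  by rewrite -!expRD; congr expR; field.
rewrite /H ca cx s1 s2 /kJ -/t cpowB cpow1//.
transitivity (cpow x (tau *i) * cexp (a * u%:C) * cpow (1 + t) a *
  (Num.sqrt x * (Num.sqrt pi / (Num.sqrt x * (t + 2^-1))) * dphi u)%:C *
  (expR (- (x / 2)) * expR (- (2 * (x * (t + 2^-1) / 2))))%:C).
  by rewrite !rcM; ring.
rewrite e2 (_ : Num.sqrt x * _ * dphi u = 2 * Num.sqrt pi / (1 + t)); last first.
  rewrite /dphi -/t; field; rewrite sx0 gt_eqF//=.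
  by rewrite gt_eqF//; lra.
rewrite !rcM rcV; ring.
Qed.

End bessel.

(** * Composition of two Laplace kernels into a Beta factor *)

Section laplace_convolution.
Context {R : realType}.
Local Notation mu := (@lebesgue_measure R).
Implicit Types (x u v : R) (a b p q : R[i]).

Lemma measurable_oneD_expR : measurable_fun setT (fun u : R => 1 + expR u).
Proof. by apply: measurable_funD => //; exact: measurable_expR. Qed.

(* With [s = e^v] and [t = e^u], the substitutions [s = w t / (1 + t)] and
   [t = r / (1 + w)] separate the variables; both are translations, of [v]
   for fixed [u] and of [u] for fixed [v]. *)
Lemma J_convolution p q b x : 0 < Re p -> 0 < Re q -> 0 < x -> b = q - 1 - p ->
  cintble (fun v => kJ p b x v * J q (q - 1) (x * (1 + expR v))) /\
  cint (fun v => kJ p b x v * J q (q - 1) (x * (1 + expR v))) = Beta p q * J (p + q) b x.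
Proof.
move=> p0 q0 x0 bE.
have pq0 : 0 < Re (p + q) by rewrite cReD addr_gt0.
pose L u : R := ln (1 + expR u).
have mL : measurable_fun setT L.
  by apply: measurableT_comp; [exact: measurable_ln|exact: measurable_oneD_expR].
have eL u : expR (L u) = 1 + expR u by rewrite lnK// posrE.
pose y v : R := x * (1 + expR v).
have y0 v : 0 < y v by rewrite mulr_gt0.
have xy v : x <= y v by rewrite ler_peMr// ltW.
pose f v u := kJ p b x v * kJ q (q - 1) (y v) u.
pose f' v u := kB p q v * kJ (p + q) b x (u + L v).
(* The relation [b = q - 1 - p] makes all powers of [1 + e^u] cancel, leaving a Beta kernel in [v]
   and a translated kernel in [u]. *)
have fE u v : f (v + (u - L u)) u = f' v u.
  pose t := expR u; pose w := expR v; pose r := t * (1 + w); pose s := w * t / (1 + t).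
  have t0 : 0 < 1 + t by exact: one_expR_gt0.
  have w0 : 0 < 1 + w by exact: one_expR_gt0.
  have r0 : 0 < 1 + r by rewrite addr_gt0// mulr_gt0// expR_gt0.
  have es : expR (v + (u - L u)) = s by rewrite !expRD expRN eL mulrA.
  have er : expR (u + L v) = r by rewrite expRD eL.
  have s1 : 1 + s = (1 + r) / (1 + t) by rewrite /s /r; field; rewrite gt_eqF.
  have e1 : cexp (p * (v + (u - L u))%:C) =
      cexp (p * v%:C) * cexp (p * u%:C) / cpow (1 + t) p.
    by rewrite !rcD rcN !mulrDr mulrN !cexpD cexpN; ring.
  have e2 : cexp ((p + q) * (u + L v)%:C) =
      cexp (p * u%:C) * cexp (q * u%:C) * cpow (1 + w) (p + q).
    by rewrite rcD mulrDr cexpD mulrDl cexpD.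
  rewrite /f /f' /kJ /kB /y es er e1 e2 s1 cpowM ?invr_gt0// cpowV//.
  rewrite -/w -/t (_ : q - 1 = b + p); last by rewrite bE; ring.
  rewrite (cpowD (1 + t) b p) !cpowN.
  have h1 := cpow_neq0 (1 + t) p; have h2 := cpow_neq0 (1 + t) b.
  have h3 := cpow_neq0 (1 + w) (p + q).
  have -> : (expR (- x * r))%:C = (expR (- x * s))%:C * (expR (- (x * ((1 + r) / (1 + t))) * t))%:C.
    rewrite -rcM -expRD; congr ((expR _)%:C).
    by rewrite /s /r; field; rewrite gt_eqF.
  by field; rewrite h1 h2 h3.
have -> : (fun v => kJ p b x v * J q (q - 1) (x * (1 + expR v))) = (fun v => cint (f v)).
  by apply/funext => v; rewrite /f cintZ//; exact: cintble_kJ.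
have [step1 step2] : cintble (fun v => cint (f v)) /\
    cint (fun v => cint (f v)) = cint (fun u => cint (fun v => f v u)).
  apply: (@cFubini_int _ f (fun v u => normc (kJ p b x v) * normc (kJ q (q - 1) x u))
    (fun v => (\int[mu]_u normc (kJ q (q - 1) x u)) * normc (kJ p b x v))).
  - apply: cmeasM; first by apply: cmeas_comp; [exact: cmeas_kJ|exact: measurable_fst].
    have m1 : measurable_fun setT (fun z : R * R => expR z.2).
      by apply: (measurableT_comp (@measurable_expR R)); exact: measurable_snd.
    have m2 : measurable_fun setT (fun z : R * R => expR z.1).
      by apply: (measurableT_comp (@measurable_expR R)); exact: measurable_fst.
    apply: cmeasM.
      apply: cmeasM.
        apply: cmeas_cexp; apply: cmeasM; first exact: cmeas_cst.
        by apply: cmeas_real; exact: measurable_snd.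
      by apply: cmeas_cpow; apply: measurable_funD.
    apply: cmeas_real; apply: (measurableT_comp (@measurable_expR R)).
    apply: measurable_funM => //; apply: (measurableT_comp (f := @GRing.opp R)) => //.
    by apply: measurable_funM => //; apply: measurable_funD.
  - by move=> v; apply/rintegrableZ/cintble_normc/cintble_kJ.
  - move=> v u; rewrite /f normcM ler_wpM2l ?normc_ge0// !normc_kJ.
    apply: ler_wpM2l; first by rewrite mulr_ge0 ?expR_ge0 ?powR_ge0.
    by rewrite ler_expR ler_wpM2r ?expR_ge0// lerN2.
  - move=> v; have i1 := cintble_normc (cintble_kJ (q - 1) q0 x0).
    by rewrite (RintegralZl _ measurableT i1) mulrC.
  - exact/rintegrableZ/cintble_normc/cintble_kJ.
have step3 : cint (fun u => cint (fun v => f v u)) = cint (fun u => cint (fun v => f' v u)).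
  apply: eq_cint => u.
  have cf : ccont (fun v => f v u).
    apply: ccontM; first exact: ccont_kJ.
    apply: ccont_cder => v; eexists.
    apply: (@cder_comp _ (fun z => kJ q (q - 1) z u) y v _ _ (kJ_derx _ _ _ _)).
    exact: rderM (rder_cst x v) (rder_oneD_expR v).
  by rewrite -(cint_shift (u - L u) cf).1; apply: eq_cint => v; rewrite fE.
have cK : ccont (kJ (p + q) b x) by exact: ccont_kJ.
have iK : cintble (kJ (p + q) b x) by exact: cintble_kJ.
have step4 : cint (fun v => cint (fun u => f' v u)) = cint (fun u => cint (fun v => f' v u)).
  apply: (@cFubini _ f' (fun v u => normc (kB p q v) * normc (kJ (p + q) b x (u + L v)))
    (fun v => (\int[mu]_u normc (kJ (p + q) b x u)) * normc (kB p q v))).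
  - apply: cmeasM.
      by apply: cmeas_comp; [exact/cmeas_ccont/ccont_kB|exact: measurable_fst].
    apply: cmeas_comp; first exact: cmeas_kJ.
    apply: measurable_funD; first exact: measurable_snd.
    by apply: (measurableT_comp mL); exact: measurable_fst.
  - move=> v; apply: rintegrableZ.
    exact: (rint_shift (L v) (continuous_normc cK)).2 (cintble_normc iK).
  - by move=> v u; rewrite /f' normcM.
  - move=> v; have [e h] := rint_shift (L v) (continuous_normc cK).
    by rewrite (RintegralZl _ measurableT (h (cintble_normc iK))) e mulrC.
  - exact/rintegrableZ/cintble_normc/cintble_kB.
split; first exact: step1.
rewrite step2 step3 -step4 /Beta -cintZr; last exact: cintble_kB.
apply: eq_cint => v; rewrite /f'.
have [e h] := cint_shift (L v) cK.
by rewrite (cintZ _ (h.2 iK)) e.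
Qed.

End laplace_convolution.

Section base_formula.
Context {R : realType}.
Local Notation mu := (@lebesgue_measure R).
Implicit Types (x u v xi tau m : R).

(** Expanding [J] as an integral over [v], the dependence on [xi] is only through
    [e^{-x (1 + e^v) cosh^2(xi/2)}]. The integral over [xi] is thus [I0] at [x (1 + e^v)], and
    [J_convolution] evaluates what remains. *)
Lemma fourier_base m x tau : m < 0 -> 0 < x ->
  Gamma (2^-1 - m%:C + tau *i) *
    cint (fun xi => (expR (- (x * ch2 xi)))%:C * J (- m%:C) (m%:C - 2^-1) (x * ch2 xi)
                      * cexp (tau *i * xi%:C)) =
  Gamma (- m%:C) * (2 * Num.sqrt pi)%:C * cpow x (tau *i) * (expR (- x))%:C *
    J (2^-1 - m%:C + tau *i) (m%:C - 2^-1 + tau *i) x.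
Proof.
move=> m0 x0; have [p pE] : exists p : R[i], p = - m%:C by exists (- m%:C).
have [q q_def] : exists q : R[i], q = 2^-1 + tau *i by exists (2^-1 + tau *i).
have [b0 b0E] : exists b0 : R[i], b0 = m%:C - 2^-1 by exists (m%:C - 2^-1).
have p0 : 0 < Re p by rewrite pE /= oppr_gt0.
have qE : q = (2^-1 : R)%:C + tau *i by rewrite q_def rcV natC.
have q0 : 0 < Re q by rewrite qE cReD /= addr0 invr_gt0.
have pqE : 2^-1 - m%:C + tau *i = p + q by rewrite pE q_def; ring.
have bE : m%:C - 2^-1 + tau *i = q - 1 - p by rewrite pE q_def; field.
have b0q : q - 1 - p = b0 + tau *i by rewrite -bE b0E.
rewrite pqE bE -pE -b0E.
have pq0 : 0 < Re (p + q) by rewrite cReD addr_gt0.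
pose k xi v := kJ p b0 (x * ch2 xi) v * kI0 x tau xi.
have kE xi v : k xi v = cexp (p * v%:C) * cpow (1 + expR v) b0 *
    kI0 (x * (1 + expR v)) tau xi.
  rewrite /k /kJ /kI0.
  have -> : (expR (- (x * (1 + expR v) * ch2 xi)))%:C =
     (expR (- (x * ch2 xi) * expR v))%:C * (expR (- (x * ch2 xi)))%:C.
    by rewrite -rcM -expRD; congr ((expR _)%:C); ring.
  ring.
have Gq := Gamma_neq0 q0.
have xc xi : 0 < x * ch2 xi by rewrite mulr_gt0// ch2_gt0.
have xcx xi : x <= x * ch2 xi by rewrite ler_peMr ?(ltW x0)// ch2_ge1.
have step1 : cint (fun xi => (expR (- (x * ch2 xi)))%:C * J p b0 (x * ch2 xi)
    * cexp (tau *i * xi%:C)) = cint (fun xi => cint (k xi)).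
  apply: eq_cint => xi; rewrite /k cintZr; last exact: cintble_kJ.
  by rewrite /kI0 -/(J _ _ _); ring.
have step2 : cint (fun xi => cint (k xi)) = cint (fun v => cint (fun xi => k xi v)).
  apply: (@cFubini _ k (fun xi v => normc (kJ p b0 x v) * expR (- (x * ch2 xi)))
    (fun xi => (\int[mu]_v normc (kJ p b0 x v)) * expR (- (x * ch2 xi)))).
  - apply: cmeasM; last by apply: cmeas_comp; [exact/cmeas_ccont/ccont_kI0|exact: measurable_fst].
    have m1 : measurable_fun setT (fun z : R * R => expR z.2).
      by apply: (measurableT_comp (@measurable_expR R)); exact: measurable_snd.
    apply: cmeasM.
      apply: cmeasM.
        apply: cmeas_cexp; apply: cmeasM; first exact: cmeas_cst.
        by apply: cmeas_real; exact: measurable_snd.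
      by apply: cmeas_cpow; apply: measurable_funD.
    apply: cmeas_real; apply: (measurableT_comp (@measurable_expR R)).
    apply: measurable_funM => //; apply: (measurableT_comp (f := @GRing.opp R)) => //.
    apply: measurable_funM => //.
    apply: (measurableT_comp (f := @ch2 R)); last exact: measurable_fst.
    by apply: continuous_measurable_fun; exact: ch2_cont.
  - move=> xi; apply: (rintegrable_ext _ (rintegrableZ (expR (- (x * ch2 xi))) _)) => [v|].
      exact: mulrC.
    exact/cintble_normc/cintble_kJ.
  - move=> xi v; rewrite /k normcM normc_kI0 ler_wpM2r ?expR_ge0// !normc_kJ.
    apply: ler_wpM2l; first by rewrite mulr_ge0 ?expR_ge0 ?powR_ge0.
    by rewrite ler_expR ler_wpM2r ?expR_ge0// lerN2.
  - move=> xi; have i1 := cintble_normc (cintble_kJ b0 p0 x0).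
    by rewrite (RintegralZr _ measurableT i1).
  - exact/rintegrableZ/rintegrable_ch2.
have y0 v : 0 < x * (1 + expR v) by rewrite mulr_gt0.
pose C := (2 * Num.sqrt pi)%:C * cpow x (tau *i) * (expR (- x))%:C.
have step3a v : Gamma q * cint (fun xi => k xi v) =
    C * (kJ p (q - 1 - p) x v * J q (q - 1) (x * (1 + expR v))).
  rewrite (eq_cint (fun xi => kE xi v)) cintZ; last exact: cintble_kI0.
  rewrite -/(I0 (x * (1 + expR v)) tau).
  transitivity (cexp (p * v%:C) * cpow (1 + expR v) b0 *
      (Gamma q * I0 (x * (1 + expR v)) tau)); first by ring.
  have hb := bessel_laplace tau (y0 v).
  rewrite -q_def in hb.
  rewrite (cpowM _ x0 (one_expR_gt0 v)) in hb.
  rewrite hb.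
  rewrite /kJ b0q (cpowD _ b0) /C.
  have -> : (expR (- (x * (1 + expR v))))%:C = (expR (- x))%:C * (expR (- x * expR v))%:C.
    by rewrite -rcM -expRD; congr ((expR _)%:C); ring.
  ring.
have step3 v : cint (fun xi => k xi v) =
    (Gamma q)^-1 * C * (kJ p (q - 1 - p) x v * J q (q - 1) (x * (1 + expR v))).
  by rewrite -mulrA -step3a mulKf.
have [ik ek] := J_convolution p0 q0 x0 erefl.
have G0 : Gamma p * Gamma q = Beta p q * Gamma (p + q).
  by rewrite (GammaE p0) (GammaE q0) (GammaE pq0); exact: euler_mul.
apply: (mulfI Gq).
rewrite step1 step2 (eq_cint step3) (cintZ _ ik) ek /C.
transitivity ((2 * Num.sqrt pi)%:C * cpow x (tau *i) * (expR (- x))%:C *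
   (Beta p q * Gamma (p + q)) * J (p + q) (q - 1 - p) x); first by field.
rewrite -G0; ring.
Qed.

End base_formula.

(** * Raising [m] *)

Section tame_functions.
Context {R : realType}.
Implicit Types (p : R -> R) (x y tau m k : R).

Lemma cder_near (f g : R -> R[i]) x (d : R[i]) : 0 < x ->
  (forall t, 0 < t -> f t = g t) -> cder f x d -> cder g x d.
Proof.
move=> x0 fg [h1 h2].
have n1 : \near x, f x = g x.
  by near=> t; apply: fg; near: t; exact: lt_nbhsr.
split.
  apply: near_eq_is_derive h1.
  by apply: filterS n1 => t ->.
apply: near_eq_is_derive h2.
by apply: filterS n1 => t ->.
Unshelve. all: by end_near. Qed.

(** All derivatives are carried along since each step from [m] to [m + 1] differentiates once more.
    The rate [e^{-y/2}], weaker than the true [e^{-y}], leaves room for arbitrary powers of [y]. *)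
Definition tame_family (P : nat -> R -> R) :=
  (forall n y, 0 < y -> rder (P n) y (P n.+1 y)) /\
  (forall n j d, 0 < d -> exists2 C, 0 <= C &
     forall y, d <= y -> y ^+ j * `|P n y| <= C * expR (- (y / 2))).

Definition tame p := exists2 P, P 0%N = p & tame_family P.

Lemma tame_euler P a k : tame_family P -> tame (fun y => a * (y * P 1%N y) + k * P 0%N y).
Proof.
move=> [dP bP].
(* Leibniz's rule for the [n]-th derivative of [a y P' + k P]. *)
exists (fun n y => a * (y * P n.+1 y + n%:R * P n y) + k * P n y).
  by apply/funext => y; rewrite mul0r addr0.
split.
  move=> n y y0.
  have h1 := dP n y y0; have h2 := dP n.+1 y y0.
  apply: rder_eq (rderD (rderM (rder_cst a y) (rderD (rderM (rder_id y) h2)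
     (rderM (rder_cst n%:R y) h1))) (rderM (rder_cst k y) h1)) _.
  by rewrite -natr1; ring.
move=> n j d d0.
have [C C0 hC] := bP n.+1 j.+1 d d0; have [D D0 hD] := bP n j d d0.
exists (`|a| * C + (`|a| * n%:R + `|k|) * D); first by rewrite !(addr_ge0, mulr_ge0).
move=> y dy; have y0 : 0 < y by exact: lt_le_trans dy.
have hc := hC _ dy; have hd := hD _ dy.
apply: (@le_trans _ _ (`|a| * (y ^+ j.+1 * `|P n.+1 y|) +
    (`|a| * n%:R + `|k|) * (y ^+ j * `|P n y|))).
  apply: (@le_trans _ _ (y ^+ j * (`|a| * (y * `|P n.+1 y| + n%:R * `|P n y|) + `|k| * `|P n y|))).
    rewrite ler_wpM2l ?exprn_ge0 ?(ltW y0)//.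
    apply: le_trans (ler_normD _ _) _; rewrite !normrM lerD2r ler_wpM2l//.
    apply: le_trans (ler_normD _ _) _.
    by rewrite !normrM (gtr0_norm y0) normr_nat.
  by rewrite exprSr le_eqVlt; apply/orP; left; apply/eqP; ring.
rewrite [leRHS]mulrDl; apply: lerD; rewrite -[leRHS]mulrA; apply: ler_wpM2l => //.
Qed.

Lemma tame_mul_deriv P : tame_family P -> tame (fun y => y * P 1%N y).
Proof.
by move=> /(tame_euler 1 0); under eq_fun do rewrite mul1r mul0r addr0.
Qed.

Lemma tame_bound p x : tame p -> 0 < x ->
  exists2 C, 0 <= C & forall xi, `|p (x * ch2 xi)| <= C * expR (- (x / 2 * ch2 xi)).
Proof.
move=> [P <- [_ bP]] x0; have [C C0 hC] := bP 0%N 0%N x x0.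
exists C => // xi; have := hC (x * ch2 xi).
rewrite expr0 mul1r mulrAC; apply.
by rewrite ler_peMr ?(ltW x0)// ch2_ge1.
Qed.

Definition kI p x tau xi : R[i] := (p (x * ch2 xi))%:C * cexp (tau *i * xi%:C).
Definition I p x tau : R[i] := cint (kI p x tau).

Lemma tame_cont p y : tame p -> 0 < y -> {for y, continuous p}.
Proof. by move=> [P <- [dP _]] y0; exact: rder_cont (dP 0%N y y0). Qed.

Lemma tame_ch2_cont p x : tame p -> 0 < x -> continuous (fun xi => p (x * ch2 xi)).
Proof.
move=> tp x0 xi; apply: (@continuous_comp _ _ _ (fun xi => x * ch2 xi) p).
  by apply: cvgM; [exact: cvg_cst|exact: ch2_cont].
by apply: tame_cont; rewrite // mulr_gt0// ch2_gt0.
Qed.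

Lemma ccont_kI p x tau : tame p -> 0 < x -> ccont (kI p x tau).
Proof.
move=> tp x0; apply: ccontM; last exact: ccont_cexp_lin.
exact/ccont_real/tame_ch2_cont.
Qed.

Lemma normc_kI p x tau xi : normc (kI p x tau xi) = `|p (x * ch2 xi)|.
Proof. by rewrite /kI normcM normc_real normc_cexp cReMr /= mul0r expR0 mulr1. Qed.

Lemma rintegrable_tame p x : tame p -> 0 < x -> rintegrable (fun xi => p (x * ch2 xi)).
Proof.
move=> tp x0; have [C C0 hC] := tame_bound tp x0.
have x2 : 0 < x / 2 by rewrite divr_gt0.
apply: (rintegrable_le _ (rintegrableZ C (rintegrable_ch2 x2)) hC).
by apply: continuous_measurable_fun; exact: tame_ch2_cont.
Qed.

Lemma cintble_kI p x tau : tame p -> 0 < x -> cintble (kI p x tau).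
Proof.
move=> tp x0; apply: (cintble_le _ (rintegrable_norm (rintegrable_tame tp x0))) => [|xi].
  exact/cmeas_ccont/ccont_kI.
by rewrite normc_kI.
Qed.

(** The integrand depends on [x] only through [y = x cosh^2(xi/2)], so that [x d/dx] outside the
    integral is [y d/dy] inside. *)
Lemma cder_I P x tau : tame_family P -> 0 < x ->
  cder (fun x => I (P 0%N) x tau) x
    ((x%:C)^-1 * I (fun y => y * P 1%N y) x tau).
Proof.
move=> tP x0; have [dP bP] := tP.
have x2 : 0 < x / 2 by rewrite divr_gt0.
have x4 : 0 < x / 2 / 2 by rewrite divr_gt0.
(* The weight [y^1] absorbs the factor [ch2 xi] produced by the chain rule. *)
have [C C0 hC] := bP 1%N 1%N (x / 2) x2.
have hd t : x / 2 < t < 2 * x -> 0 < t by move=> /andP[h _]; exact: lt_trans h.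
have tP0 : tame (P 0%N) by exists P.
apply: (cder_eq (@cder_cint _ (kI (P 0%N)^~ tau)
   (fun x xi => (ch2 xi * P 1%N (x * ch2 xi))%:C * cexp (tau *i * xi%:C)) x (x / 2) (2 * x)
   (fun xi => (C * (x / 2)^-1) * expR (- (x / 2 / 2 * ch2 xi))) _ _ _ _ _)).
- by apply/andP; split; lra.
- by move=> t /hd t0; exact: cintble_kI.
- move=> t xi /hd t0.
  have h : rder (fun t => t * ch2 xi) t (ch2 xi).
    by apply: rder_eq (rderM (rder_id t) (rder_cst _ t)) _; rewrite mul1r mulr0 addr0.
  have tc : 0 < t * ch2 xi by rewrite mulr_gt0// ch2_gt0.
  have h2 := @rder_comp _ (P 0%N) (fun t => t * ch2 xi) t _ _ (dP 0%N _ tc) h.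
  apply: cder_eq (cderM (cder_real h2) (cder_cst (cexp (tau *i * xi%:C)) t)) _.
  by rewrite mulr0 addr0 [_ * ch2 xi]mulrC.
- exact/rintegrableZ/rintegrable_ch2.
- move=> t xi ht; have t0 := hd _ ht; have /andP[t1 t2] := ht.
  rewrite normcM normc_real normc_cexp cReMr /= mul0r expR0 mulr1.
  have c0 := ch2_gt0 xi.
  have tc : x / 2 * ch2 xi <= t * ch2 xi by rewrite ler_wpM2r// ltW.
  have hc : t * ch2 xi * `|P 1%N (t * ch2 xi)| <= C * expR (- (t * ch2 xi / 2)).
    have := hC (t * ch2 xi); rewrite expr1; apply; apply: le_trans tc.
    by rewrite ler_peMr ?ch2_ge1// ltW.
  rewrite normrM (gtr0_norm c0) [leRHS]mulrAC ler_pdivlMr//.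
  apply: (@le_trans _ _ (t * ch2 xi * `|P 1%N (t * ch2 xi)|)).
    by rewrite mulrC -mulrA ler_wpM2r ?mulr_ge0// ltW.
  apply: le_trans hc _; rewrite ler_wpM2l// ler_expR lerN2; lra.
- rewrite /I -cintZ; last by apply: cintble_kI => //; exact: tame_mul_deriv.
  apply: eq_cint => xi; rewrite /kI; have := rc_neq0 x0 => xC.
  by rewrite !rcM; field.
Qed.

End tame_functions.

(** * Both sides as one family in [m], and the induction on [m] *)

Section representation.
Context {R : realType}.
Local Notation mu := (@lebesgue_measure R).
Implicit Types (x y tau m r s : R) (a c nu : R[i]).

Definition rJ r s x : R := Re (J r%:C s%:C x).

Lemma kJ_realE r s x u :
  kJ r%:C s%:C x u = (expR (r * u) * (1 + expR u) `^ s * expR (- x * expR u))%:C.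
Proof. by rewrite /kJ cpow_real// -rcM cexp_real -!rcM. Qed.

Lemma J_real r s x : J r%:C s%:C x = (rJ r s x)%:C.
Proof. by rewrite /rJ /J (eq_cint (kJ_realE r s x)) cintR. Qed.

Lemma normc_J_le r s d y : 0 < r -> 0 < d -> d <= y ->
  `|rJ r s y| <= 2 * \int[mu]_u normc (kJ r%:C s%:C d u).
Proof.
move=> r0 d0 dy; apply: le_trans (normRe_le _) _.
apply: normc_cint_le; first exact: cmeas_kJ.
  exact/cintble_normc/cintble_kJ.
move=> u; rewrite !normc_kJ; apply: ler_wpM2l; first by rewrite mulr_ge0 ?expR_ge0 ?powR_ge0.
by rewrite ler_expR ler_wpM2r ?expR_ge0// lerN2.
Qed.

Lemma exprn_expR_le j y : 0 <= y -> y ^+ j * expR (- y) <= (2 ^+ j * j`!%:R) * expR (- (y / 2)).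
Proof.
move=> y0.
have h : y ^+ j <= (2 ^+ j * j`!%:R) * expR (y / 2).
  case: j => [|j]; first by rewrite !expr0 !mul1r -expR0 ler_expR divr_ge0.
  have y2 : 0 <= y / 2 by rewrite divr_ge0.
  have := expR_ge1Dxn j y2.
  have f0 : 0 < (j.+1`!%:R : R) by rewrite ltr0n fact_gt0.
  have p0 : 0 < 2 ^+ j.+1 * (j.+1`!%:R : R) by rewrite mulr_gt0// exprn_gt0.
  move=> h; rewrite mulrC -ler_pdivrMr//.
  apply: le_trans h; rewrite expr_div_n.
  have -> : y ^+ j.+1 / (2 ^+ j.+1 * j.+1`!%:R) = y ^+ j.+1 / 2 ^+ j.+1 / j.+1`!%:R.
    by rewrite invfM mulrA.
  by rewrite lerDr.
apply: (@le_trans _ _ ((2 ^+ j * j`!%:R) * expR (y / 2) * expR (- y))).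
  by rewrite ler_wpM2r ?expR_ge0.
rewrite -mulrA -expRD (_ : y / 2 + - y = - (y / 2)) ?lexx//.
by field.
Qed.

(** The [n]-th derivative of [K e^{-y} J(r, s, y)]: by [J_succ], the factor [e^{-y}] turns
    differentiation into the shift [s -> s + 1] with a sign. *)
Definition Pbase (K r s : R) (n : nat) y : R :=
  K * ((-1) ^+ n * (expR (- y) * rJ r (s + n%:R) y)).

Lemma tame_base K r s : 0 < r -> tame_family (Pbase K r s).
Proof.
move=> r0; have r1 : 0 < r + 1 by rewrite addr_gt0.
split.
  move=> n y y0.
  have [h1 _] := @cder_J R r%:C (s + n%:R)%:C y r0 y0.
  have h2 := rder_comp (is_derive_expR _) (rderN (rder_id y)).
  apply: rder_eq (rderM (rder_cst K y) (rderM (rder_cst ((-1) ^+ n) y) (rderM h2 h1))) _.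
  have := @J_succ R r%:C (s + n%:R)%:C y r0 y0.
  have -> : (s + n%:R)%:C + 1 = (s + n.+1%:R)%:C :> R[i].
    by rewrite -natr1 addrA !rcD.
  have -> : r%:C + 1 = (r + 1)%:C :> R[i] by rewrite rcD.
  rewrite !J_real -rcD => /(congr1 Re) /= e.
  rewrite /Pbase e exprS; ring.
move=> n j d d0; pose C := 2 * \int[mu]_u normc (kJ r%:C (s + n%:R)%:C d u).
have C0 : 0 <= C by rewrite mulr_ge0// Rintegral_ge0// => u _; exact: normc_ge0.
exists (`|K| * C * (2 ^+ j * j`!%:R)).
  by rewrite (mulr_ge0 (mulr_ge0 (normr_ge0 _) C0))// mulr_ge0 ?exprn_ge0.
move=> y dy; have y0 : 0 <= y by apply: le_trans dy; exact: ltW.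
rewrite /Pbase !normrM normrX normrN1 expr1n mul1r (ger0_norm (expR_ge0 _)).
have h1 := exprn_expR_le j y0; have h2 := normc_J_le (s + n%:R) r0 d0 dy.
rewrite [leLHS](_ : _ = `|K| * (`|rJ r (s + n%:R) y| * (y ^+ j * expR (- y)))); last by ring.
rewrite -!mulrA ler_wpM2l// mulrA; apply: ler_pM => //.
  by rewrite mulr_ge0 ?exprn_ge0 ?expR_ge0.
by rewrite mulrA.
Qed.

(** The common shape of both sides: [p_m] is the case [c = 3/2], [nu = 1/2], and [W_{m, i tau}] is
    [sqrt x e^{x/2}] times the case [c = 1 + 2 i tau], [nu = i tau]. *)
Definition tF a c nu x : R[i] := (expR (- x))%:C * cpow x nu * tricomi_nonint a c x.

(* [P 0] is the function [p_m] of the header, and [P n] its [n]-th derivative. *)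
Definition represents m (P : nat -> R -> R) := [/\ tame_family P,
  forall y, 0 < y -> tF (2^-1 - m%:C) (2^-1 + 1) 2^-1 y = (P 0%N y)%:C &
  forall x tau, 0 < x -> tau != 0 ->
    tF (2^-1 + tau *i - m%:C) (2 * tau *i + 1) (tau *i) x =
      ((2 * Num.sqrt pi)^-1)%:C * I (P 0%N) x tau].

(** Kummer's transformation exchanges the two terms of the definition. *)
Lemma tricomi_kummer a c x : tricomi_nonint a c x =
  cpow x (1 - c) * tricomi_nonint (a - c + 1) (2 - c) x.
Proof.
rewrite /tricomi_nonint.
have -> : 1 - (2 - c) = c - 1 by ring.
have -> : a - c + 1 - (2 - c) + 1 = a by ring.
have -> : 2 - c - 1 = 1 - c by ring.
have -> : 2 - (2 - c) = c by ring.
have e : cpow x (1 - c) * cpow x (c - 1) = 1.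
  by rewrite -cpowD (_ : 1 - c + (c - 1) = 0) ?cpow0//; ring.
by rewrite [RHS]mulrDr addrC !mulrA e mul1r.
Qed.

Lemma half_re : Re (2^-1 : R[i]) = 2^-1.
Proof. by rewrite natC -rcV. Qed.

Lemma halfC : 2^-1 = (2^-1 : R)%:C :> R[i].
Proof. by rewrite rcV natC. Qed.

Lemma I_base m x tau : m < 0 -> 0 < x ->
  (2 * Num.sqrt pi)%:C * cpow x (tau *i) * (expR (- x))%:C
     * J (2^-1 - m%:C + tau *i) (m%:C - 2^-1 + tau *i) x =
  Gamma (2^-1 - m%:C + tau *i) * I (Pbase (rgamma (- m))^-1 (- m) (m - 2^-1) 0) x tau.
Proof.
move=> m0 x0; have mn0 : 0 < - m by rewrite oppr_gt0.
have mn0C : 0 < Re (- m%:C) by rewrite cReN.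
have GK : (Gamma (- m%:C))^-1 = ((rgamma (- m))^-1)%:C.
  by rewrite GammaE// -rcN rgammaE rcV.
have Gm := Gamma_neq0 mn0C.
have := fourier_base tau m0 x0.
have -> : cint (fun xi => (expR (- (x * ch2 xi)))%:C * J (- m%:C) (m%:C - 2^-1) (x * ch2 xi)
                    * cexp (tau *i * xi%:C)) =
   Gamma (- m%:C) * I (Pbase (rgamma (- m))^-1 (- m) (m - 2^-1) 0) x tau.
  rewrite /I -cintZ; last first.
    apply: cintble_kI => //; exists (Pbase (rgamma (- m))^-1 (- m) (m - 2^-1)) => //.
    exact: tame_base.
  apply: eq_cint => xi; rewrite /kI /Pbase expr0 mul1r addr0 !rcM -GK.
  rewrite (_ : m%:C - 2^-1 = (m - 2^-1)%:C :> R[i]); last by rewrite rcB -halfC.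
  by rewrite -rcN J_real rcN; field; exact: Gm.
move: (I _ _ _) (J _ _ _) ((2 * Num.sqrt pi)%:C) => I1 J1 w e.
apply: (mulfI Gm); rewrite [RHS]mulrCA e; ring.
Qed.

Lemma represents_base m : m < 0 -> represents m (Pbase (rgamma (- m))^-1 (- m) (m - 2^-1)).
Proof.
move=> m0; have mn0 : 0 < - m by rewrite oppr_gt0.
have mn0C : 0 < Re (- m%:C) by rewrite cReN.
pose K := (rgamma (- m))^-1.
have GK : (Gamma (- m%:C))^-1 = K%:C.
  by rewrite GammaE// -rcN rgammaE /K rcV.
have Gm := Gamma_neq0 mn0C.
split.
- exact: tame_base.
(* The transformation passes from [c = 3/2] to [c = 1/2], where the Laplace integral is the
   [J(-m, m - 1/2, y)] of [fourier_base] and the factor [sqrt y] disappears. *)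
- move=> y y0; rewrite /tF tricomi_kummer.
  have -> : 1 - (2^-1 + 1) = - 2^-1 :> R[i] by ring.
  have -> : 2 - (2^-1 + 1) = 2^-1 :> R[i] by field.
  have -> : 2^-1 - m%:C - (2^-1 + 1) + 1 = - m%:C :> R[i] by ring.
  rewrite cpowN -[LHS]mulrA mulVKf ?cpow_neq0//.
  rewrite tricomi_J//; last 4 first.
  - by rewrite half_re invr_gt0.
  - rewrite half_re; lra.
  - by apply/eqP => /(congr1 Re); rewrite half_re /=; lra.
  - rewrite !(cReB, cReD, cReN) half_re /=; lra.
  have -> : 2^-1 - - m%:C - 1 = (m - 2^-1)%:C :> R[i].
    by rewrite rcB -halfC; field.
  rewrite GK -rcN J_real /Pbase expr0 mul1r addr0 !rcM; ring.
- move=> x tau x0 tau0.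
  have aE : 2^-1 + tau *i - m%:C = 2^-1 - m%:C + tau *i by ring.
  have tauC : Re (tau *i) = 0 by [].
  have a0 : 0 < Re (2^-1 + tau *i - m%:C).
    by rewrite !cRIE half_re /= addr0; lra.
  have cRe : Re (2 * tau *i + 1 : R[i]) = 1 by rewrite cReD natC cReMl /= mulr0 add0r.
  rewrite /tF tricomi_J//; last 4 first.
  - by rewrite cRe.
  - by rewrite cRe ltr1n.
  - apply/eqP => /(congr1 Im); rewrite cImD natC cImMl /= addr0 => /eqP.
    by rewrite mulf_eq0 (negbTE tau0) pnatr_eq0.
  - rewrite cReB cReB cRe !cRIE half_re /=; lra.
  have bE : 2 * tau *i + 1 - (2^-1 + tau *i - m%:C) - 1 = m%:C - 2^-1 + tau *i by ring.
  rewrite bE aE.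
  have := I_base tau m0 x0.
  rewrite aE in a0; have Ga := Gamma_neq0 a0.
  set a := 2^-1 - m%:C + tau *i in Ga *.
  have sp : (2 * Num.sqrt pi)%:C != 0 :> R[i].
    by apply: rc_neq0; rewrite mulr_gt0// sqrtr_gt0 pi_gt0.
  rewrite rcV; move: (I _ _ _) (J _ _ _) ((2 * Num.sqrt pi)%:C) sp => I1 J1 w w0 e.
  apply: (mulfI Ga); apply: (mulfI w0).
  transitivity (w * cpow x (tau *i) * (expR (- x))%:C * J1); first by field.
  rewrite e; field; exact: w0.
Qed.

(** For both parameter sets in [represents], [c - a - nu = m + 1/2]. Hence one operator,
    [- x d/dx - (m + 1/2)], lowers [a] by one, that is, raises [m], on either side. *)
Lemma cder_tF a c nu x : 0 < Re c -> Re c < 2 -> 0 < x ->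
  cder (tF a c nu) x (- (tF (a - 1) c nu x + (c - a - nu) * tF a c nu x) / x%:C).
Proof.
move=> c0 c2 x0; have xC := rc_neq0 x0.
have h1 := cder_real (rder_comp (is_derive_expR _) (rderN (rder_id x))).
have h2 := @cder_cpow R (fun t => t) x 1 nu x0 (rder_id x).
apply: cder_eq (cderM (cderM h1 h2) (cder_tricomi a c0 c2 x0)) _.
rewrite /tF tricomi_lower// rcM rcN mul1r rcV; field; exact: xC.
Qed.

(** Each identity for [m] is differentiated in two ways, by [cder_tF] and through the derivatives of
    [P]; uniqueness of the derivative gives the identity for [m + 1]. *)
Lemma represents_succ m : (exists P, represents m P) -> exists P, represents (m + 1) P.
Proof.
move=> [P [tP hD hW]]; have [dP bP] := tP.
have [Q QE tQ] := tame_euler (-1) (- (m + 2^-1)) tP.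
have mE : m%:C + 1 = (m + 1)%:C :> R[i] by rewrite rcD.
have kE : m%:C + 2^-1 = (m + 2^-1)%:C :> R[i] by rewrite rcD -halfC.
exists Q; split => //.
- move=> y y0; rewrite QE.
  have yC := rc_neq0 y0.
  have c0 : 0 < Re (2^-1 + 1 : R[i]) by rewrite cReD half_re /=; lra.
  have c2 : Re (2^-1 + 1 : R[i]) < 2 by rewrite cReD half_re /=; lra.
  have h1 := cder_tF (2^-1 - m%:C) 2^-1 c0 c2 y0.
  have h2 := cder_near y0 (fun t t0 => esym (hD t t0)) (cder_real (dP 0%N y y0)).
  have := cder_uniq h1 h2; rewrite hD// => e.
  have -> : 2^-1 - (m + 1)%:C = 2^-1 - m%:C - 1 :> R[i] by rewrite -mE; ring.
  have {}e : - (tF (2^-1 - m%:C - 1) (2^-1 + 1) 2^-1 y +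
      (2^-1 + 1 - (2^-1 - m%:C) - 2^-1) * (P 0%N y)%:C) = y%:C * (P 1%N y)%:C.
    by rewrite -e [RHS]mulrCA mulfV ?mulr1.
  rewrite mulN1r mulNr rcB rcN !rcM -e -kE.
  have -> : m%:C + 2^-1 = 2^-1 + 1 - (2^-1 - m%:C) - 2^-1 :> R[i] by field.
  ring.
- move=> x tau x0 tau0; rewrite QE.
  have xC := rc_neq0 x0.
  have cRe : Re (2 * tau *i + 1 : R[i]) = 1 by rewrite cReD natC cReMl /= mulr0 add0r.
  have c0 : 0 < Re (2 * tau *i + 1 : R[i]) by rewrite cRe.
  have c2 : Re (2 * tau *i + 1 : R[i]) < 2 by rewrite cRe ltr1n.
  have h1 := cder_tF (2^-1 + tau *i - m%:C) (tau *i) c0 c2 x0.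
  have h2 := cder_near x0 (fun t t0 => esym (hW t tau t0 tau0)) (cderZ _ (cder_I tau tP x0)).
  have := cder_uniq h1 h2; rewrite hW// => e.
  have -> : 2^-1 + tau *i - (m + 1)%:C = 2^-1 + tau *i - m%:C - 1 by rewrite -mE; ring.
  have tP0 : tame (P 0%N) by exists P.
  have -> : I (fun y => -1 * (y * P 1%N y) + - (m + 2^-1) * P 0%N y) x tau =
     - I (fun y => y * P 1%N y) x tau - (m%:C + 2^-1) * I (P 0%N) x tau.
    have i1 : cintble (kI (fun y => y * P 1%N y) x tau).
      by apply: cintble_kI => //; exact: tame_mul_deriv.
    have i2 : cintble (kI (P 0%N) x tau) by exact: cintble_kI.
    transitivity (-1 * I (fun y => y * P 1%N y) x tau + - (m%:C + 2^-1) * I (P 0%N) x tau); last by ring.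
    rewrite /I -(cintZ _ i1) -(cintZ _ i2) -cintD; [|exact: cintbleZ..].
    by apply: eq_cint => xi; rewrite /kI kE !(rcD, rcM, rcN); ring.
  move: (I _ _ _) (I _ _ _) e => I1 I2 e.
  have kk : 2 * tau *i + 1 - (2^-1 + tau *i - m%:C) - tau *i = m%:C + 2^-1 by field.
  rewrite kk in e.
  move: (((2 * Num.sqrt pi)^-1)%:C) e => w e.
  have {}e : x%:C * (w * ((x%:C)^-1 * I1)) = - (tF (2^-1 + tau *i - m%:C - 1) (2 * tau *i + 1) (tau *i) x +
      (m%:C + 2^-1) * (w * I2)).
    by rewrite -e [LHS]mulrCA mulfV ?mulr1.
  transitivity (- (x%:C * (w * ((x%:C)^-1 * I1))) - (m%:C + 2^-1) * (w * I2)).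
    by rewrite e; ring.
  by field.
Qed.

Lemma representsP m : exists P, represents m P.
Proof.
have h n r : r < n%:R -> exists P, represents r P.
  elim: n r => [|n IH] r rn; first by eexists; exact: represents_base.
  rewrite -(subrK 1 r); apply/represents_succ/IH.
  by move: rn; rewrite -natr1; lra.
apply: (h (Num.truncn `|m|).+1); apply: le_lt_trans (ler_norm m) _.
by have /andP[] := truncn_itv (normr_ge0 m).
Qed.

End representation.

(** * The three-term recurrence and the case [tau = 0] *)

Section near_one.
Context {R : realType}.
Local Notation mu := (@lebesgue_measure R).
Implicit Types (x y tau m r s : R) (a c d : R[i]) (f g : R[i] -> R[i]).

(* A convergence rate makes the limit [c -> 1] stable under products and under
   the three-term recurrence without any appeal to filters. *)
Definition lip1 f (l : R[i]) := exists2 C, 0 <= C &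
  forall c, c != 1 -> normc (c - 1) <= 2^-1 -> normc (f c - l) <= C * normc (c - 1).

Lemma lip1_ext f g l : (forall c, c != 1 -> normc (c - 1) <= 2^-1 -> f c = g c) ->
  lip1 f l -> lip1 g l.
Proof. by move=> e [C C0 h]; exists C => // c c1 c2; rewrite -e// h. Qed.

Lemma lip1_affine k (d : R[i]) : lip1 (fun c => k + d * c) (k + d).
Proof.
exists (normc d); first exact: normc_ge0.
by move=> c _ _; rewrite (_ : _ - _ = d * (c - 1)) ?normcM//; ring.
Qed.

Lemma lip1B f g l k : lip1 f l -> lip1 g k -> lip1 (fun c => f c - g c) (l - k).
Proof.
move=> [C C0 h] [D D0 h']; exists (C + D); first exact: addr_ge0.
move=> c c1 c2; rewrite (_ : _ - _ = (f c - l) + - (g c - k)); last by ring.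
apply: le_trans (normcD _ _) _; rewrite normcN mulrDl.
by apply: lerD; [exact: h|exact: h'].
Qed.

Lemma lip1M f g l k : lip1 f l -> lip1 g k -> lip1 (fun c => f c * g c) (l * k).
Proof.
move=> [C C0 h] [D D0 h']; exists (C * (normc k + D) + normc l * D).
  by rewrite !(addr_ge0, mulr_ge0, normc_ge0).
move=> c c1 c2; set e := normc (c - 1).
have e0 : 0 <= e by exact: normc_ge0.
have gk : normc (g c) <= normc k + D.
  rewrite -[g c](subrK k) addrC; apply: le_trans (normcD _ _) _; rewrite lerD2l.
  apply: le_trans (h' c c1 c2) _; rewrite ler_piMr// (le_trans c2)//; lra.
rewrite (_ : _ - _ = (f c - l) * g c + l * (g c - k)); last by ring.
apply: le_trans (normcD _ _) _; rewrite !normcM mulrDl; apply: lerD.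
  by rewrite mulrAC; apply: ler_pM; rewrite ?normc_ge0// h.
by rewrite -mulrA ler_wpM2l ?normc_ge0// h'.
Qed.

Lemma lip1_lim f l : lip1 f l ->
  lim ((f c : R[i]^o) @[c --> (1 : R[i]^o)^']) = l.
Proof.
move=> [C C0 h]; apply: (@cvg_lim R[i]^o); first exact: norm_hausdorff.
apply/cvgrPdist_le => /= e e0.
have [e1 e2] : 0 < Re e /\ e = (Re e)%:C.
  by case: e e0 => u v; rewrite ltcE /= => /andP[/eqP -> ->].
pose dl := Num.min 2^-1 (Re e / (C + 1)).
have C1 : 0 < C + 1 by rewrite ltr_wpDl.
have dl0 : 0 < dl by rewrite lt_min invr_gt0 ltr0n divr_gt0.
have dlC : 0 < (dl%:C : R[i]) by rewrite ltcR.
apply/nbhs_ballP; exists (dl%:C) => //= c.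
rewrite -ball_normE /= => hc c1.
have {}hc : normc (c - 1) < dl.
  by move: hc; rewrite distrC (_ : `|c - 1| = (normc (c - 1))%:C)// ltcR.
have hc2 : normc (c - 1) <= 2^-1 by rewrite ltW// (lt_le_trans hc)// ge_min lexx.
rewrite e2 distrC (_ : `|f c - l| = (normc (f c - l))%:C)// lecR.
apply: le_trans (h c c1 hc2) _.
apply: (@le_trans _ _ ((C + 1) * (Re e / (C + 1)))); last by rewrite mulrC divfK// gt_eqF.
apply: ler_pM; rewrite ?normc_ge0//; first by rewrite lerDl.
by rewrite ltW// (lt_le_trans hc)// ge_min lexx orbT.
Qed.

Lemma normc_cexpB1 (w : R[i]) : normc (cexp w - 1) <= 3 * normc w * expR (normc w).
Proof.
pose n := normc w; have n0 : 0 <= n by exact: normc_ge0.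
have hr := normRe_le w; have hi := normIm_le w.
have expB1 (t : R) : `|expR t - 1| <= `|t| * expR `|t|.
  have h1 := expR_ge1Dx t; have h2 := expR_ge1Dx (- t).
  have e0 := expR_gt0 t.
  have [t0|t0] := leP 0 t.
    rewrite !ger0_norm//; last by rewrite subr_ge0 -expR0 ler_expR.
    have := ler_wpM2r (ltW e0) h2; rewrite -expRD addNr expR0; lra.
  rewrite !ltr0_norm//; last by rewrite subr_lt0 -expR0 ltr_expR.
  have h3 : 1 <= expR (- t) by rewrite -expR0 ler_expR; lra.
  have h4 : - t <= - t * expR (- t) by rewrite ler_peMr//; lra.
  lra.
have er : expR (Re w) <= expR n by rewrite ler_expR (le_trans (ler_norm _)).
have eR : expR `|Re w| <= expR n by rewrite ler_expR.
have e1 : `|expR (Re w) - 1| <= n * expR n.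
  by apply: (le_trans (expB1 (Re w))); apply: ler_pM; rewrite ?expR_ge0.
have cb : `|cos (Im w) - 1| <= n.
  have h := @MVT_bound R cos (fun t => - sin t) 1 (fun t => is_derive_cos t) _ (Im w) 0.
  rewrite cos0 subr0 mul1r in h; apply: le_trans (h _) hi.
  by move=> t; rewrite normrN sin_max.
have sb : `|sin (Im w)| <= n by apply: le_trans (abs_sin_le _) hi.
have ew := expR_gt0 (Re w); have en := expR_ge0 n.
have r1 : `|Re (cexp w - 1)| <= 2 * (n * expR n).
  rewrite cReB /=.
  rewrite (_ : _ - _ = expR (Re w) * (cos (Im w) - 1) + (expR (Re w) - 1)); last by ring.
  apply: le_trans (ler_normD _ _) _.
  have : `|expR (Re w) * (cos (Im w) - 1)| <= expR n * n.
    by rewrite normrM (gtr0_norm ew); apply: ler_pM => //; exact: ltW.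
  lra.
have r2 : `|Im (cexp w - 1)| <= n * expR n.
  rewrite cImB /= subr0 normrM (gtr0_norm ew) mulrC.
  by apply: ler_pM => //; exact: ltW.
apply: le_trans (normc_le _) _; rewrite -/n; lra.
Qed.

(** The difference of the kernels carries [e^{(c-1) L} - 1] with [L = ln (1 + e^u)], of modulus at
    most [3 |c - 1| L e^{L}] on the disc. As [L <= 1 + e^u], two extra powers of [1 + e^u] suffice,
    whence the exponent [2 - a]. *)
Lemma J_lip1 a x : 0 < Re a -> 0 < x -> lip1 (fun c => J a (c - a - 1) x) (J a (- a) x).
Proof.
move=> a0 x0; exists (2 * (3 * \int[mu]_u normc (kJ a (2 - a) x u))).
  by rewrite !mulr_ge0// Rintegral_ge0// => u _; exact: normc_ge0.
move=> c _ c2; set e := normc (c - 1).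
have i2 := cintble_normc (cintble_kJ (2 - a) a0 x0).
rewrite /J -cintB; [|exact: cintble_kJ..].
have -> : 2 * (3 * \int[mu]_u normc (kJ a (2 - a) x u)) * e =
    2 * \int[mu]_u (3 * e * normc (kJ a (2 - a) x u)).
  by rewrite (RintegralZl _ measurableT i2); ring.
apply: normc_cint_le; last first.
- move=> u; pose L := ln (1 + expR u).
  have L0 : 0 <= L by rewrite ln_ge0.
  have eL : expR L = 1 + expR u by rewrite lnK// posrE.
  have LeL : L <= expR L by apply: le_trans (expR_ge1Dx L); rewrite lerDr.
  have -> : kJ a (c - a - 1) x u - kJ a (- a) x u =
      kJ a (- a) x u * (cexp ((c - 1) * L%:C) - 1).
    rewrite /kJ (_ : c - a - 1 = - a + (c - 1)); last by ring.
    by rewrite cpowD /cpow -/L; ring.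
  have nw : normc ((c - 1) * L%:C) = e * L by rewrite normcM normc_real ger0_norm.
  have hb := normc_cexpB1 ((c - 1) * L%:C); rewrite nw in hb.
  have -> : normc (kJ a (2 - a) x u) = normc (kJ a (- a) x u) * (expR L * expR L).
    rewrite (_ : 2 - a = - a + 1 + 1); last by ring.
    by rewrite /kJ !cpowS// -eL !normcM normc_real ger0_norm ?expR_ge0//; ring.
  rewrite normcM mulrCA ler_wpM2l ?normc_ge0//.
  apply: le_trans hb _.
  have e0 : 0 <= e by exact: normc_ge0.
  rewrite -!mulrA ler_wpM2l// ler_wpM2l//; apply: ler_pM; rewrite ?expR_ge0//.
  rewrite ler_expR ler_piMl//; apply: le_trans c2 _; lra.
- exact: rintegrableZ.
- apply: (cmeas_ccont (ccontB _ _)); exact: ccont_kJ.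
Qed.

Lemma represents_uniq m P Q x tau : represents m P -> represents m Q -> 0 < x ->
  I (P 0%N) x tau = I (Q 0%N) x tau.
Proof.
move=> [_ hP _] [_ hQ _] x0; apply: eq_cint => xi; rewrite /kI; congr (_ * _).
have y0 : 0 < x * ch2 xi by rewrite mulr_gt0// ch2_gt0.
by rewrite -hP// -hQ.
Qed.

Lemma Re_near1 c : normc (c - 1) <= 2^-1 -> 2^-1 <= Re c <= 3 / 2.
Proof.
move=> h; have := le_trans (normRe_le (c - 1)) h; rewrite cReB /= ler_norml => /andP[].
by move=> h1 h2; apply/andP; split; lra.
Qed.

(** With [a = - (m + 1/2) + i tau] and [c = 1 + 2 i tau], the numbers [a] and [a - c + 1] are
    complex conjugates, so the last coefficient of [tricomi_3term] is their squared modulus. *)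
Lemma I_3term_neq0 m P0 P1 P2 x tau : represents m P0 -> represents (m + 1) P1 ->
  represents (m + 2) P2 -> 0 < x -> tau != 0 ->
  I (P2 0%N) x tau = (x - 2 * (m + 1))%:C * I (P1 0%N) x tau
     - ((m + 2^-1) ^+ 2 + tau ^+ 2)%:C * I (P0 0%N) x tau.
Proof.
move=> [_ _ h0] [_ _ h1] [_ _ h2] x0 t0.
have := h0 _ _ x0 t0; have := h1 _ _ x0 t0; have := h2 _ _ x0 t0.
have sp : ((2 * Num.sqrt pi)^-1)%:C != 0 :> R[i].
  by apply: rc_neq0; rewrite invr_gt0 mulr_gt0// sqrtr_gt0 pi_gt0.
move: (I _ _ _) (I _ _ _) (I _ _ _) sp => I0' I1 I2.
move: (((2 * Num.sqrt pi)^-1)%:C) => w w0 e2 e1 e0.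
have cRe : Re (2 * tau *i + 1 : R[i]) = 1 by rewrite cReD natC cReMl /= mulr0 add0r.
have c0 : 0 < Re (2 * tau *i + 1 : R[i]) by rewrite cRe.
have c2 : Re (2 * tau *i + 1 : R[i]) < 2 by rewrite cRe ltr1n.
pose a := 2^-1 + tau *i - m%:C - 1.
have a1E : 2^-1 + tau *i - (m + 1)%:C = a by rewrite /a rcD opprD addrA.
have a0E : 2^-1 + tau *i - m%:C = a + 1 by rewrite /a subrK.
have a2E : 2^-1 + tau *i - (m + 2)%:C = a - 1.
  by rewrite /a rcD natC; ring.
rewrite a0E in e0; rewrite a1E in e1; rewrite a2E in e2.
have h3 := tricomi_3term a c0 c2 x0.
apply: (mulfI w0); rewrite -e2.
transitivity ((x - 2 * (m + 1))%:C * (w * I1) - ((m + 2^-1) ^+ 2 + tau ^+ 2)%:C * (w * I0')); last by ring.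
rewrite -e1 -e0 /tF h3.
have k1 : 2 * a - (2 * tau *i + 1) = - (2 * (m + 1))%:C.
  by rewrite /a rcM rcD natC; field.
have tt : tau *i * tau *i = - (tau ^+ 2)%:C.
  by apply: complexP; rewrite ?cReM ?cImM ?cReN ?cImN /=; ring.
have k2 : a * (a - (2 * tau *i + 1) + 1) = ((m + 2^-1) ^+ 2 + tau ^+ 2)%:C.
  transitivity ((m%:C + 2^-1) ^+ 2 - tau *i * tau *i); first by rewrite /a; field.
  by rewrite tt opprK !(rcD, rcX) -halfC.
rewrite k1 k2 rcB; ring.
Qed.

Lemma I_cvg0 p x : tame p -> 0 < x ->
  ccvg (fun n : nat => I p x n.+1%:R^-1) (I p x 0).
Proof.
move=> tp x0.
have [||||_ h] := @cDCT R (fun n : nat => kI p x n.+1%:R^-1) (kI p x 0)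
   (fun xi => `|p (x * ch2 xi)|).
- by move=> n; exact/cmeas_ccont/ccont_kI.
- exact/rintegrable_norm/rintegrable_tame.
- by move=> n xi; rewrite normc_kI.
- move=> xi; rewrite /kI; apply: ccvgM; first exact: ccvg_cst.
  have hd : cder (fun t => cexp (t *i * xi%:C)) 0 (cexp (0 *i * xi%:C) * (xi *i)).
    apply: cder_cexp; split.
      by apply: (rder_ext (f := fun=> 0)) => [t|]; [rewrite cReMr /= mul0r|exact: rder_cst].
    apply: (rder_ext (f := fun t => t * xi)) => [t|]; first by rewrite cImMr.
    by apply: rder_eq (rderM (rder_id 0) (rder_cst xi 0)) _; rewrite mul1r mulr0 addr0.
  by apply: (ccvg_cont hd); exact: cvg_harmonic.
- exact: h.
Qed.

(** The integrals are continuous in [tau] by domination, so the relation extends to [tau = 0] along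
    [1 / (n + 1)]. *)
Lemma I_3term m P0 P1 P2 x tau : represents m P0 -> represents (m + 1) P1 ->
  represents (m + 2) P2 -> 0 < x ->
  I (P2 0%N) x tau = (x - 2 * (m + 1))%:C * I (P1 0%N) x tau
     - ((m + 2^-1) ^+ 2 + tau ^+ 2)%:C * I (P0 0%N) x tau.
Proof.
move=> h0 h1 h2 x0; have [t0|t0] := eqVneq tau 0; last exact: I_3term_neq0.
have t0' (P : nat -> R -> R) : tame_family P -> tame (P 0%N) by exists P.
have [/t0' p0 _ _] := h0; have [/t0' p1 _ _] := h1; have [/t0' p2 _ _] := h2.
rewrite t0; apply: (ccvg_uniq (I_cvg0 p2 x0)).
have hh : ccvg (fun n : nat => ((m + 2^-1) ^+ 2 + n.+1%:R^-1 ^+ 2 : R)%:C)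
    ((m + 2^-1) ^+ 2 + 0 ^+ 2)%:C.
  apply: ccvg_real; apply: cvgD; first exact: cvg_cst.
  by rewrite expr2; apply: cvgM; exact: cvg_harmonic.
have := ccvgB (ccvgM (ccvg_cst (x - 2 * (m + 1))%:C) (I_cvg0 p1 x0)) (ccvgM hh (I_cvg0 p0 x0)).
apply: ccvg_ext => n; rewrite (I_3term_neq0 h0 h1 h2 x0)//.
Qed.

(** For [m < 0] the Laplace integral is regular at [c = 1]. Otherwise the recurrence at fixed [c]
    descends to [m - 1] and [m - 2], and its limit matches [I_3term] at [tau = 0]. *)
Lemma tricomi_lip1 m P x : represents m P -> 0 < x ->
  lip1 (fun c => tricomi_nonint (2^-1 - m%:C) c x)
    ((expR x)%:C * ((2 * Num.sqrt pi)^-1)%:C * I (P 0%N) x 0).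
Proof.
move=> hP x0; have ReC c := @Re_near1 c.
have [n mn] : exists n : nat, m < n%:R.
  exists (Num.truncn `|m|).+1; apply: le_lt_trans (ler_norm m) _.
  by have /andP[] := truncn_itv (normr_ge0 m).
have base r Q : r < 0 -> represents r Q -> lip1 (fun c => tricomi_nonint (2^-1 - r%:C) c x)
    ((expR x)%:C * ((2 * Num.sqrt pi)^-1)%:C * I (Q 0%N) x 0).
  move=> r0 hQ; pose a : R[i] := 2^-1 - r%:C.
  (* On the disc of radius 1/2, [Re c <= 3/2]; this bound on [a] then gives [Re (c - a - 1) < 0], as
     [tricomi_J] demands. *)
  have a0 : 2^-1 < Re a by rewrite /a cReB half_re /=; lra.
  have a00 : 0 < Re a by apply: lt_trans a0; rewrite invr_gt0.
  have Ga := Gamma_neq0 a00.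
  have lE : (expR x)%:C * ((2 * Num.sqrt pi)^-1)%:C * I (Q 0%N) x 0 =
      J a (- a) x * (Gamma a)^-1.
    rewrite (represents_uniq 0 hQ (represents_base r0) x0).
    have := I_base 0 r0 x0; rewrite (_ : 0 *i = 0 :> R[i])// !addr0 cpow0 mulr1 -/a.
    rewrite (_ : r%:C - 2^-1 = - a); last by rewrite /a opprB.
    have sp : (2 * Num.sqrt pi)%:C != 0 :> R[i].
      by apply: rc_neq0; rewrite mulr_gt0// sqrtr_gt0 pi_gt0.
    have ex : (expR x)%:C != 0 :> R[i] by apply: rc_neq0; exact: expR_gt0.
    rewrite rcV expRN rcV; move: (I _ _ _) (J _ _ _) ((2 * Num.sqrt pi)%:C) sp => I1 J1 w w0 e.
    apply: (mulfI Ga); apply: (mulfI w0).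
    transitivity ((expR x)%:C * (Gamma a * I1)); first by field; exact: w0.
    by rewrite -e; field; rewrite ex Ga.
  rewrite lE; apply: (@lip1_ext (fun c => J a (c - a - 1) x * (Gamma a)^-1)).
    move=> c c1 c2; have /andP[h1 h2] := ReC _ c2.
    have k1 : 0 < Re c by lra.
    have k2 : Re c < 2 by lra.
    have k3 : Re (c - a - 1) < 0.
      rewrite cReB cReB (_ : Re (1 : R[i]) = 1)//; move: (Re a) (Re c) a0 h2 => ra rc'; lra.
    by symmetry; exact: tricomi_J.
  apply: lip1M; first exact: J_lip1.
  have := lip1_affine (Gamma a)^-1 0; rewrite addr0; apply: lip1_ext => c _ _.
  by rewrite mul0r addr0.
elim: n m P mn hP => [|n IH] m P mn hP; first exact: base.
have [m0|m0] := ltP m 0; first exact: base.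
have [Q1 hQ1] := representsP (m - 1); have [Q0 hQ0] := representsP (m - 2).
have mn1 : m - 1 < n%:R by move: mn; rewrite -natr1; lra.
have mn2 : m - 2 < n%:R by lra.
have l1 := IH _ _ mn1 hQ1; have l0 := IH _ _ mn2 hQ0.
have hQ1' : represents (m - 2 + 1) Q1 by rewrite (_ : m - 2 + 1 = m - 1)//; ring.
have hP' : represents (m - 2 + 2) P by rewrite subrK.
have e := I_3term 0 hQ0 hQ1' hP' x0.
pose a : R[i] := 2^-1 - (m - 1)%:C.
have lA := lip1_affine (2 * a + x%:C) (-1).
have lB := lip1_affine (a * (a + 1)) (- a).
have := lip1B (lip1M lA l1) (lip1M lB l0).
have -> : (2 * a + x%:C + -1) * ((expR x)%:C * ((2 * Num.sqrt pi)^-1)%:C * I (Q1 0%N) x 0) -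
  (a * (a + 1) + - a) * ((expR x)%:C * ((2 * Num.sqrt pi)^-1)%:C * I (Q0 0%N) x 0) =
  (expR x)%:C * ((2 * Num.sqrt pi)^-1)%:C * I (P 0%N) x 0.
  rewrite e /a expr0n addr0.
  have -> : (x - 2 * (m - 2 + 1))%:C = 2 * (2^-1 - (m - 1)%:C) + x%:C + -1 :> R[i].
    by rewrite !(rcB, rcM, rcD) natC; field.
  have -> : ((m - 2 + 2^-1) ^+ 2)%:C =
      (2^-1 - (m - 1)%:C) * (2^-1 - (m - 1)%:C + 1) + - (2^-1 - (m - 1)%:C) :> R[i].
    by rewrite rcX !(rcB, rcM, rcD, rcV) natC; field.
  ring.
apply: lip1_ext => c c1 c2; have /andP[h1 h2] := ReC _ c2.
have c0 : 0 < Re c by lra.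
have c3 : Re c < 2 by lra.
have -> : 2^-1 - m%:C = a - 1 by rewrite /a rcB natC; ring.
have aE : 2^-1 - (m - 2)%:C = a + 1 by rewrite /a !rcB natC; ring.
by rewrite (tricomi_3term a c0 c3 x0) aE -/a; ring.
Qed.

End near_one.

(** * The Whittaker and parabolic cylinder functions in terms of [P 0] *)

Section closed_forms.
Context {R : realType}.
Implicit Types (x y tau xi m : R) (a c : R[i]).

Lemma Im_intmul (k : int) : Im (k%:~R : R[i]) = 0.
Proof.
have h (n : nat) : Im (n%:R : R[i]) = 0 by rewrite natC.
by case: k => n; rewrite ?NegzE ?mulrNz ?cImN h ?oppr0.
Qed.

Lemma half_odd_nonint (k : int) : 2^-1 + 1 <> k%:~R :> R[i].
Proof.
move=> /(congr1 (fun z => 2 * z)); rewrite (_ : 2 * (2^-1 + 1) = 3%:Z%:~R); last first.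
  by rewrite -pmulrn; field.
rewrite (_ : 2 * k%:~R = (2%:Z * k)%:~R :> R[i]); last by rewrite intrM.
(* A parity contradiction: doubling an integer value 3/2 would make 3 even. *)
move=> e; have : 3%:Z = 2%:Z * k by apply/eqP; rewrite -(eqr_int R[i]) e eqxx.
move=> /(congr1 absz).
by rewrite abszM => /(congr1 odd); rewrite oddM.
Qed.

Lemma tricomi_nonintE a c x : (forall k : int, c <> k%:~R) ->
  tricomi a c x = tricomi_nonint a c x.
Proof. by move=> h; rewrite /tricomi asboolF// => -[k /h]. Qed.

Lemma whittaker_I m P x tau : represents m P -> 0 < x ->
  whittakerW m%:C (tau *i) x =
  (Num.sqrt x * expR (x / 2) / (2 * Num.sqrt pi))%:C * I (P 0%N) x tau.
Proof.
move=> hP x0; have [tP _ hW] := hP.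
have ex : expR (- x / 2) * expR x = expR (x / 2).
  by rewrite -expRD; congr expR; field.
have sq : cpow x 2^-1 = (Num.sqrt x)%:C.
  by rewrite halfC cpow_real// powR12_sqrt// ltW.
have sE : 2^-1 + tau *i - m%:C = 2^-1 + tau *i - m%:C by [].
suff e : cpow x (tau *i) * tricomi (2^-1 + tau *i - m%:C) (2 * tau *i + 1) x =
    (expR x)%:C * ((2 * Num.sqrt pi)^-1)%:C * I (P 0%N) x tau.
  rewrite /whittakerW cpowD sq; move: e.
  move: (cpow _ _) (tricomi _ _ _) (I _ _ _) => p1 T1 I1 e.
  transitivity ((expR (- x / 2))%:C * (Num.sqrt x)%:C * (p1 * T1)); first by ring.
  by rewrite e -ex !rcM; ring.
have [->|t0] := eqVneq tau 0.
  rewrite (_ : 0 *i = 0 :> R[i])// mulr0 add0r addr0 cpow0 mul1r.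
  rewrite /tricomi asboolT; last by exists 1.
  exact: lip1_lim (tricomi_lip1 hP x0).
rewrite tricomi_nonintE; last first.
  move=> k /(congr1 Im); rewrite Im_intmul cImD natC cImMl /= => /eqP.
  by rewrite addr0 mulf_eq0 (negbTE t0) pnatr_eq0.
have := hW x tau x0 t0; rewrite /tF expRN rcV.
have := rc_neq0 (expR_gt0 x).
move: (tricomi_nonint _ _ _) (I _ _ _) (cpow _ _) => T1 I1 p1 e0 e.
by rewrite -[RHS]mulrA -e; field; exact: e0.
Qed.

Lemma cosh_ch2 xi : cosh xi = 2 * ch2 xi - 1.
Proof. by rewrite /cosh /ch2; field. Qed.

Lemma parabolic_P m P x xi : represents m P -> 0 < x ->
  parabolicD (2 * m)%:C (Num.sqrt (2 * x) * cosh (xi / 2)) =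
  (2 `^ m * expR (x * ch2 xi / 2) * P 0%N (x * ch2 xi))%:C.
Proof.
move=> [tP hD _] x0; pose y := x * ch2 xi.
have y0 : 0 < y by rewrite mulr_gt0// ch2_gt0.
pose z := Num.sqrt (2 * x) * cosh (xi / 2).
have x20 : 0 < 2 * x by rewrite mulr_gt0.
have z0 : 0 < z by rewrite mulr_gt0 ?sqrtr_gt0// /cosh divr_gt0// addr_gt0 ?expR_gt0.
have zE : z ^+ 2 / 2 = y.
  by rewrite /z exprMn sqr_sqrtr ?ltW// ch2_cosh /y; field.
have lE : ln y = ln z *+ 2 - ln 2 by rewrite -zE ln_div ?posrE ?exprn_gt0// lnXn.
(* Since [y = z^2 / 2], the quarter powers from the two definitions cancel and only [2^m]
   survives. *)
have k4 : cpow 2 4^-1 * cpow z (- 2^-1) * cpow y 4^-1 = 1 :> R[i].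
  rewrite /cpow lE rcB mulr2n rcD -!cexpD.
  by set l := (X in cexp X); rewrite (_ : l = 0) ?cexp0// /l; field.
have := hD _ y0; rewrite -/y -/z /tF /parabolicD /whittakerW zE.
have -> : (2 * m)%:C / 2 + 4^-1 = m%:C + 4^-1 :> R[i].
  by rewrite rcM natC; field.
have -> : 2^-1 + 4^-1 - (m%:C + 4^-1) = 2^-1 - m%:C :> R[i] by ring.
have -> : 2 * 4^-1 + 1 = 2^-1 + 1 :> R[i] by field.
rewrite tricomi_nonintE; last exact: half_odd_nonint.
have ey : expR (- y / 2) = expR (y / 2) * expR (- y).
  by rewrite -expRD; congr expR; field.
rewrite cpowD (cpow_real _ (ltr0n _ 2)) cpowD ey !rcM => <-.
move: k4; move: (tricomi_nonint _ _ _) => T1.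
move: (cpow 2 _) (cpow z _) (cpow y 4^-1) => p1 p2 p3 k4.
transitivity ((p1 * p2 * p3) * (2 `^ m)%:C * (expR (y / 2))%:C *
  (expR (- y))%:C * cpow y 2^-1 * T1); first by ring.
by rewrite k4; ring.
Qed.
End closed_forms.

(** * Fourier inversion *)

Section gaussian.
Context {R : realType}.
Local Notation mu := (@lebesgue_measure R).
Implicit Types (x t w k xi : R).

Lemma cint_scale (f : R -> R[i]) k : 0 < k -> ccont f -> cintble f ->
  cint f = k%:C * cint (fun u => f (k * u)) /\ cintble (fun u => f (k * u)).
Proof.
move=> k0 [c1 c2] fi; have [m1 m2] := cmeas_ccont (conj c1 c2).
have kC := rc_neq0 k0.
have := @cint_subst R (fun t => k * t) (fun=> k) setT _ _ _ _ _ f m1 m2 _ _.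
move=> [||||//|y _|y _|e1 e2].
- by move=> x; apply: (rder_eq (rderM (rder_cst k x) (rder_id x))); rewrite mul0r add0r mulr1.
- by move=> x; exact: cvg_cst.
- by [].
- by apply/seteqP; split => // x _; exists (k^-1 * x) => //; rewrite mulVKf// gt_eqF.
- exact: c1.
- exact: c2.
have fE u : f (k * u) * k%:C * (k%:C)^-1 = f (k * u) by rewrite mulfK.
have hi : cintble (fun u => f (k * u)).
  exact: (cintble_ext fE (cintbleZr (k%:C)^-1 (e2.1 fi))).
by split => //; rewrite e1 cintZr 1?mulrC.
Qed.

Definition gauss t : R := expR (- (t ^+ 2 / 2)).

Lemma gauss_ge0 t : 0 <= gauss t. Proof. exact: expR_ge0. Qed.

Lemma gauss_le1 t : gauss t <= 1.
Proof. by rewrite -expR0 ler_expR oppr_le0 divr_ge0 ?sqr_ge0. Qed.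

Lemma rder_gauss t : rder gauss t (- t * gauss t).
Proof.
have h := rderN (rderM (rderM (rder_id t) (rder_id t)) (rder_cst 2^-1 t)).
apply: rder_eq (rder_comp (is_derive_expR _) h) _.
by rewrite /gauss expr2 mulrC; field.
Qed.

Lemma gauss_cont : continuous gauss.
Proof. by move=> t; exact: rder_cont (rder_gauss t). Qed.

(** The Gaussian is split into two equal factors [e^{-t^2/4}]: one absorbs the linear factor, the
    other is compared with [1 + t^2]. *)
Lemma gauss_mul_le t : `|t| * gauss t <= 4 * (1 + t ^+ 2)^-1.
Proof.
have h1 : `|t| <= expR (t ^+ 2 / 4).
  apply: le_trans (expR_ge1Dx _).
  have := sqr_ge0 (`|t| / 2 - 1); rewrite -(real_normK (num_real t)); lra.
have h2 : 1 + t ^+ 2 <= 4 * expR (t ^+ 2 / 4).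
  have := expR_ge1Dx (t ^+ 2 / 4); lra.
have e0 := expR_gt0 (t ^+ 2 / 4); have t1 : 0 < 1 + t ^+ 2 by rewrite ltr_pwDl ?sqr_ge0.
have -> : gauss t = (expR (t ^+ 2 / 4))^-1 * (expR (t ^+ 2 / 4))^-1.
  by rewrite -expRN -expRD /gauss; congr expR; field.
rewrite mulrA; apply: (@le_trans _ _ (expR (t ^+ 2 / 4))^-1).
  by rewrite ler_piMl ?invr_ge0 ?expR_ge0// ler_pdivrMr ?mul1r.
by rewrite ler_pdivlMr// ler_pdivrMl// mulrC.
Qed.

Lemma gauss_le t : gauss t <= 2 * (1 + t ^+ 2)^-1.
Proof.
have h2 : 1 + t ^+ 2 <= 2 * expR (t ^+ 2 / 2).
  have := expR_ge1Dx (t ^+ 2 / 2); have := sqr_ge0 t; lra.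
have t1 : 0 < 1 + t ^+ 2 by rewrite ltr_pwDl ?sqr_ge0.
by rewrite /gauss expRN ler_pdivlMr// ler_pdivrMl ?expR_gt0// mulrC.
Qed.

Lemma rintegrable_gauss : rintegrable gauss.
Proof.
apply: (rintegrable_le _ (rintegrableZ 2 rintegrable_oneDsqrV)) => [|t].
  by apply: continuous_measurable_fun; exact: gauss_cont.
by rewrite ger0_norm ?gauss_ge0// gauss_le.
Qed.

Lemma rintegrable_mul_gauss : rintegrable (fun t => `|t| * gauss t).
Proof.
apply: (rintegrable_le _ (rintegrableZ 4 rintegrable_oneDsqrV)) => [|t].
  apply: continuous_measurable_fun => t; apply: cvgM; last exact: gauss_cont.
  exact: norm_continuous.
by rewrite ger0_norm ?mulr_ge0 ?gauss_ge0// gauss_mul_le.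
Qed.

(** It enters the inversion twice, through the transform of the Gaussian and through the mass of the
    approximate identity; its square is the factor [2 pi]. *)
Definition gauss_int : R := \int[mu]_t gauss t.

Lemma gauss_int_ge0 : 0 <= gauss_int.
Proof. by apply: Rintegral_ge0 => // t _; exact: gauss_ge0. Qed.

Lemma gauss_int_sqr : gauss_int ^+ 2 = 2 * pi.
Proof.
have s2 : 0 < Num.sqrt 2 :> R by rewrite sqrtr_gt0.
have c : ccont (fun t => (gauss t)%:C) by exact/ccont_real/gauss_cont.
have := (cint_scale s2 c (cintbleR rintegrable_gauss)).1; rewrite !cintR.
have e t : gauss (Num.sqrt 2 * t) = gauss_fun t.
  by rewrite /gauss /gauss_fun exprMn sqr_sqrtr//; congr expR; field.
under [in RHS]eq_Rintegral do rewrite e.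
have -> : \int[mu]_t gauss_fun t = Num.sqrt pi.
  by rewrite /Rintegral integralT_gauss.
rewrite -/gauss_int -rcM => -[->].
by rewrite exprMn !sqr_sqrtr// pi_ge0.
Qed.

Lemma imagE t : t *i = 1 *i * t%:C :> R[i].
Proof. by apply: complexP; rewrite !cRIE /=; ring. Qed.

Lemma normc_imag t : normc (t *i) = `|t|.
Proof. by rewrite /ComplexField.Normc.normc expr0n add0r sqrtr_sqr. Qed.

Lemma imag_sqr : 1 *i * 1 *i = -1 :> R[i].
Proof. by apply: complexP; rewrite !cRIE /=; ring. Qed.

Definition phase t x : R[i] := cexp (t *i * x%:C).

Lemma normc_phase t x : normc (phase t x) = 1.
Proof. by rewrite /phase normc_cexp cReMr /= mul0r expR0. Qed.

Lemma phaseC t x : phase t x = phase x t.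
Proof. by rewrite /phase (imagE t) (imagE x); congr cexp; ring. Qed.

Lemma phaseD t x y : phase t (x + y) = phase t x * phase t y.
Proof. by rewrite /phase rcD mulrDr cexpD. Qed.

Lemma cder_phase t x : cder (phase t) x (phase t x * t *i).
Proof.
apply: cder_eq (cder_cexp (cderZ (t *i) (cder_id x))) _.
by rewrite mulr1.
Qed.

Lemma cder_phasel t x : cder (phase^~ x) t (phase t x * x *i).
Proof.
have := cder_phase x t; rewrite phaseC.
by rewrite (_ : phase x = phase^~ x)//; apply/funext => y; rewrite phaseC.
Qed.

Lemma ccont_phase t : ccont (phase t).
Proof. exact: ccont_cexp_lin. Qed.

Lemma ccont_gauss_phase w : ccont (fun t => (gauss t)%:C * phase w t).
Proof. by apply: ccontM; [exact/ccont_real/gauss_cont|exact: ccont_phase]. Qed.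

Lemma cintble_gauss_phase w : cintble (fun t => (gauss t)%:C * phase w t).
Proof.
apply: (cintble_le _ rintegrable_gauss) => [|t].
  exact/cmeas_ccont/ccont_gauss_phase.
by rewrite normcM normc_real normc_phase mulr1 ger0_norm ?gauss_ge0.
Qed.

Lemma gauss_cvg0 : gauss n%:R @[n --> \oo] --> (0 : R).
Proof.
have h n : gauss n%:R <= expR 2^-1 * expR (- (1 * n%:R)).
  rewrite -expRD ler_expR.
  have := sqr_ge0 (n%:R - 1 : R); rewrite sqrrB1; lra.
have c : expR 2^-1 * expR (- (1 * n%:R)) @[n --> \oo] --> (0 : R).
  by rewrite -(mulr0 (expR 2^-1)); apply: cvgM; [exact: cvg_cst|exact: expR_abs_cvg0].
have [|//] := @ccvg0_le R (fun n => (gauss n%:R)%:C) _ _ c.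
by move=> n; rewrite normc_real ger0_norm ?gauss_ge0.
Qed.

(** Integration by parts gives [K' = - w K], so [K(w) e^{w^2/2}] is constant and equal to its value
    at 0. *)
Lemma gauss_fourier w : cint (fun t => (gauss t)%:C * phase w t) = (gauss w * gauss_int)%:C.
Proof.
pose K w := cint (fun t => (gauss t)%:C * phase w t).
pose M w := cint (fun t => (gauss t)%:C * (phase w t * t *i)).
have nM v t : normc ((gauss t)%:C * (phase v t * t *i)) <= `|t| * gauss t.
  rewrite normcM normcM normc_phase normc_real mul1r ger0_norm ?gauss_ge0// mulrC.
  by rewrite ler_wpM2r ?gauss_ge0// normc_imag.
have iM v : cintble (fun t => (gauss t)%:C * (phase v t * t *i)).
  apply: (cintble_le _ rintegrable_mul_gauss) => [|t].
    apply: cmeas_ccont; apply: ccontM; first exact/ccont_real/gauss_cont.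
    apply: ccontM; first exact: ccont_phase.
    by split => x; [exact: cvg_cst|exact: cvg_id].
  exact: nM.
have dK v : cder K v (M v).
  have vv : v - 1 < v < v + 1 by apply/andP; split; lra.
  apply: (@cder_cint R (fun w t => (gauss t)%:C * phase w t)
    (fun w t => (gauss t)%:C * (phase w t * t *i)) v _ _ _ vv _ _ rintegrable_mul_gauss).
  - by move=> x _; exact: cintble_gauss_phase.
  - by move=> x t _; apply: cderZ; exact: cder_phasel.
  - by move=> x t _; exact: nM.
have ME v : M v = - v%:C * K v.
  have h t := cderM (cder_real (rder_gauss t)) (cder_phase v t).
  pose f t := 1 *i * ((gauss t)%:C * (phase v t * t *i)) + v *i * ((gauss t)%:C * phase v t).
  have i1 := cintbleZ (1 *i) (iM v).
  have i2 := cintbleZ (v *i) (cintble_gauss_phase v).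
  have f0 : cint f = 0.
    apply: (cint_cder0 (F := fun t => (gauss t)%:C * phase v t)).
    - move=> t; apply: cder_eq (h t) _.
      rewrite /f rcM rcN (imagE t); have := imag_sqr; move: (1 *i) => i1' ii.
      transitivity (i1' * i1' * (gauss t)%:C * phase v t * t%:C + v *i * ((gauss t)%:C * phase v t)).
        by rewrite ii; ring.
      ring.
    - apply: ccontD.
        apply: ccontZ.
        apply: ccontM; first exact/ccont_real/gauss_cont.
        apply: ccontM; first exact: ccont_phase.
        by split => x; [exact: cvg_cst|exact: cvg_id].
      exact/ccontZ/ccont_gauss_phase.
    - exact: cintbleD.
    - apply: (ccvg0_le _ gauss_cvg0) => n.
      by rewrite normcM normc_phase mulr1 normc_real ger0_norm ?gauss_ge0.
    - apply: (ccvg0_le _ gauss_cvg0) => n.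
      by rewrite normcM normc_phase mulr1 normc_real ger0_norm ?gauss_ge0// /gauss sqrrN.
  move: f0; rewrite cintD// !cintZ// ?iM// => [f0|]; last exact: cintble_gauss_phase.
  have {f0} : 1 *i * (M v + v%:C * K v) = 0 by rewrite mulrDr mulrA -imagE.
  move=> /eqP; rewrite mulf_eq0 => /orP[/eqP e|]; last by rewrite addr_eq0 mulNr => /eqP.
  by have := imag_sqr; rewrite e mul0r => /eqP; rewrite eq_sym oppr_eq0 oner_eq0.
pose G v := K v * (expR (v ^+ 2 / 2))%:C.
have dG v : cder G v 0.
  have h := rder_comp (is_derive_expR _) (rderM (rderM (rder_id v) (rder_id v)) (rder_cst 2^-1 v)).
  apply: (cder_ext (f := fun t => K t * (expR (t * t / 2))%:C)) => [t|]; first by rewrite /G expr2.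
  apply: cder_eq (cderM (dK v) (cder_real h)) _.
  by rewrite ME !(rcM, rcD, rcV); field.
have GE : G w = G 0.
  (* Constancy is available on the positive half-line only; translating by [s] brings both 0 and [w]
     into it. *)
  pose s := `|w| + 1.
  have ws : 0 < w + s by have := ler_norm (- w); rewrite normrN /s; lra.
  have s0 : 0 < s by rewrite /s ltr_wpDl.
  have := @cder_cst_itv R (fun t => G (t - s)) (w + s) s _ ws s0.
  rewrite addrK subrr; apply => t _.
  have := @cder_comp R G (fun t => t - s) t _ _ (dG (t - s)) (rderB (rder_id t) (rder_cst s t)).
  by rewrite mul0r.
have G0 : G 0 = gauss_int%:C.
  rewrite /G expr0n mul0r expR0 mulr1 /K -cintR; apply: eq_cint => t.
  by rewrite /phase (_ : 0 *i = 0)// mul0r cexp0 mulr1.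
have : K w * (expR (w ^+ 2 / 2))%:C = gauss_int%:C by rewrite -G0 -GE.
move=> /(congr1 (fun z => z * (gauss w)%:C)); rewrite -mulrA -rcM /gauss -expRD subrr expR0 mulr1.
by rewrite -rcM mulrC.
Qed.

End gaussian.

Section inversion.
Context {R : realType}.
Local Notation mu := (@lebesgue_measure R).
Implicit Types (x t w k xi : R).

Lemma phaseE t x : phase t x = cexp ((t * x) *i).
Proof. by rewrite /phase (imagE (t * x)) imagE rcM mulrA. Qed.

Lemma cmeas_phase d (T : measurableType d) (f g : T -> R) :
  measurable_fun setT f -> measurable_fun setT g -> cmeas (fun z => phase (f z) (g z)).
Proof.
move=> mf mg; apply: cmeas_cexp; apply: cmeasM; last exact: cmeas_real.
by split => //; exact: measurable_cst.
Qed.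

Lemma ccont_phasel x : ccont (fun t => phase t x).
Proof. by apply: ccont_cder => t; eexists; exact: cder_phasel. Qed.

Variables (h : R -> R) (B xi : R).
Hypotheses (h_cont : continuous h) (h_int : rintegrable h) (h_bound : forall u, `|h u| <= B).
Let H t := cint (fun u => (h u)%:C * phase t u).
Hypothesis H_int : cintble H.

Let h_phase_int t : cintble (fun u => (h u)%:C * phase t u).
Proof.
apply: (cintble_le _ (rintegrable_norm h_int)) => [|u].
  by apply: cmeas_ccont; apply: ccontM; [exact: ccont_real|exact: ccont_phase].
by rewrite normcM normc_real normc_phase mulr1.
Qed.

(* Fubini moves the regularizing Gaussian onto [h], where it becomes the
   approximate identity [e^-1 gauss ((u - xi) / e)]. *)
Let regularized e : 0 < e ->
  cint (fun t => (gauss (e * t))%:C * (H t * phase t (- xi))) =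
  cint (fun v => (h (e * v + xi) * gauss v * gauss_int)%:C).
Proof.
move=> e0; have eC := rc_neq0 e0.
have mh := rintegrable_meas h_int.
have mg : measurable_fun setT (@gauss R) by apply: continuous_measurable_fun; exact: gauss_cont.
have ce k : continuous (fun v : R => k * v).
  by move=> v; apply: cvgM; [exact: cvg_cst|exact: cvg_id].
pose f t u := (gauss (e * t) * h u)%:C * phase t (u - xi).
have gi : rintegrable (fun t => gauss (e * t)).
  have := (cint_scale e0 (ccont_real gauss_cont) (cintbleR rintegrable_gauss)).2.
  by case.
pose S := \int[mu]_u `|h u|.
have [|||||_] := @cFubini_int R f (fun t u => gauss (e * t) * `|h u|) (fun t => gauss (e * t) * S) _ _ _ _ _.
- apply: cmeasM.
    apply: cmeas_real; apply: measurable_funM.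
      apply: measurableT_comp mg _; apply: measurable_funM => //.
    exact: measurableT_comp mh _.
  by apply: cmeas_phase => //; exact: measurable_funB.
- by move=> t; exact/rintegrableZ/rintegrable_norm.
- by move=> t u; rewrite normcM normc_phase mulr1 normc_real normrM (ger0_norm (gauss_ge0 _)).
- by move=> t; rewrite RintegralZl//; exact: rintegrable_norm.
- by apply: rintegrable_ext (rintegrableZ S gi) => t; rewrite mulrC.
have -> : (fun t => cint (f t)) = (fun t => (gauss (e * t))%:C * (H t * phase t (- xi))).
  apply/funext => t; rewrite /H -cintZr// -cintZ; last exact: cintbleZr.
  by apply: eq_cint => u; rewrite /f rcM phaseD; ring.
move=> ->.
have inner u : cint (fun t => f t u) = (h u * (e^-1 * (gauss ((u - xi) / e) * gauss_int)))%:C.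
  have i1 : cintble (fun t => (gauss (e * t))%:C * phase t (u - xi)).
    apply: (cintble_le _ gi) => [|t].
      by apply: cmeasM; [exact: (cmeas_real (rintegrable_meas gi))|exact/cmeas_ccont/ccont_phasel].
    by rewrite normcM normc_phase mulr1 normc_real ger0_norm ?gauss_ge0.
  transitivity ((h u)%:C * cint (fun t => (gauss (e * t))%:C * phase t (u - xi))).
    by rewrite -cintZ//; apply: eq_cint => t; rewrite /f rcM; ring.
  rewrite rcM rcM; congr (_ * _).
  rewrite -gauss_fourier (cint_scale e0 (ccont_gauss_phase _) (cintble_gauss_phase _)).1.
  rewrite rcV mulKf//; apply: eq_cint => t; rewrite !phaseE.
  by congr (_ * cexp (_ *i)); field; rewrite gt_eqF.
rewrite (eq_cint inner).
pose q u := (h u * (e^-1 * (gauss ((u - xi) / e) * gauss_int)))%:C.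
have cq : ccont q.
  apply: ccont_real => u; apply: cvgM; first exact: h_cont.
  apply: cvgM; first exact: cvg_cst.
  apply: cvgM; last exact: cvg_cst.
  apply: (@continuous_comp _ _ _ (fun u => (u - xi) / e) (@gauss R)); last exact: gauss_cont.
  by apply: cvgM; [apply: cvgB; [exact: cvg_id|exact: cvg_cst]|exact: cvg_cst].
have iq : cintble q.
  apply: cintbleR; apply: (rintegrable_le _ (rintegrableZ (e^-1 * gauss_int) (rintegrable_norm h_int))).
    by apply: continuous_measurable_fun; case: cq.
  move=> u; rewrite !normrM (ger0_norm gauss_int_ge0) (ger0_norm (gauss_ge0 _)).
  have ei : 0 <= e^-1 by rewrite invr_ge0 ltW.
  rewrite (ger0_norm ei) [leRHS]mulrC ler_wpM2l// ler_wpM2l//.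
  by rewrite ler_piMl ?gauss_int_ge0 ?gauss_le1.
have [<- iqs] := cint_shift xi cq.
have cqs : ccont (fun t => q (t + xi)).
  by apply: ccont_comp cq _ => t; apply: cvgD; [exact: cvg_id|exact: cvg_cst].
rewrite (cint_scale e0 cqs (iqs.2 iq)).1 -cintZ; last first.
  exact: (cint_scale e0 cqs (iqs.2 iq)).2.
by apply: eq_cint => v; rewrite /q -rcM; congr _%:C; rewrite addrK (mulrC e v) mulfK ?gt_eqF//; field; rewrite gt_eqF.
Qed.

(** Both sides of [regularized] converge as the width tends to 0: the left one under the bound by
    the integrable [H], the right one by continuity and boundedness of [h]. *)
Lemma fourier_inversion : cint (fun t => H t * phase t (- xi)) = (2 * pi * h xi)%:C.
Proof.
pose e n : R := n.+1%:R^-1.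
have e_cvg : e n @[n --> \oo] --> (0 : R) by exact: cvg_harmonic.
have e0 n : 0 < e n by rewrite invr_gt0.
have mH : cmeas (fun t => H t * phase t (- xi)).
  by apply: cmeasM; [exact: cintble_meas|exact/cmeas_ccont/ccont_phasel].
have [||||_ c1] := @cDCT R (fun n t => (gauss (e n * t))%:C * (H t * phase t (- xi)))
  (fun t => H t * phase t (- xi)) (fun t => normc (H t)).
- move=> n; apply: cmeasM mH; apply: cmeas_ccont; apply: ccont_real => t.
  apply: (@continuous_comp _ _ _ (fun t => e n * t) (@gauss R)); last exact: gauss_cont.
  by apply: cvgM; [exact: cvg_cst|exact: cvg_id].
- exact: cintble_normc.
- move=> n t; rewrite !normcM normc_phase mulr1 normc_real ger0_norm ?gauss_ge0//.
  by rewrite ler_piMl ?normc_ge0 ?gauss_le1.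
- move=> t; rewrite -[X in ccvg _ X]mul1r; apply: ccvgM; last exact: ccvg_cst.
  apply: ccvg_real; rewrite (_ : 1 = gauss (0 * t)); last first.
    by rewrite mul0r /gauss expr0n mul0r oppr0 expR0.
  apply: (@continuous_cvg _ _ _ _ _ e (fun e : R => gauss (e * t))) => //.
  apply: (@continuous_comp R R R (fun k => k * t) (@gauss R)); last exact: gauss_cont.
  by apply: cvgM; [exact: cvg_id|exact: cvg_cst].
have [||||_ c2] := @cDCT R (fun n v => (h (e n * v + xi) * gauss v * gauss_int)%:C)
  (fun v => (h xi * gauss v * gauss_int)%:C) (fun v => B * `|gauss_int| * gauss v).
- move=> n; apply/cmeas_ccont/ccont_real => v.
  apply: cvgM; last exact: cvg_cst.
  apply: cvgM; last exact: gauss_cont.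
  apply: (@continuous_comp _ _ _ (fun v => e n * v + xi) h); last exact: h_cont.
  by apply: cvgD; [apply: cvgM; [exact: cvg_cst|exact: cvg_id]|exact: cvg_cst].
- exact/rintegrableZ/rintegrable_gauss.
- move=> n v; rewrite normc_real !normrM (ger0_norm (gauss_ge0 v)) mulrAC.
  by rewrite ler_wpM2r ?gauss_ge0// ler_wpM2r.
- move=> v; apply: ccvg_real; apply: cvgM; last exact: cvg_cst.
  apply: cvgM; last exact: cvg_cst.
  apply: (@continuous_cvg _ _ _ _ _ (fun n => e n * v + xi) h); first exact: h_cont.
  rewrite -[X in _ --> X]add0r -[X in _ --> X + _](mul0r v).
  by apply: cvgD; [apply: cvgM; [|exact: cvg_cst]|exact: cvg_cst].
have -> : (2 * pi * h xi)%:C = cint (fun v => (h xi * gauss v * gauss_int)%:C).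
  rewrite -gauss_int_sqr cintR; congr _%:C.
  transitivity (\int[mu]_v (h xi * gauss_int * gauss v)).
    by rewrite RintegralZl//; [rewrite -/gauss_int; ring|exact: rintegrable_gauss].
  by apply: eq_Rintegral => v _; ring.
apply: ccvg_uniq c1 _; apply: ccvg_ext c2 => n.
by rewrite regularized.
Qed.

End inversion.

(** * Integrability in [tau] and the two transforms *)

Section transforms.
Context {R : realType}.
Local Notation mu := (@lebesgue_measure R).
Implicit Types (x m tau xi : R) (P : nat -> R -> R).

(** Measurability in [tau] is extracted from Fubini: the weight [1 / (1 + tau^2)] makes the kernel
    jointly integrable and is divided out afterwards. *)
Lemma cmeas_I p x : tame p -> 0 < x -> cmeas (I p x).
Proof.
move=> tp x0; pose h u := p (x * ch2 u).
have hi : rintegrable h := rintegrable_tame tp x0.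
have mh : measurable_fun setT h := rintegrable_meas hi.
pose q (t : R) := (1 + t ^+ 2)^-1.
have mq : measurable_fun setT q := rintegrable_meas rintegrable_oneDsqrV.
have q0 t : 0 < q t by rewrite invr_gt0 ltr_pwDl ?sqr_ge0.
pose S := \int[mu]_u `|h u|.
have [|||||i _] := @cFubini_int R (fun t u => (q t)%:C * kI p x t u)
   (fun t u => q t * `|h u|) (fun t => q t * S) _ _ _ _ _.
- apply: cmeasM; first exact/cmeas_real/measurableT_comp.
  apply: cmeasM; first exact/cmeas_real/(measurableT_comp mh).
  exact: (cmeas_phase measurable_fst measurable_snd).
- by move=> t; exact/rintegrableZ/rintegrable_norm.
- by move=> t u; rewrite normcM normc_kI normc_real gtr0_norm.
- by move=> t; rewrite RintegralZl//; exact: rintegrable_norm.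
- by apply: rintegrable_ext (rintegrableZ S rintegrable_oneDsqrV) => t; rewrite mulrC.
have -> : I p x = (fun t => (1 + t ^+ 2)%:C * cint (fun u => (q t)%:C * kI p x t u)).
  apply/funext => t; rewrite cintZ; last exact: cintble_kI.
  by rewrite mulrA -rcM /q divff ?mul1r// lt0r_neq0// ltr_pwDl ?sqr_ge0.
apply: cmeasM; last exact: cintble_meas.
apply/cmeas_ccont/ccont_real => t; apply: cvgD; first exact: cvg_cst.
by rewrite expr2; apply: cvgM; exact: cvg_id.
Qed.

Lemma I_bounded p x : tame p -> 0 < x ->
  exists2 B, 0 <= B & forall tau, normc (I p x tau) <= B.
Proof.
move=> tp x0; exists (2 * \int[mu]_u `|p (x * ch2 u)|).
  by rewrite mulr_ge0// Rintegral_ge0.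
move=> tau; apply: normc_cint_le; first exact/cmeas_ccont/ccont_kI.
  exact/rintegrable_norm/rintegrable_tame.
by move=> u; rewrite normc_kI.
Qed.

(* The three-term relation trades a factor [tau ^+ 2] for a shift of the parameter. *)
Lemma cintble_I m P x : represents m P -> 0 < x -> cintble (I (P 0%N) x).
Proof.
move=> hP x0; have [P1 h1] := representsP (m + 1); have [P2 h2] := representsP (m + 2).
have t0 (n : R) Q : represents n Q -> tame (Q 0%N) by move=> [h _ _]; exists Q.
have [B0 B00 b0] := I_bounded (t0 _ _ hP) x0.
have [B1 B10 b1] := I_bounded (t0 _ _ h1) x0.
have [B2 B20 b2] := I_bounded (t0 _ _ h2) x0.
apply: (cintble_le _ (rintegrableZ (B0 + (`|x - 2 * (m + 1)| * B1 + B2)) rintegrable_oneDsqrV)).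
  exact: (cmeas_I (t0 _ _ hP) x0).
move=> t; have t1 : 0 < 1 + t ^+ 2 by rewrite ltr_pwDl ?sqr_ge0.
(* Of [1 + t^2], the term 1 is covered by boundedness, and [t^2] is at most the coefficient
   [(m + 1/2)^2 + t^2] of the recurrence. *)
rewrite ler_pdivlMr// mulrDr mulr1; apply: lerD; first exact: b0.
have := I_3term t hP h1 h2 x0.
move: (b1 t) (b2 t); move: (I (P2 0%N) x t) (I (P1 0%N) x t) (I (P 0%N) x t) => I2 I1 I0' hb1 hb2 e.
apply: (@le_trans _ _ (normc (((m + 2^-1) ^+ 2 + t ^+ 2)%:C * I0'))).
  rewrite normcM normc_real mulrC ger0_norm ?addr_ge0 ?sqr_ge0//.
  by rewrite ler_wpM2r ?normc_ge0// lerDr sqr_ge0.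
rewrite (_ : _ * _ = (x - 2 * (m + 1))%:C * I1 - I2); last by rewrite e; ring.
apply: le_trans (normcD _ _) _; rewrite normcN normcM normc_real.
by apply: lerD => //; rewrite ler_wpM2l.
Qed.

Lemma I_inversion m P x xi : represents m P -> 0 < x ->
  cintble (fun tau => I (P 0%N) x tau * phase tau (- xi)) /\
  cint (fun tau => I (P 0%N) x tau * phase tau (- xi)) = (2 * pi * P 0%N (x * ch2 xi))%:C.
Proof.
move=> hP x0; have iI := cintble_I hP x0; have [tP _ _] := hP.
have tp : tame (P 0%N) by exists P.
split.
  apply: (cintble_le _ (cintble_normc iI)) => [|t]; last by rewrite normcM normc_phase mulr1.
  by apply: cmeasM; [exact: cintble_meas|exact/cmeas_ccont/ccont_phasel].
have [C C0 hC] := tame_bound tp x0.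
apply: (@fourier_inversion R (fun u => P 0%N (x * ch2 u)) C) => //.
- exact: tame_ch2_cont.
- exact: rintegrable_tame.
- move=> u; apply: le_trans (hC u) _; rewrite ler_piMr// -expR0 ler_expR oppr_le0.
  by rewrite mulr_ge0 ?divr_ge0 ?ltW// ch2_gt0.
Qed.

Lemma whittaker_transform m x xi : 0 < x ->
  let f tau := whittakerW m%:C (tau *i) x * cexp ((- (tau * xi)) *i) in
  cintble f /\
  cint f = (2 `^ (- m) * Num.sqrt (pi * x) * expR (x / 4 * (1 - cosh xi)))%:C
       * parabolicD (2 * m)%:C (Num.sqrt (2 * x) * cosh (xi / 2)).
Proof.
move=> x0 f; have [P hP] := representsP m.
have [i e] := I_inversion xi hP x0.
pose K : R := Num.sqrt x * expR (x / 2) / (2 * Num.sqrt pi).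
have fE : f = (fun tau => K%:C * (I (P 0%N) x tau * phase tau (- xi))).
  by apply/funext => t; rewrite /f (whittaker_I t hP x0) phaseE mulrN mulrA.
rewrite fE; split; first exact: cintbleZ.
rewrite cintZ// e (parabolic_P xi hP x0) -!rcM; congr _%:C.
have p2 : 2 `^ (- m) * 2 `^ m = 1 :> R.
  by rewrite -powRD ?addNr ?powRr0// pnatr_eq0 implybT.
(* As [ch2 xi = (1 + cosh xi) / 2], the terms in [cosh xi] cancel. *)
have ee : expR (x / 4 * (1 - cosh xi)) * expR (x * ch2 xi / 2) = expR (x / 2).
  by rewrite -expRD cosh_ch2; congr expR; field.
have sp : 0 < Num.sqrt pi :> R by rewrite sqrtr_gt0 pi_gt0.
transitivity (Num.sqrt x * Num.sqrt pi * expR (x / 2) * P 0%N (x * ch2 xi)).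
  by rewrite /K -[in 2 * pi](@sqr_sqrtr _ pi) ?pi_ge0//; field; rewrite gt_eqF.
rewrite -ee sqrtrM ?pi_ge0//.
transitivity ((2 `^ (- m) * 2 `^ m) * Num.sqrt x * Num.sqrt pi *
  (expR (x / 4 * (1 - cosh xi)) * expR (x * ch2 xi / 2)) * P 0%N (x * ch2 xi)); last by ring.
by rewrite p2; ring.
Qed.

Lemma parabolic_transform m x tau : 0 < x ->
  let f xi := (expR (- (x / 4) * cosh xi))%:C
     * parabolicD (2 * m)%:C (Num.sqrt (2 * x) * cosh (xi / 2))
     * cexp ((tau * xi) *i) in
  cintble f /\
  whittakerW m%:C (tau *i) x =
    (Num.sqrt (x / pi) * (expR (x / 4) / 2 `^ (m + 1)))%:C * cint f.
Proof.
move=> x0 f; have [P hP] := representsP m; have [tP _ _] := hP.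
have tp : tame (P 0%N) by exists P.
pose K : R := 2 `^ m * expR (x / 4).
have fE : f = (fun xi => K%:C * kI (P 0%N) x tau xi).
  apply/funext => xi; rewrite /f (parabolic_P xi hP x0) -phaseE /phase /kI mulrA -!rcM.
  congr (_%:C * _).
  rewrite /K; have -> : expR (x / 4) = expR (- (x / 4) * cosh xi) * expR (x * ch2 xi / 2).
    by rewrite -expRD cosh_ch2; congr expR; field.
  ring.
rewrite fE; split; first exact/cintbleZ/cintble_kI.
rewrite cintZ; last exact: cintble_kI.
rewrite (whittaker_I tau hP x0) mulrA -rcM; congr (_%:C * _).
have p2 : 0 < 2 `^ m :> R by rewrite powR_gt0.
have sp : 0 < Num.sqrt pi :> R by rewrite sqrtr_gt0 pi_gt0.
rewrite powRD ?pnatr_eq0 ?implybT// powRr1// sqrtrM ?ltW// sqrtrV ?pi_ge0//.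
have -> : expR (x / 2) = expR (x / 4) * expR (x / 4).
  by rewrite -expRD; congr expR; field.
by rewrite /K; field; rewrite !gt_eqF.
Qed.

End transforms.

Unset Implicit Arguments.

Theorem lemma3p1 (R : realType) (mu x : R) (x_gt0 : 0 < x) :
  (forall xi : R,
     cintegrable setT (fun tau : R =>
       whittakerW mu%:C (tau *i) x * cexp ((- (tau * xi)) *i)) /\
     cintegral setT (fun tau : R =>
       whittakerW mu%:C (tau *i) x * cexp ((- (tau * xi)) *i))
     = (powR 2 (- mu) * Num.sqrt (pi * x) * expR (x / 4 * (1 - cosh xi)))%:C
       * parabolicD (2 * mu)%:C (Num.sqrt (2 * x) * cosh (xi / 2))) /\
  (forall tau : R,
     cintegrable setT (fun xi : R =>
       (expR (- (x / 4) * cosh xi))%:C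
       * parabolicD (2 * mu)%:C (Num.sqrt (2 * x) * cosh (xi / 2))
       * cexp ((tau * xi) *i)) /\
     whittakerW mu%:C (tau *i) x
     = (Num.sqrt (x / pi) * (expR (x / 4) / powR 2 (mu + 1)))%:C
       * cintegral setT (fun xi : R =>
           (expR (- (x / 4) * cosh xi))%:C
           * parabolicD (2 * mu)%:C (Num.sqrt (2 * x) * cosh (xi / 2))
           * cexp ((tau * xi) *i))).
Proof.
split => [xi|tau]; first exact: whittaker_transform.
exact: parabolic_transform.
Qed.
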